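(* Let $(A,m)$ be a Frobenius 3-structure in a monoidal category that satisfies sliding. 1. Any Frobenius 3-structure diagram for $(A,m)$ with at least one input is equal (as a morphism) to one in normal form after bending at most one input and/or at most one output. 2. If moreover the monoidal category is symmetric and $(A,m)$ is commutative, then any commutative Frobenius 3-structure diagram for $(A,m)$ is equivalent to one in normal form.
   Context: Monoidal categories are treated as strict. **Frobenius 3-structures.** A Frobenius 3-structure consists of two-sided dual objects $A$, $A^*$ and a morphism $m\colon A\otimes A^*\otimes A\to A$ as follows. The duality is given by morphisms $\eta\colon I\to A^*\otimes A$, $\varepsilon\colon A\otimes A^*\to I$, $\eta'\colon I\to A\otimes A^*$, $\varepsilon'\colon A^*\otimes A\to I$ with - $(\varepsilon\otimes\mathrm{id}_A)(\mathrm{id}_A\otimes\eta)=\mathrm{id}_A$ and $(\mathrm{id}_{A^*}\otimes\varepsilon)(\eta\otimes\mathrm{id}_{A^*})=\mathrm{id}_{A^*}$, - $(\varepsilon'\otimes\mathrm{id}_{A^*})(\mathrm{id}_{A^*}\otimes\eta')=\mathrm{id}_{A^*}$ and $(\mathrm{id}_A\otimes\varepsilon')(\eta'\otimes\mathrm{id}_A)=\mathrm{id}_A$. The morphism $m$ satisfies associativity $m\circ(\mathrm{id}_A\otimes\mathrm{id}_{A^*}\otimes m)=m\circ(m\otimes\mathrm{id}_{A^*}\otimes\mathrm{id}_A)$ and symmetry, i.e. the two morphisms $A\to A\otimes A^*\otimes A$ $$(m\otimes\mathrm{id}_{A^*}\otimes\mathrm{id}_A)(\mathrm{id}_A\otimes\mathrm{id}_{A^*}\otimes\eta'\otimes\mathrm{id}_A)(\mathrm{id}_A\otimes\eta)\quad\text{and}\quad(\mathrm{id}_A\otimes\mathrm{id}_{A^*}\otimes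 m)(\mathrm{id}_A\otimes\eta\otimes\mathrm{id}_{A^*}\otimes\mathrm{id}_A)(\eta'\otimes\mathrm{id}_A)$$ are equal. Their common value is the comultiplication $w$. **Loops and sliding.** The left loop is $\lambda=m\circ(\eta'\otimes\mathrm{id}_A)$ and the right loop is $\rho=m\circ(\mathrm{id}_A\otimes\eta)$; these commute. Sliding means $m\circ(\rho\otimes\mathrm{id}_{A^*}\otimes\mathrm{id}_A)=\rho\circ m$ and $m\circ(\mathrm{id}_A\otimes\mathrm{id}_{A^*}\otimes\lambda)=\lambda\circ m$. **Commutativity.** In a symmetric monoidal category with symmetry $\sigma$, the structure is commutative when $m=m\circ\tau$, where $\tau$ is the symmetry exchanging the first and third factors of $A\otimes A^*\otimes A$, and $A$, $A^*$ are symmetric duals, i.e. $\varepsilon=\varepsilon'\circ\sigma$. **Diagrams.** A Frobenius 3-structure diagram is a finite (nonempty) connected string diagram built from the pieces $m,w,\eta,\eta',\varepsilon,\varepsilon'$ using identities, composition and tensor products. A commutative Frobenius 3-structure diagram may in addition use the symmetries among copies of $A$ and $A^*$. Inputs and outputs are the tensor factors ($A$ or $A^*$) of the domain and codomain. **Bending and equivalence.** Bending an output of $f$ means turning it into an input (of the dual type) by composing with one of $\varepsilon,\varepsilon'$; bending an input means turning it into an output (of the dual type) by composing with one of $\eta,\eta'$. In a general monoidal category (part 1) this is applied to an outermost (leftmost or rightmost) leg; in the symmetric case any leg may be bent, using symmetries. Two commutative diagrams are equivalent when they can be obtained from one another by bending any number of inputs and outputs and applying symmetry maps. **Normal forms.**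 Define $m_0=\mathrm{id}_A$ and $m_{p+1}=m\circ(m_p\otimes\mathrm{id}_{A^*}\otimes\mathrm{id}_A)\colon A\otimes(A^*\otimes A)^{\otimes (p+1)}\to A$, and similarly $w_0=\mathrm{id}_A$ and $w_{q+1}=(w_q\otimes\mathrm{id}_{A^*}\otimes\mathrm{id}_A)\circ w$. A diagram with domain $A\otimes(A^*\otimes A)^{\otimes p}$ and codomain $A\otimes(A^*\otimes A)^{\otimes q}$ is in normal form when it equals $w_q\circ\rho^{k'}\circ\lambda^{k}\circ m_p$ for some natural numbers $k,k'$. In the commutative case $\lambda=\rho$, and a diagram with no inputs and no outputs is regarded as in normal form when it equals $\varepsilon\circ(\lambda^k\otimes\mathrm{id}_{A^*})\circ\eta'$ for some $k$. *)

(* Defs.v *)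
From mathcomp Require Import all_boot.

Set Implicit Arguments.
Unset Strict Implicit.
Unset Printing Implicit Defensive.

(* Strict monoidal categories are presented with a single type of morphisms
   (categories internal to monoids), so that the strictness laws are plain
   equations between objects and between morphisms.  [compm g f] is g after f;
   it is a total function, but all laws about it assume composability, so its
   value at non-composable pairs carries no information. *)
Record smcat : Type := SMCat {
  ob : Type;
  mor : Type;
  dom : mor -> ob;
  cod : mor -> ob;
  idm : ob -> mor;
  compm : mor -> mor -> mor;
  unito : ob;
  tenso : ob -> ob -> ob;
  tensm : mor -> mor -> mor;
  dom_idm : forall a, dom (idm a) = a;
  cod_idm : forall a, cod (idm a) = a;
  dom_compm : forall g f, cod f = dom g -> dom (compm g f) = dom f;
  cod_compm : forall g f, cod f = dom g -> cod (compm g f) = cod g;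
  comp1m : forall f, compm (idm (cod f)) f = f;
  compm1 : forall f, compm f (idm (dom f)) = f;
  compmA : forall h g f, cod f = dom g -> cod g = dom h ->
    compm h (compm g f) = compm (compm h g) f;
  tensoA : forall a b c, tenso a (tenso b c) = tenso (tenso a b) c;
  tens1o : forall a, tenso unito a = a;
  tenso1 : forall a, tenso a unito = a;
  dom_tensm : forall f g, dom (tensm f g) = tenso (dom f) (dom g);
  cod_tensm : forall f g, cod (tensm f g) = tenso (cod f) (cod g);
  tensmA : forall f g h, tensm f (tensm g h) = tensm (tensm f g) h;
  tens1m : forall f, tensm (idm unito) f = f;
  tensm1 : forall f, tensm f (idm unito) = f;
  tensm_idm : forall a b, tensm (idm a) (idm b) = idm (tenso a b);
  tensm_compm : forall g f g' f', cod f = dom g -> cod f' = dom g' ->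
    tensm (compm g f) (compm g' f') = compm (tensm g g') (tensm f f')
}.

Declare Scope smc_scope.
Delimit Scope smc_scope with smc.
Notation "a ⊠ b" := (tenso a b) (at level 38, left associativity) : smc_scope.
Notation "f ⊗ g" := (tensm f g) (at level 38, left associativity) : smc_scope.
Notation "g ∘ f" := (compm g f) (at level 40, left associativity) : smc_scope.
Local Open Scope smc_scope.

Definition is_hom (C : smcat) (a b : ob C) (f : mor C) : Prop :=
  dom f = a /\ cod f = b.

Record symmetry (C : smcat) : Type := Symmetry {
  sym : ob C -> ob C -> mor C;
  sym_hom : forall a b, is_hom (a ⊠ b) (b ⊠ a) (sym a b);
  sym_natural : forall f g,
    sym (cod f) (cod g) ∘ (f ⊗ g) = (g ⊗ f) ∘ sym (dom f) (dom g);
  sym_inv : forall a b, sym b a ∘ sym a b = idm (a ⊠ b);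
  sym_hexagon : forall a b c,
    sym (a ⊠ b) c = (sym a c ⊗ idm b) ∘ (idm a ⊗ sym b c)
}.

Record frob3 (C : smcat) : Type := Frob3 {
  fA : ob C;
  fD : ob C; (* the dual object A^* *)
  eta : mor C;
  eps : mor C;
  eta' : mor C;
  eps' : mor C;
  fm : mor C;
  eta_hom : is_hom (unito C) (fD ⊠ fA) eta;
  eps_hom : is_hom (fA ⊠ fD) (unito C) eps;
  eta'_hom : is_hom (unito C) (fA ⊠ fD) eta';
  eps'_hom : is_hom (fD ⊠ fA) (unito C) eps';
  fm_hom : is_hom (fA ⊠ fD ⊠ fA) fA fm;
  snakeA : (eps ⊗ idm fA) ∘ (idm fA ⊗ eta) = idm fA;
  snakeD : (idm fD ⊗ eps) ∘ (eta ⊗ idm fD) = idm fD;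
  snakeD' : (eps' ⊗ idm fD) ∘ (idm fD ⊗ eta') = idm fD;
  snakeA' : (idm fA ⊗ eps') ∘ (eta' ⊗ idm fA) = idm fA;
  fm_assoc :
    fm ∘ (idm fA ⊗ idm fD ⊗ fm) = fm ∘ (fm ⊗ idm fD ⊗ idm fA);
  fm_symmetry :
    (fm ⊗ idm fD ⊗ idm fA) ∘ (idm fA ⊗ idm fD ⊗ eta' ⊗ idm fA)
      ∘ (idm fA ⊗ eta)
    = (idm fA ⊗ idm fD ⊗ fm) ∘ (idm fA ⊗ eta ⊗ idm fD ⊗ idm fA)
      ∘ (eta' ⊗ idm fA)
}.

Section Structure.
Variables (C : smcat) (F : frob3 C).

Definition fw : mor C :=
  (fm F ⊗ idm (fD F) ⊗ idm (fA F))
    ∘ (idm (fA F) ⊗ idm (fD F) ⊗ eta' F ⊗ idm (fA F)) ∘ (idm (fA F) ⊗ eta F).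

Definition lam : mor C := fm F ∘ (eta' F ⊗ idm (fA F)).
Definition rho : mor C := fm F ∘ (idm (fA F) ⊗ eta F).

Definition sliding : Prop :=
  fm F ∘ (rho ⊗ idm (fD F) ⊗ idm (fA F)) = rho ∘ fm F /\
  fm F ∘ (idm (fA F) ⊗ idm (fD F) ⊗ lam) = lam ∘ fm F.

(* x ⊗ y ⊗ z goes to y ⊗ z ⊗ x and then to z ⊗ y ⊗ x. *)
Definition tau (S : symmetry C) : mor C :=
  (sym S (fD F) (fA F) ⊗ idm (fA F)) ∘ sym S (fA F) (fD F ⊠ fA F).

Definition frob3_commutative (S : symmetry C) : Prop :=
  fm F = fm F ∘ tau S /\ eps F = eps' F ∘ sym S (fA F) (fD F).

Fixpoint mpow (p : nat) : mor C :=
  if p is p'.+1 then fm F ∘ (mpow p' ⊗ idm (fD F) ⊗ idm (fA F))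
  else idm (fA F).

Fixpoint wpow (q : nat) : mor C :=
  if q is q'.+1 then (wpow q' ⊗ idm (fD F) ⊗ idm (fA F)) ∘ fw
  else idm (fA F).

Definition endo_pow (f : mor C) (k : nat) : mor C :=
  iter k (compm f) (idm (fA F)).

End Structure.

(* The type of a wire: A or its dual. *)
Inductive leg : Type := LA | LD.

Definition dual (x : leg) : leg := if x is LA then LD else LA.

(* The generators available in string diagrams.  [gstrand g] is the set of
   connected components of the generator g seen as a piece of a diagram;
   [gstrand_in g] and [gstrand_out g] list the components to which its
   successive inputs and outputs belong. *)
Record signature : Type := Signature {
  gen : Type;
  gin : gen -> seq leg;
  gout : gen -> seq leg;
  gstrand : gen -> finType;
  gstrand_in : forall g, seq (gstrand g);
  gstrand_out : forall g, seq (gstrand g)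
}.

Inductive piece : Type := Pm | Pw | Peta | Peta' | Peps | Peps'.

Definition piece_in (g : piece) : seq leg :=
  match g with
  | Pm => [:: LA; LD; LA]
  | Pw => [:: LA]
  | Peta | Peta' => [::]
  | Peps => [:: LA; LD]
  | Peps' => [:: LD; LA]
  end.

Definition piece_out (g : piece) : seq leg :=
  match g with
  | Pm => [:: LA]
  | Pw => [:: LA; LD; LA]
  | Peta => [:: LD; LA]
  | Peta' => [:: LA; LD]
  | Peps | Peps' => [::]
  end.

Definition frob3_sig : signature := {|
  gen := piece;
  gin := piece_in;
  gout := piece_out;
  gstrand := fun _ => unit : finType;
  gstrand_in := fun g => nseq (size (piece_in g)) tt;
  gstrand_out := fun g => nseq (size (piece_out g)) tt
|}.

Inductive cpiece : Type := CPiece of piece | CSym of leg & leg.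

(* A symmetry consists of two crossing wires that do not touch, hence of two
   components: [true] starts at the first input, [false] at the second. *)
Definition cstrand (g : cpiece) : finType :=
  match g with CPiece _ => unit | CSym _ _ => bool end.

Definition cfrob3_sig : signature := {|
  gen := cpiece;
  gin := fun g =>
    match g with CPiece p => piece_in p | CSym x y => [:: x; y] end;
  gout := fun g =>
    match g with CPiece p => piece_out p | CSym x y => [:: y; x] end;
  gstrand := cstrand;
  gstrand_in := fun g =>
    match g return seq (cstrand g) with
    | CPiece p => nseq (size (piece_in p)) tt
    | CSym _ _ => [:: true; false]
    end;
  gstrand_out := fun g =>
    match g return seq (cstrand g) with
    | CPiece p => nseq (size (piece_out p)) tt
    | CSym _ _ => [:: false; true]
    end
|}.

(* [Comp g f] is g after f. *)
Inductive term (G : signature) : Type :=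
| Id of seq leg
| Gen of gen G
| Comp of term G & term G
| Tens of term G & term G.

Section Terms.
Variable G : signature.

Fixpoint tin (t : term G) : seq leg :=
  match t with
  | Id u => u
  | Gen g => gin g
  | Comp _ f => tin f
  | Tens f g => tin f ++ tin g
  end.

Fixpoint tout (t : term G) : seq leg :=
  match t with
  | Id u => u
  | Gen g => gout g
  | Comp g _ => tout g
  | Tens f g => tout f ++ tout g
  end.

Fixpoint well_typed (t : term G) : Prop :=
  match t with
  | Id _ | Gen _ => True
  | Comp g f => [/\ well_typed g, well_typed f & tout f = tin g]
  | Tens f g => well_typed f /\ well_typed g
  end.

(* The graph underlying a string diagram: its nodes are the wires of the
   identities and the components of the generators; composition joins the
   i-th output of the first diagram to the i-th input of the second. *)
Fixpoint node (t : term G) : finType :=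
  match t with
  | Id u => 'I_(size u)
  | Gen g => gstrand g
  | Comp g f => (node f + node g)%type
  | Tens f g => (node f + node g)%type
  end.

Fixpoint node_in (t : term G) : seq (node t) :=
  match t return seq (node t) with
  | Id u => enum 'I_(size u)
  | Gen g => gstrand_in g
  | Comp g f => map inl (node_in f)
  | Tens f g => map inl (node_in f) ++ map inr (node_in g)
  end.

Fixpoint node_out (t : term G) : seq (node t) :=
  match t return seq (node t) with
  | Id u => enum 'I_(size u)
  | Gen g => gstrand_out g
  | Comp g f => map inr (node_out g)
  | Tens f g => map inl (node_out f) ++ map inr (node_out g)
  end.

Fixpoint edge (t : term G) : rel (node t) :=
  match t return rel (node t) with
  | Id _ | Gen _ => fun _ _ => false
  | Comp g f => fun x y =>
      match x, y with
      | inl a, inl b => edge a b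
      | inr a, inr b => edge a b
      | inl a, inr b => (a, b) \in zip (node_out f) (node_in g)
      | inr _, inl _ => false
      end
  | Tens f g => fun x y =>
      match x, y with
      | inl a, inl b => edge a b
      | inr a, inr b => edge a b
      | _, _ => false
      end
  end.

Definition nonempty_connected (t : term G) : Prop :=
  0 < #|node t| /\
  forall x y : node t, connect (fun a b => edge a b || edge b a) x y.

Definition is_diagram (t : term G) : Prop :=
  well_typed t /\ nonempty_connected t.

End Terms.

(* A morphism together with the words of its inputs and outputs: the objects A
   and A^* may coincide, so the words are not determined by the morphism. *)
Record lmor (C : smcat) : Type := LMor {
  lin : seq leg;
  lout : seq leg;
  lval : mor C
}.

Section Interpretation.
Variables (C : smcat) (F : frob3 C).

Definition obj (x : leg) : ob C := if x is LA then fA F else fD F.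

Definition objs (u : seq leg) : ob C :=
  foldr (fun x a => obj x ⊠ a) (unito C) u.

Section Eval.
Variables (G : signature) (I : gen G -> mor C).

Fixpoint eval (t : term G) : mor C :=
  match t with
  | Id u => idm (objs u)
  | Gen g => I g
  | Comp g f => eval g ∘ eval f
  | Tens f g => eval f ⊗ eval g
  end.

Definition denote (t : term G) : lmor C := LMor (tin t) (tout t) (eval t).

End Eval.

Definition piece_mor (g : gen frob3_sig) : mor C :=
  match g with
  | Pm => fm F
  | Pw => fw F
  | Peta => eta F
  | Peta' => eta' F
  | Peps => eps F
  | Peps' => eps' F
  end.

Definition cpiece_mor (S : symmetry C) (g : gen cfrob3_sig) : mor C :=
  match g with
  | CPiece p => piece_mor p
  | CSym x y => sym S (obj x) (obj y)
  end.

(* I -> dual x ⊗ x *)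
Definition cup (x : leg) : mor C := if x is LA then eta F else eta' F.
(* x ⊗ dual x -> I *)
Definition cap (x : leg) : mor C := if x is LA then eps F else eps' F.

(* f : x ⊗ u -> v  becomes  u -> dual x ⊗ v *)
Definition bend_in_left x u (f : mor C) : mor C :=
  (idm (obj (dual x)) ⊗ f) ∘ (cup x ⊗ idm (objs u)).
(* f : u ⊗ x -> v  becomes  u -> v ⊗ dual x *)
Definition bend_in_right u x (f : mor C) : mor C :=
  (f ⊗ idm (obj (dual x))) ∘ (idm (objs u) ⊗ cup (dual x)).
(* f : u -> y ⊗ v  becomes  dual y ⊗ u -> v *)
Definition bend_out_left y v (f : mor C) : mor C :=
  (cap (dual y) ⊗ idm (objs v)) ∘ (idm (obj (dual y)) ⊗ f).
(* f : u -> v ⊗ y  becomes  u ⊗ dual y -> v *)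
Definition bend_out_right v y (f : mor C) : mor C :=
  (idm (objs v) ⊗ cap y) ∘ (f ⊗ idm (obj (dual y))).

Inductive bend_in : lmor C -> lmor C -> Prop :=
| BendInLeft x u v f :
    bend_in (LMor (x :: u) v f) (LMor u (dual x :: v) (bend_in_left x u f))
| BendInRight x u v f :
    bend_in (LMor (rcons u x) v f)
            (LMor u (rcons v (dual x)) (bend_in_right u x f)).

Inductive bend_out : lmor C -> lmor C -> Prop :=
| BendOutLeft y u v f :
    bend_out (LMor u (y :: v) f) (LMor (dual y :: u) v (bend_out_left y v f))
| BendOutRight y u v f :
    bend_out (LMor u (rcons v y) f)
             (LMor (rcons u (dual y)) v (bend_out_right v y f)).

(* Bending at most one outermost input and at most one outermost output of the
   first argument.  When both are bent, the bent output has to be one of the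
   original outputs, and the two legs have to lie on opposite sides, since the
   first leg to be bent on a given side covers the other leg on that side. *)
Inductive bent_at_most_one : lmor C -> lmor C -> Prop :=
| BentNone X : bent_at_most_one X X
| BentIn X Y : bend_in X Y -> bent_at_most_one X Y
| BentOut X Y : bend_out X Y -> bent_at_most_one X Y
| BentInLeftOutRight x y u v f :
    bent_at_most_one (LMor (x :: u) (rcons v y) f)
      (LMor (rcons u (dual y)) (dual x :: v)
         (bend_out_right (dual x :: v) y (bend_in_left x u f)))
| BentInRightOutLeft x y u v f :
    bent_at_most_one (LMor (rcons u x) (y :: v) f)
      (LMor (dual y :: u) (rcons v (dual x))
         (bend_out_left y (rcons v (dual x)) (bend_in_right u x f))).

Definition swap_at (S : symmetry C) u x y v : mor C :=
  idm (objs u) ⊗ sym S (obj x) (obj y) ⊗ idm (objs v).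

(* Symmetries of adjacent legs generate all permutations of the inputs and of
   the outputs, in particular those that bring any leg to an outermost
   position. *)
Inductive bend_or_permute (S : symmetry C) : lmor C -> lmor C -> Prop :=
| StepBendIn X Y : bend_in X Y -> bend_or_permute S X Y
| StepBendOut X Y : bend_out X Y -> bend_or_permute S X Y
| StepSymIn x y u1 u2 v f :
    bend_or_permute S (LMor (u1 ++ x :: y :: u2) v f)
      (LMor (u1 ++ y :: x :: u2) v (f ∘ swap_at S u1 y x u2))
| StepSymOut x y u v1 v2 f :
    bend_or_permute S (LMor u (v1 ++ x :: y :: v2) f)
      (LMor u (v1 ++ y :: x :: v2) (swap_at S v1 x y v2 ∘ f)).

Inductive obtained_from (S : symmetry C) (X : lmor C) : lmor C -> Prop :=
| ObtainedRefl : obtained_from S X X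
| ObtainedStep Y Z :
    obtained_from S X Y -> bend_or_permute S Y Z -> obtained_from S X Z.

Definition equivalent (S : symmetry C) (X Y : lmor C) : Prop :=
  obtained_from S X Y /\ obtained_from S Y X.

Definition nf_word (p : nat) : seq leg :=
  LA :: flatten (nseq p [:: LD; LA]).

Definition normal_form (X : lmor C) : Prop :=
  exists p q k k' : nat,
    X = LMor (nf_word p) (nf_word q)
          (wpow F q ∘ endo_pow F (rho F) k' ∘ endo_pow F (lam F) k ∘ mpow F p).

Definition comm_normal_form (X : lmor C) : Prop :=
  normal_form X \/
  exists k : nat,
    X = LMor [::] [::]
          (eps F ∘ (endo_pow F (lam F) k ⊗ idm (fD F)) ∘ eta' F).

End Interpretation.

(* Main.v *)
(* Bending all inputs of a diagram turns it into a state, a morphism out of the unit.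
   A spider is the state obtained from a cup by applying comultiplications and loops to
   one of its legs.  By the Frobenius identities and sliding, neither the leg nor the
   order matters; contracting two adjacent legs of a spider, or adjacent legs of two
   spiders, gives a spider again.  So the state of a planar diagram is a noncrossing
   collection of spiders, one for each component with legs, and the state of a
   connected diagram with an input is a single spider.  The legs of a spider alternate
   between A and A^*, which tells which legs of the diagram to bend in order to reach
   the normal form.  In the commutative case a spider is moreover invariant under all
   permutations of its A-legs and of its A^*-legs, and states are permuted tensor
   products of spiders, including spiders without legs. *)

From HB Require Import structures.
From mathcomp Require Import all_boot.
Require Import Defs.

Set Implicit Arguments.
Unset Strict Implicit.
Unset Printing Implicit Defensive.

Local Open Scope smc_scope.

(** Three obstacles shape the proof. Interchange has to be invisible in calculations, so local
    diagrams are lists of layers, and lists differing by interchange are compared by computing a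
    sorted form; each local identity is then a short chain of rewrites. Connectedness has to survive
    evaluation, so every leg carries a label: a diagram acts on labelled states by merging labels
    and also labels its own nodes compatibly with its edges, and on a connected diagram such a
    labelling is constant. A planar component is closed when a two-legged spider is capped; its
    label then stays in the list although no leg carries it, which is impossible for a connected
    diagram with an input. Finally, coherence of symmetries is replaced by a canonical isomorphism
    between any two orderings of distinctly named wires: these isomorphisms compose to one another
    and are natural, so an equation between wire permutations only needs its source and target
    orders compared. *)

Definition eq_leg (x y : leg) : bool :=
  match x, y with LA, LA | LD, LD => true | _, _ => false end.
Lemma eq_legP : Equality.axiom eq_leg.
Proof. by case=> [] []; constructor. Qed.
HB.instance Definition _ := hasDecEq.Build leg eq_legP.

Lemma dualK : involutive dual. Proof. by case. Qed.

(** * Words of wires, whiskered morphisms and interchange *)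

Section Words.
Variables (C : smcat) (F : frob3 C).
Implicit Types (u v w a b : seq leg) (f g h : mor C).

Definition idw u : mor C := idm (objs F u).
Definition hom u v f : Prop := is_hom (objs F u) (objs F v) f.
(** Layers are always composed after [f], so composability is a condition on its codomain alone. *)
Definition to w f : Prop := cod f = objs F w.
Definition lay u g v : mor C := idw u ⊗ g ⊗ idw v.
Definition act u g v f : mor C := lay u g v ∘ f.

Lemma objs_cat u v : objs F (u ++ v) = objs F u ⊠ objs F v.
Proof. by elim: u => [|x u IHu] /=; rewrite ?tens1o // IHu tensoA. Qed.

Lemma idw_cat u v : idw (u ++ v) = idw u ⊗ idw v.
Proof. by rewrite /idw objs_cat tensm_idm. Qed.

Lemma idw0 : idw [::] = idm (unito C). Proof. by []. Qed.

Lemma idw1 x : idw [:: x] = idm (obj F x).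
Proof. by rewrite /idw /= tenso1. Qed.

Lemma hom_idw u : hom u u (idw u).
Proof. by split; rewrite ?dom_idm ?cod_idm. Qed.

Lemma hom_tens u v u' v' f f' :
  hom u v f -> hom u' v' f' -> hom (u ++ u') (v ++ v') (f ⊗ f').
Proof.
by move=> [d c] [d' c']; split; rewrite ?dom_tensm ?cod_tensm objs_cat ?d ?c ?d' ?c'.
Qed.

Lemma hom_comp u v w g f : hom v w g -> hom u v f -> hom u w (g ∘ f).
Proof.
by move=> [dg cg] [df cf]; split; rewrite ?dom_compm ?cod_compm // cf dg.
Qed.

Lemma hom_lay u v a b g : hom a b g -> hom (u ++ a ++ v) (u ++ b ++ v) (lay u g v).
Proof.
move=> hg; rewrite !catA; apply: hom_tens; last exact: hom_idw.
by apply: hom_tens => //; apply: hom_idw.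
Qed.

Lemma hom_to a b g f : hom a b g -> to a f -> to b (g ∘ f).
Proof. by move=> [dg cg] tf; rewrite /to cod_compm ?cg // tf dg. Qed.

Lemma hom_cod a b f : hom a b f -> to b f. Proof. by case. Qed.

Lemma to_act u v a b g f :
  hom a b g -> to (u ++ a ++ v) f -> to (u ++ b ++ v) (act u g v f).
Proof. by move=> hg; apply: hom_to; apply: hom_lay. Qed.

Lemma hom_act c u v a b g f :
  hom a b g -> hom c (u ++ a ++ v) f -> hom c (u ++ b ++ v) (act u g v f).
Proof. by move=> hg; apply: hom_comp; apply: hom_lay. Qed.

Lemma compA_hom a b g h f : hom a b g -> dom h = objs F b -> to a f ->
  h ∘ (g ∘ f) = (h ∘ g) ∘ f.
Proof. by move=> [dg cg] dh tf; apply: compmA; [rewrite tf dg | rewrite cg dh]. Qed.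

Lemma tens_comp a b a' b' g f g' f' : hom a b g -> to a f -> hom a' b' g' -> to a' f' ->
  (g ∘ f) ⊗ (g' ∘ f') = (g ⊗ g') ∘ (f ⊗ f').
Proof. by move=> [dg _] tf [dg' _] tf'; apply: tensm_compm; rewrite ?tf ?tf' ?dg ?dg'. Qed.

Lemma id_comp w f : to w f -> idw w ∘ f = f.
Proof. by move=> tf; rewrite /idw -tf comp1m. Qed.

Lemma comp_id a b f : hom a b f -> f ∘ idw a = f.
Proof. by move=> [df _]; rewrite /idw -df compm1. Qed.

Lemma lay0 g : lay [::] g [::] = g.
Proof. by rewrite /lay idw0 tens1m tensm1. Qed.

Lemma lay_lay u p g q v : lay u (lay p g q) v = lay (u ++ p) g (q ++ v).
Proof. by rewrite /lay !idw_cat !tensmA. Qed.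

Lemma lay_id u a v : lay u (idw a) v = idw (u ++ a ++ v).
Proof. by rewrite /lay !idw_cat tensmA. Qed.

Lemma act0 g f : act [::] g [::] f = g ∘ f.
Proof. by rewrite /act lay0. Qed.

Lemma act_lay u p g q v f : act u (lay p g q) v f = act (u ++ p) g (q ++ v) f.
Proof. by rewrite /act lay_lay. Qed.

Lemma act_id u a v f : to (u ++ a ++ v) f -> act u (idw a) v f = f.
Proof. by move=> tf; rewrite /act lay_id id_comp. Qed.

Lemma lay_comp u v a b c g h : hom a b g -> hom b c h ->
  lay u (h ∘ g) v = lay u h v ∘ lay u g v.
Proof.
move=> hg hh; rewrite /lay.
have -> : idw u = idw u ∘ idw u by rewrite (id_comp (hom_cod (hom_idw u))).
have -> : idw v = idw v ∘ idw v by rewrite (id_comp (hom_cod (hom_idw v))).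
have hu := hom_idw u; have hv := hom_idw v.
rewrite !(id_comp (hom_cod (hom_idw _))).
rewrite -(tens_comp (hom_tens hu hh) _ hv (hom_cod hv)); last exact: hom_cod (hom_tens hu hg).
by rewrite -(tens_comp hu (hom_cod hu) hh (hom_cod hg)) !(id_comp (hom_cod (hom_idw _))).
Qed.

Lemma act_comp u v a b c g h f : hom a b g -> hom b c h -> to (u ++ a ++ v) f ->
  act u (h ∘ g) v f = act u h v (act u g v f).
Proof.
move=> hg hh tf; rewrite /act (lay_comp _ _ hg hh) -(compA_hom (hom_lay u v hg)) //.
by case: (hom_lay u v hh).
Qed.

Lemma act_comp_r u v a b g f e : hom a b g -> to (u ++ a ++ v) f -> cod e = dom f ->
  act u g v (f ∘ e) = act u g v f ∘ e.
Proof.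
move=> hg tf ce; rewrite /act compmA //.
by rewrite tf; case: (hom_lay u v hg).
Qed.

(** Both sides tensor [g] and [g'] with identities, by functoriality of the tensor product. The
    contexts differ because the box applied first has already replaced its wires. *)
Lemma act_exch u m v a b a' b' g g' f : hom a b g -> hom a' b' g' ->
  to (u ++ a ++ m ++ a' ++ v) f ->
  act u g (m ++ b' ++ v) (act (u ++ a ++ m) g' v f)
  = act (u ++ b ++ m) g' v (act u g (m ++ a' ++ v) f).
Proof.
move=> hg hg' tf.
have hl : hom (u ++ a ++ m ++ a' ++ v) (u ++ a ++ m ++ b' ++ v) (lay (u ++ a ++ m) g' v).
  by have := hom_lay (u ++ a ++ m) v hg'; rewrite -!catA.
have hr : hom (u ++ b ++ m ++ a' ++ v) (u ++ b ++ m ++ b' ++ v) (lay (u ++ b ++ m) g' v).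
  by have := hom_lay (u ++ b ++ m) v hg'; rewrite -!catA.
have kl := hom_lay u (m ++ b' ++ v) hg.
have kr := hom_lay u (m ++ a' ++ v) hg.
rewrite /act (compA_hom hl) //; last by case: kl.
rewrite (compA_hom kr) //; last by case: hr.
congr (_ ∘ f); rewrite /lay.
(* The wires [u] are an identity factor of all four layers and are split off. *)
suff H : (g ⊗ idw (m ++ b' ++ v)) ∘ (idw (a ++ m) ⊗ g' ⊗ idw v)
       = (idw (b ++ m) ⊗ g' ⊗ idw v) ∘ (g ⊗ idw (m ++ a' ++ v)).
  have hu := hom_idw u.
  have el X : idw u ⊗ g ⊗ idw X = idw u ⊗ (g ⊗ idw X) by rewrite tensmA.
  have er c : idw (u ++ c ++ m) ⊗ g' ⊗ idw v = idw u ⊗ (idw (c ++ m) ⊗ g' ⊗ idw v).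
    by rewrite idw_cat !tensmA.
  rewrite !el !er.
  have h1 := hom_tens hg (hom_idw (m ++ b' ++ v)).
  have h2 := hom_tens (hom_tens (hom_idw (a ++ m)) hg') (hom_idw v).
  have h3 := hom_tens (hom_tens (hom_idw (b ++ m)) hg') (hom_idw v).
  have h4 := hom_tens hg (hom_idw (m ++ a' ++ v)).
  rewrite -!catA in h2 h3.
  rewrite -(tens_comp hu (hom_cod hu) h1 (hom_cod h2)).
  rewrite -(tens_comp hu (hom_cod hu) h3 (hom_cod h4)).
  by rewrite -H.
rewrite !idw_cat !tensmA.
have hm := hom_idw m; have hv := hom_idw v.
have e1 : g ⊗ idw m ⊗ idw b' ⊗ idw v = g ⊗ (idw m ⊗ idw b' ⊗ idw v) by rewrite !tensmA.
have e2 : idw a ⊗ idw m ⊗ g' ⊗ idw v = idw a ⊗ (idw m ⊗ g' ⊗ idw v) by rewrite !tensmA.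
have e3 : idw b ⊗ idw m ⊗ g' ⊗ idw v = idw b ⊗ (idw m ⊗ g' ⊗ idw v) by rewrite !tensmA.
have e4 : g ⊗ idw m ⊗ idw a' ⊗ idw v = g ⊗ (idw m ⊗ idw a' ⊗ idw v) by rewrite !tensmA.
rewrite e1 e2 e3 e4.
have k1 := hom_tens (hom_tens hm (hom_idw b')) hv.
have k2 := hom_tens (hom_tens hm hg') hv.
have k4 := hom_tens (hom_tens hm (hom_idw a')) hv.
rewrite -(tens_comp hg (hom_cod (hom_idw a)) k1 (hom_cod k2)).
rewrite -(tens_comp (hom_idw b) (hom_cod hg) k2 (hom_cod k4)).
rewrite (comp_id hg) (id_comp (hom_cod hg)); congr (_ ⊗ _).
have -> : idw m ⊗ idw b' ⊗ idw v = idw ((m ++ b') ++ v) by rewrite !idw_cat.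
have -> : idw m ⊗ idw a' ⊗ idw v = idw ((m ++ a') ++ v) by rewrite !idw_cat.
by rewrite (comp_id k2) (id_comp (hom_cod k2)).
Qed.

End Words.

(** * Layered diagrams and interchange *)

Section Layers.
Variables (C : smcat) (F : frob3 C).
Implicit Types (u v w p q : seq leg) (f : mor C).

Record box : Type := Box {
  bin : seq leg;
  bout : seq leg;
  bmor : mor C;
  bhom : hom F bin bout bmor
}.
Implicit Types (g h : box) (l : seq (nat * box)).

(* A string diagram as a list of layers, read from the inputs to the outputs:
   [(i, g)] is the box [g] with [i] wires on its left. *)
Definition nxt w i g := take i w ++ bout g ++ drop (i + size (bin g)) w.

Fixpoint valid w l : bool :=
  if l is (i, g) :: l' then
    [&& i + size (bin g) <= size w, take (size (bin g)) (drop i w) == bin g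
      & valid (nxt w i g) l']
  else true.

Fixpoint outw w l : seq leg :=
  if l is (i, g) :: l' then outw (nxt w i g) l' else w.

Fixpoint run w l f : mor C :=
  if l is (i, g) :: l' then
    run (nxt w i g) l' (act F (take i w) (bmor g) (drop (i + size (bin g)) w) f)
  else f.

Lemma nxt_cat p v g : nxt (p ++ bin g ++ v) (size p) g = p ++ bout g ++ v.
Proof. by rewrite /nxt take_size_cat // -size_cat (catA p (bin g)) drop_size_cat. Qed.

Lemma run_cons p v g l f :
  run (p ++ bin g ++ v) ((size p, g) :: l) f
  = run (p ++ bout g ++ v) l (act F p (bmor g) v f).
Proof. by rewrite /= nxt_cat take_size_cat // -size_cat (catA p (bin g)) drop_size_cat. Qed.

Lemma valid_cons p v g l :
  valid (p ++ bin g ++ v) ((size p, g) :: l) = valid (p ++ bout g ++ v) l.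
Proof.
rewrite /= nxt_cat !size_cat leq_add2l leq_addr drop_size_cat //.
by rewrite take_size_cat // eqxx.
Qed.

Lemma valid_inv w i g l : valid w ((i, g) :: l) ->
  exists p v, [/\ w = p ++ bin g ++ v, i = size p & valid (p ++ bout g ++ v) l].
Proof.
move=> /and3P[le_i /eqP e ok].
exists (take i w), (drop (i + size (bin g)) w).
have ew : w = take i w ++ bin g ++ drop (i + size (bin g)) w.
  by rewrite addnC -drop_drop -[X in _ ++ (X ++ _)]e !cat_take_drop.
split=> //; rewrite size_take_min; symmetry; apply/minn_idPl.
by apply: leq_trans le_i; rewrite leq_addr.
Qed.

(** The box [h] lies entirely to the left of [g], so the two touch disjoint wires. Performing [h]
    first changes the number of wires to the left of [g]; the truncated subtraction is exact because
    [size (bin h) <= i]. *)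
Lemma valid_exch w i g j h l f :
  j + size (bin h) <= i -> valid w [:: (i, g), (j, h) & l] -> to F w f ->
  valid w [:: (j, h), (i + size (bout h) - size (bin h), g) & l] /\
  run w [:: (j, h), (i + size (bout h) - size (bin h), g) & l] f
    = run w [:: (i, g), (j, h) & l] f.
Proof.
move=> le_ji ok tf.
have [p [v [ew ei ok1]]] := valid_inv ok.
have [q [v' [eq1 ej _]]] := valid_inv ok1.
(* The wires [m] lie strictly between the two boxes. *)
have [m ep] : exists m, p = q ++ bin h ++ m.
  exists (drop (size q + size (bin h)) p).
  have le_p : size q + size (bin h) <= size p by rewrite -ej -ei.
  rewrite -{1}(cat_take_drop (size q + size (bin h)) p) catA; congr (_ ++ _).
  have := congr1 (take (size q + size (bin h))) eq1.
  by rewrite takel_cat // catA take_size_cat // size_cat.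
move: ew ei eq1 ok ok1 tf; rewrite {}ep -!catA => -> -> _ ok ok1 tf.
have e1 : size (q ++ bin h ++ m) + size (bout h) - size (bin h)
        = size (q ++ bout h ++ m).
  by rewrite !size_cat [_ + size m]addnC addnA addnAC addnK addnAC -addnA addnC
       -addnA.
rewrite e1 ej in ok *.
have ew : q ++ bin h ++ m ++ bin g ++ v = (q ++ bin h ++ m) ++ bin g ++ v.
  by rewrite -!catA.
have ew' : q ++ bout h ++ m ++ bin g ++ v = (q ++ bout h ++ m) ++ bin g ++ v.
  by rewrite -!catA.
have ew2 : q ++ bin h ++ m ++ bout g ++ v = (q ++ bin h ++ m) ++ bout g ++ v.
  by rewrite -!catA.
have ew3 : q ++ bout h ++ m ++ bout g ++ v = (q ++ bout h ++ m) ++ bout g ++ v.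
  by rewrite -!catA.
split.
  rewrite valid_cons ew' valid_cons -ew3.
  by move: ok; rewrite ew valid_cons -ew2 valid_cons.
rewrite (run_cons q) ew' run_cons ew run_cons -ew2 (run_cons q) -ew3.
congr run; symmetry.
rewrite (act_exch (bhom h) (bhom g)) //.
Qed.

Lemma to_layer p v g f : to F (p ++ bin g ++ v) f ->
  to F (p ++ bout g ++ v) (act F p (bmor g) v f).
Proof. exact: to_act (bhom g). Qed.

(** One step of an insertion sort: the layers that follow are moved before [g] as long as they lie
    to its left, and the position of [g] is corrected as in [valid_exch]. *)
Fixpoint ins i g l :=
  if l is (j, h) :: l' then
    if j + size (bin h) <= i
    then (j, h) :: ins (i + size (bout h) - size (bin h)) g l'
    else (i, g) :: l
  else [:: (i, g)].

(* Moves every layer as early as possible past the layers on its right. *)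
Definition sift l := foldr (fun x => ins x.1 x.2) [::] l.

(* Iterated because a cap followed by a cup at the same place may be sifted
   either way in a single pass. *)
Definition norm l := iter 3 sift l.

Lemma run_ins w i g l f : valid w ((i, g) :: l) -> to F w f ->
  valid w (ins i g l) /\ run w (ins i g l) f = run w ((i, g) :: l) f.
Proof.
elim: l w i f => [|[j h] l IHl] w i f // ok tf; rewrite [ins _ _ _]/=.
case: leqP => // le_ji.
have [ok1 <-] := valid_exch le_ji ok tf.
have [p [v [ew -> ok2]]] := valid_inv ok1.
rewrite {}ew in ok1 tf *.
rewrite !valid_cons !run_cons.
exact: IHl (to_layer tf).
Qed.

Lemma run_sift w l f : valid w l -> to F w f ->
  valid w (sift l) /\ run w (sift l) f = run w l f.
Proof.
elim: l w f => [|[i g] l IHl] w f // ok tf.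
have [p [v [ew ei ok1]]] := valid_inv ok; rewrite {}ew {}ei in ok tf *.
have [okn en] := IHl _ _ ok1 (to_layer tf).
rewrite run_cons -en -run_cons.
by apply: run_ins; rewrite ?valid_cons.
Qed.

Lemma run_norm w l f : valid w l -> to F w f ->
  valid w (norm l) /\ run w (norm l) f = run w l f.
Proof.
move=> ok tf; rewrite /norm; elim: 3 => [|n [okn en]] //=.
by rewrite -en; apply: run_sift.
Qed.

(** Interchange by reflection. Only soundness of [norm] is claimed, not that it is a complete normal
    form. *)
Lemma run_eq w l l' f : norm l = norm l' -> valid w l -> valid w l' -> to F w f ->
  run w l f = run w l' f.
Proof.
move=> e ok ok' tf.
by have [_ <-] := run_norm ok tf; have [_ <-] := run_norm ok' tf; rewrite e.
Qed.

Lemma run_cat w l1 l2 f : run w (l1 ++ l2) f = run (outw w l1) l2 (run w l1 f).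
Proof. by elim: l1 w f => [|[i g] l1 IHl] w f //=. Qed.

Lemma valid_cat w l1 l2 : valid w (l1 ++ l2) = valid w l1 && valid (outw w l1) l2.
Proof. by elim: l1 w => [|[i g] l1 IHl] w //=; rewrite IHl -!andbA. Qed.

Lemma to_run w l f : valid w l -> to F w f -> to F (outw w l) (run w l f).
Proof.
elim: l w f => [|[i g] l IHl] w f // ok tf.
have [p [v [ew ei ok1]]] := valid_inv ok; rewrite {}ew {}ei in ok tf *.
by rewrite run_cons /= nxt_cat; apply: IHl => //; apply: to_layer.
Qed.

Lemma outw_cons p v g l :
  outw (p ++ bin g ++ v) ((size p, g) :: l) = outw (p ++ bout g ++ v) l.
Proof. by rewrite /= nxt_cat. Qed.

Definition mor_of w l : mor C := run w l (idw F w).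

Lemma run_comp w l f e : valid w l -> to F w f -> cod e = dom f ->
  run w l (f ∘ e) = run w l f ∘ e.
Proof.
elim: l w f => [|[i g] l IHl] w f // ok tf ce.
have [p [v [ew ei ok1]]] := valid_inv ok; rewrite {}ew {}ei in ok tf *.
rewrite !run_cons (act_comp_r (bhom g)) // IHl //; first exact: to_layer.
rewrite ce /act dom_compm //; rewrite tf.
by case: (hom_lay p v (bhom g)).
Qed.

Lemma run_mor w l f : valid w l -> to F w f -> run w l f = mor_of w l ∘ f.
Proof.
move=> ok tf; rewrite -run_comp ?id_comp //; first by case: (hom_idw F w).
by case: (hom_idw F w) => -> _.
Qed.

Lemma hom_run a w l f : valid w l -> hom F a w f -> hom F a (outw w l) (run w l f).
Proof.
elim: l w f => [|[i g] l IHl] w f // ok hf.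
have [p [v [ew ei ok1]]] := valid_inv ok; rewrite {}ew {}ei in ok hf *.
by rewrite run_cons outw_cons; apply: IHl => //; apply: hom_act (bhom g) hf.
Qed.

Lemma hom_mor_of w l : valid w l -> hom F w (outw w l) (mor_of w l).
Proof. by move=> ok; apply: hom_run => //; apply: hom_idw. Qed.

Definition shift n l := [seq (n + x.1, x.2) | x <- l].

Lemma run_shift p w v l f : valid w l -> to F (p ++ w ++ v) f ->
  [/\ valid (p ++ w ++ v) (shift (size p) l),
      outw (p ++ w ++ v) (shift (size p) l) = p ++ outw w l ++ v
    & run (p ++ w ++ v) (shift (size p) l) f = act F p (mor_of w l) v f].
Proof.
elim: l w f => [|[i g] l IHl] w f; first by move=> _ tf; split=> //; rewrite act_id.
move=> ok tf; have hm := hom_mor_of ok.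
have [q [u [ew ei ok1]]] := valid_inv ok; rewrite {}ew {}ei in ok tf hm *.
have e1 : p ++ (q ++ bin g ++ u) ++ v = (p ++ q) ++ bin g ++ u ++ v.
  by rewrite -!catA.
have e2 : (p ++ q) ++ bout g ++ u ++ v = p ++ (q ++ bout g ++ u) ++ v.
  by rewrite -!catA.
have tf1 := tf; rewrite e1 in tf1.
have tg : to F (p ++ (q ++ bout g ++ u) ++ v) (act F (p ++ q) (bmor g) (u ++ v) f).
  by rewrite -e2; apply: to_layer.
have [ok' eo er] := IHl _ _ ok1 tg.
rewrite e1 [shift _ _]/= -size_cat valid_cons outw_cons run_cons e2; split=> //.
  by rewrite eo outw_cons.
rewrite er {2}/mor_of run_cons run_mor //; last exact: to_layer (hom_cod (hom_idw F _)).
rewrite (act_comp (a := q ++ bin g ++ u) (b := q ++ bout g ++ u) (c := outw (q ++ bout g ++ u) l)) //.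
- have -> : act F q (bmor g) u (idw F (q ++ bin g ++ u)) = lay F q (bmor g) u.
    by rewrite /act (comp_id (hom_lay q u (bhom g))).
  by rewrite act_lay.
- by apply: hom_act (bhom g) (hom_idw F _).
- exact: hom_mor_of.
Qed.

Lemma run_rule w pre post i a l r f :
  (forall e, to F a e -> run a l e = run a r e) ->
  valid a l -> valid a r -> outw a l = outw a r ->
  take (size a) (drop i (outw w pre)) = a -> i + size a <= size (outw w pre) ->
  valid w (pre ++ shift i l ++ post) -> to F w f ->
  run w (pre ++ shift i l ++ post) f = run w (pre ++ shift i r ++ post) f
  /\ valid w (pre ++ shift i r ++ post).
Proof.
move=> e okl okr eo ea le_i ok tf.
move: ok; rewrite !run_cat !valid_cat => /and3P[ok1 ok2 ok3].
have t1 := to_run ok1 tf.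
move: (outw w pre) (run w pre f) ea le_i ok2 ok3 t1 => w1 f1 ea le_i ok2 ok3 t1.
have ew : w1 = take i w1 ++ a ++ drop (i + size a) w1.
  by rewrite addnC -drop_drop -[X in _ ++ (X ++ _)]ea !cat_take_drop.
have ei : i = size (take i w1).
  rewrite size_take_min; symmetry; apply/minn_idPl.
  by apply: leq_trans le_i; rewrite leq_addr.
move: ok2 ok3 t1; rewrite ew.
move: (take i w1) (drop (i + size a) w1) ei => p v -> ok2 ok3 t1.
have [_ e2 ->] := run_shift okl t1.
have [-> e3 ->] := run_shift okr t1.
rewrite ok1 e3 -eo -e2 ok3; split=> //.
by rewrite /mor_of e //; apply: hom_cod (hom_idw F _).
Qed.

(** The form applied by [rw]: interchange makes the redex [l] contiguous, and every premise except
    the rule, the typing of [f] and the remaining equation is settled by computation. *)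
Lemma run_rewrite w l0 pre post i a l r f x :
  (forall e, to F a e -> run a l e = run a r e) ->
  valid a l -> valid a r -> outw a l = outw a r ->
  take (size a) (drop i (outw w pre)) = a -> i + size a <= size (outw w pre) ->
  norm l0 = norm (pre ++ shift i l ++ post) ->
  valid w l0 -> valid w (pre ++ shift i l ++ post) -> to F w f ->
  run w (pre ++ shift i r ++ post) f = x ->
  run w l0 f = x.
Proof.
move=> e okl okr eo ea le_i en ok0 ok tf <-.
rewrite (run_eq en ok0 ok tf).
by have [-> _] := run_rule e okl okr eo ea le_i ok tf.
Qed.

End Layers.

Arguments run : simpl never.
Arguments valid : simpl never.

(** * Local identities of a Frobenius 3-structure *)

Section Local.
Variables (C : smcat) (F : frob3 C).
Hypothesis hslide : sliding F.
Implicit Types (u v w p q : seq leg) (f : mor C).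

Local Notation box := (box F).
Local Notation run := (@run C F).
Local Notation hom := (hom F).

Definition rule w (l r : seq (nat * box)) := forall f, to F w f -> run w l f = run w r f.

Lemma hom_fm : hom [:: LA; LD; LA] [:: LA] (fm F).
Proof. by rewrite /hom /= !tenso1 tensoA; apply: fm_hom. Qed.
Lemma hom_eta : hom [::] [:: LD; LA] (eta F).
Proof. by rewrite /hom /= tenso1; apply: eta_hom. Qed.
Lemma hom_eta' : hom [::] [:: LA; LD] (eta' F).
Proof. by rewrite /hom /= tenso1; apply: eta'_hom. Qed.
Lemma hom_eps : hom [:: LA; LD] [::] (eps F).
Proof. by rewrite /hom /= tenso1; apply: eps_hom. Qed.
Lemma hom_eps' : hom [:: LD; LA] [::] (eps' F).
Proof. by rewrite /hom /= tenso1; apply: eps'_hom. Qed.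

(* Box letters: [n], [n'] for the units, [e], [e'] for the counits, [l], [r] for the
   loops; [xv], [xlD], [xrD] are the comultiplication and the loops transposed to A^*. *)
Definition xm : box := Box hom_fm.
Definition xn : box := Box hom_eta.
Definition xn' : box := Box hom_eta'.
Definition xe : box := Box hom_eps.
Definition xe' : box := Box hom_eps'.

Lemma drop_cat3 (p a v : seq leg) : drop (size p + size a) (p ++ a ++ v) = v.
Proof. by rewrite -size_cat catA drop_size_cat. Qed.

Lemma mor_of_cons w i (g : box) l : valid w ((i, g) :: l) ->
  mor_of w ((i, g) :: l) =
  mor_of (nxt w i g) l ∘ lay F (take i w) (bmor g) (drop (i + size (bin g)) w).
Proof.
move=> ok; have [p [v [ew ei ok1]]] := valid_inv ok.
rewrite {}ew {}ei in ok *.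
rewrite nxt_cat take_size_cat // drop_cat3.
rewrite {1}/mor_of run_cons run_mor //; last exact: to_layer (hom_cod (hom_idw F _)).
by rewrite {1}/act (comp_id (hom_lay p v (bhom g))).
Qed.

Lemma mor_of_cons2 w i (g : box) x l : valid w [:: (i, g), x & l] ->
  mor_of w [:: (i, g), x & l] =
  mor_of (nxt w i g) (x :: l) ∘ lay F (take i w) (bmor g) (drop (i + size (bin g)) w).
Proof. exact: mor_of_cons. Qed.

Lemma mor_of1 w i (g : box) : valid w [:: (i, g)] ->
  mor_of w [:: (i, g)] = lay F (take i w) (bmor g) (drop (i + size (bin g)) w).
Proof.
move=> ok; rewrite mor_of_cons //.
have [p [v [ew -> _]]] := valid_inv ok; rewrite {}ew.
rewrite nxt_cat take_size_cat // drop_cat3.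
by rewrite id_comp //; apply: hom_cod (hom_lay p v (bhom g)).
Qed.

Lemma rule_of_mor w l r : valid w l -> valid w r -> mor_of w l = mor_of w r -> rule w l r.
Proof. by move=> okl okr e f tf; rewrite !run_mor // e. Qed.

Lemma rule_sym w l r : rule w l r -> rule w r l.
Proof. by move=> R f tf; rewrite R. Qed.

Lemma idw_cons x y u : idw F (x :: y :: u) = idm (obj F x) ⊗ idw F (y :: u).
Proof. by rewrite -idw1 -idw_cat. Qed.

Lemma mor_nil w : mor_of w ([::] : seq (nat * box)) = idw F w. Proof. by []. Qed.

Definition morE := (idw_cons, idw1, idw0, tens1m, tensm1, tensmA).

Lemma ruleS1 : rule [:: LA] [:: (1, xn); (0, xe)] [::].
Proof.
apply: rule_of_mor => //; rewrite mor_of_cons2 // mor_of1 // /lay /nxt /= !morE mor_nil.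
by rewrite idw1; apply: snakeA.
Qed.
Lemma ruleS2 : rule [:: LD] [:: (0, xn); (1, xe)] [::].
Proof.
apply: rule_of_mor => //; rewrite mor_of_cons2 // mor_of1 // /lay /nxt /= !morE mor_nil.
by rewrite idw1; apply: snakeD.
Qed.
Lemma ruleS3 : rule [:: LD] [:: (1, xn'); (0, xe')] [::].
Proof.
apply: rule_of_mor => //; rewrite mor_of_cons2 // mor_of1 // /lay /nxt /= !morE mor_nil.
by rewrite idw1; apply: snakeD'.
Qed.
Lemma ruleS4 : rule [:: LA] [:: (0, xn'); (1, xe')] [::].
Proof.
apply: rule_of_mor => //; rewrite mor_of_cons2 // mor_of1 // /lay /nxt /= !morE mor_nil.
by rewrite idw1; apply: snakeA'.
Qed.

Lemma rule_assoc : rule [:: LA; LD; LA; LD; LA] [:: (2, xm); (0, xm)] [:: (0, xm); (0, xm)].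
Proof.
apply: rule_of_mor => //; rewrite !mor_of_cons2 // !mor_of1 // /lay /nxt /= !morE.
exact: fm_assoc.
Qed.

(** [w1] and [w2] are the two sides of the symmetry axiom; most identities below come from choosing
    the convenient one of the two. *)
Definition w1 : seq (nat * box) := [:: (1, xn); (2, xn'); (0, xm)].
Definition w2 : seq (nat * box) := [:: (0, xn'); (1, xn); (2, xm)].

Lemma mor_w1 : mor_of [:: LA] w1 = fw F.
Proof. by rewrite !mor_of_cons2 // !mor_of1 // /lay /nxt /= !morE. Qed.

Lemma mor_w2 : mor_of [:: LA] w2 = fw F.
Proof.
rewrite !mor_of_cons2 // !mor_of1 // /lay /nxt /= !morE.
by rewrite -fm_symmetry.
Qed.

Lemma hom_fw : hom [:: LA] [:: LA; LD; LA] (fw F).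
Proof. by rewrite -mor_w1; apply: hom_mor_of. Qed.
Definition xw : box := Box hom_fw.

Lemma rule_w1 : rule [:: LA] [:: (0, xw)] w1.
Proof. by apply: rule_of_mor => //; rewrite mor_w1 mor_of1 //; apply: lay0. Qed.
Lemma rule_w2 : rule [:: LA] [:: (0, xw)] w2.
Proof. by apply: rule_of_mor => //; rewrite mor_w2 mor_of1 //; apply: lay0. Qed.

(** Packages a composite as a single layer with an unfolding rule, so that transposed operations can
    be handled like the generators. *)
Definition box_of w l (ok : valid w l) : box := Box (hom_mor_of ok).

Lemma rule_box w l (ok : valid w l) : rule w [:: (0, box_of ok)] l.
Proof.
move=> f tf; rewrite [LHS]run_mor //; last first.
  by have := valid_cons [::] [::] (box_of ok) [::]; rewrite /= !cats0 => ->.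
rewrite run_mor //; congr (_ ∘ _).
have ok' : valid w [:: (0, box_of ok)].
  by have := valid_cons [::] [::] (box_of ok) [::]; rewrite /= !cats0 => ->.
by rewrite mor_of1 //= take0 drop_size lay0.
Qed.

Lemma mor_lam : mor_of [:: LA] [:: (0, xn'); (0, xm)] = lam F.
Proof. by rewrite !mor_of_cons2 // !mor_of1 // /lay /nxt /= !morE. Qed.
Lemma mor_rho : mor_of [:: LA] [:: (1, xn); (0, xm)] = rho F.
Proof. by rewrite !mor_of_cons2 // !mor_of1 // /lay /nxt /= !morE. Qed.
Lemma hom_lam : hom [:: LA] [:: LA] (lam F).
Proof. by rewrite -mor_lam; apply: hom_mor_of. Qed.
Lemma hom_rho : hom [:: LA] [:: LA] (rho F).
Proof. by rewrite -mor_rho; apply: hom_mor_of. Qed.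
Definition xl := Box hom_lam.
Definition xr := Box hom_rho.
Lemma rule_l : rule [:: LA] [:: (0, xl)] [:: (0, xn'); (0, xm)].
Proof. by apply: rule_of_mor => //; rewrite mor_lam mor_of1 //; apply: lay0. Qed.
Lemma rule_r : rule [:: LA] [:: (0, xr)] [:: (1, xn); (0, xm)].
Proof. by apply: rule_of_mor => //; rewrite mor_rho mor_of1 //; apply: lay0. Qed.

Lemma rule_slide_r : rule [:: LA; LD; LA] [:: (0, xr); (0, xm)] [:: (0, xm); (0, xr)].
Proof.
apply: rule_of_mor => //; rewrite !mor_of_cons2 // !mor_of1 // /lay /nxt /= !morE.
by case: hslide.
Qed.
Lemma rule_slide_l : rule [:: LA; LD; LA] [:: (2, xl); (0, xm)] [:: (0, xm); (0, xl)].
Proof.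
apply: rule_of_mor => //; rewrite !mor_of_cons2 // !mor_of1 // /lay /nxt /= !morE.
by case: hslide.
Qed.

Lemma valid_v : valid [:: LD] [:: (0, xn); (3, xn'); (1, xm)]. Proof. by []. Qed.
Definition xv := box_of valid_v.
Lemma rule_v : rule [:: LD] [:: (0, xv)] [:: (0, xn); (3, xn'); (1, xm)].
Proof. exact: rule_box. Qed.
Lemma valid_lD : valid [:: LD] [:: (0, xv); (1, xe)]. Proof. by []. Qed.
Definition xlD := box_of valid_lD.
Lemma rule_lD : rule [:: LD] [:: (0, xlD)] [:: (0, xv); (1, xe)].
Proof. exact: rule_box. Qed.
Lemma valid_rD : valid [:: LD] [:: (0, xv); (0, xe')]. Proof. by []. Qed.
Definition xrD := box_of valid_rD.
Lemma rule_rD : rule [:: LD] [:: (0, xrD)] [:: (0, xv); (0, xe')].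
Proof. exact: rule_box. Qed.

(* [rw R pre i post]: up to interchange, the current list of layers is [pre], the
   left-hand side of [R] shifted by [i] wires, and [post]; rewrites with [R]. *)
Tactic Notation "rw" uconstr(R) uconstr(pre) constr(i) uconstr(post) :=
  refine (@run_rewrite _ _ _ _ pre post i _ _ _ _ _ R _ _ _ _ _ _ _ _ _ _);
  [ reflexivity | reflexivity | reflexivity | reflexivity | reflexivity
  | reflexivity | reflexivity | reflexivity | assumption
  | rewrite ?[shift _ _]/= ?[_ ++ _]/= ].

Tactic Notation "rwl" uconstr(R) uconstr(pre) constr(i) uconstr(post) :=
  rw (rule_sym R) pre i post.
Ltac fin := apply: run_eq => //.

(** The caps cancel both cups inside the comultiplication by snake identities; [rule_m2] is the
    mirror image. *)
Lemma rule_m1 : rule [:: LA; LD; LA] [:: (0, xw); (2, xe); (1, xe')] [:: (0, xm)].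
Proof.
move=> f tf.
rw rule_w1 [::] 0 [:: (2, xe); (1, xe')].
rw ruleS2 [::] 1 [:: (2, xn'); (0, xm); (1, xe')].
rw ruleS4 [::] 2 [:: (0, xm)].
fin.
Qed.

Lemma rule_m2 : rule [:: LA; LD; LA] [:: (2, xw); (1, xe'); (0, xe)] [:: (0, xm)].
Proof.
move=> f tf.
rw rule_w2 [::] 2 [:: (1, xe'); (0, xe)].
rw ruleS3 [::] 1 [:: (1, xn); (0, xe); (0, xm)].
rw ruleS1 [::] 0 [:: (0, xm)].
fin.
Qed.

(** Capping the left pair of legs cancels one cup of [w2] and leaves the left loop. In [rule_w_r]
    the right pair is capped in [w1]. *)
Lemma rule_w_l : rule [:: LA] [:: (0, xw); (0, xe)] [:: (0, xl)].
Proof.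
move=> f tf.
rw rule_w2 [::] 0 [:: (0, xe)].
rw ruleS1 [:: (0, xn')] 0 [:: (0, xm)].
rwl rule_l [::] 0 [::].
fin.
Qed.

Lemma rule_w_r : rule [:: LA] [:: (0, xw); (1, xe')] [:: (0, xr)].
Proof.
move=> f tf.
rw rule_w1 [::] 0 [:: (1, xe')].
rw ruleS4 [:: (1, xn)] 2 [:: (0, xm)].
rwl rule_r [::] 0 [::].
fin.
Qed.

(** Once [xv] and [w2] are unfolded, the two sides differ by interchange only. *)
Lemma rule_cup_w : rule [::] [:: (0, xn'); (0, xw)] [:: (0, xn'); (1, xv)].
Proof.
move=> f tf; symmetry.
rw rule_v [:: (0, xn')] 1 [::].
rwl rule_w2 [:: (0, xn')] 0 [::].
fin.
Qed.

Lemma rule_cup_v : rule [::] [:: (0, xn); (0, xv)] [:: (0, xn); (1, xw)].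
Proof.
move=> f tf.
rw rule_v [:: (0, xn)] 0 [::].
rwl rule_w1 [:: (0, xn)] 1 [::].
fin.
Qed.

(** A Frobenius identity: with the comultiplication written as [w1] it is associativity with two
    cups attached. The mirror image uses [w2]. *)
Lemma rule_wm1 : rule [:: LA; LD; LA] [:: (0, xm); (0, xw)] [:: (2, xw); (0, xm)].
Proof.
move=> f tf; symmetry.
rw rule_w1 [::] 2 [:: (0, xm)].
rw rule_assoc [:: (3, xn); (4, xn')] 0 [::].
rwl rule_w1 [:: (0, xm)] 0 [::].
fin.
Qed.

Lemma rule_wm2 : rule [:: LA; LD; LA] [:: (0, xm); (0, xw)] [:: (0, xw); (2, xm)].
Proof.
move=> f tf; symmetry.
rw rule_w2 [::] 0 [:: (2, xm)].
rwl rule_assoc [:: (0, xn'); (1, xn)] 2 [::].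
rwl rule_w2 [:: (0, xm)] 0 [::].
fin.
Qed.

(** This rule and the next three let a comultiplication wander between the legs of another one. Each
    unfolds one of the two, applies a Frobenius identity and folds it again. *)
Lemma rule_w02 : rule [:: LA] [:: (0, xw); (2, xw)] [:: (0, xw); (0, xw)].
Proof.
move=> f tf.
rw rule_w2 [::] 0 [:: (2, xw)].
rw rule_wm1 [:: (0, xn'); (1, xn)] 2 [::].
rwl rule_w2 [:: (0, xw)] 0 [::].
fin.
Qed.

Lemma rule_w01 : rule [:: LA] [:: (0, xw); (1, xv)] [:: (0, xw); (2, xw)].
Proof.
move=> f tf.
rw rule_w2 [::] 0 [:: (1, xv)].
rw rule_cup_v [:: (0, xn')] 1 [:: (4, xm)].
rwl rule_wm2 [:: (0, xn'); (1, xn)] 2 [::].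
rwl rule_w2 [::] 0 [:: (2, xw)].
fin.
Qed.

Lemma rule_v01 : rule [:: LD] [:: (0, xv); (0, xv)] [:: (0, xv); (1, xw)].
Proof.
move=> f tf.
rw rule_v [::] 0 [:: (0, xv)].
rw rule_cup_v [::] 0 [:: (5, xn'); (3, xm)].
rwl rule_wm2 [:: (0, xn); (3, xn')] 1 [::].
rwl rule_v [::] 0 [:: (1, xw)].
fin.
Qed.

Lemma rule_v02 : rule [:: LD] [:: (0, xv); (2, xv)] [:: (0, xv); (1, xw)].
Proof.
move=> f tf.
rw rule_v [::] 0 [:: (2, xv)].
rwl rule_cup_w [:: (0, xn)] 3 [:: (1, xm)].
rwl rule_wm1 [:: (0, xn); (3, xn')] 1 [::].
rwl rule_v [::] 0 [:: (1, xw)].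
fin.
Qed.

Lemma hom_loop (b : bool) : hom [:: LA] [:: LA] (if b then lam F else rho F).
Proof. by case: b; [apply: hom_lam | apply: hom_rho]. Qed.
Lemma hom_loopD (b : bool) : hom [:: LD] [:: LD] (if b then bmor xlD else bmor xrD).
Proof. by case: b; [apply: (bhom xlD) | apply: (bhom xrD)]. Qed.
Definition xA b : box := Box (hom_loop b).
Definition xD b : box := Box (hom_loopD b).

(** For the left loop this is associativity, for the right loop a sliding hypothesis. In [rule_mA]
    the roles are exchanged. *)
Lemma rule_Am b : rule [:: LA; LD; LA] [:: (0, xA b); (0, xm)] [:: (0, xm); (0, xA b)].
Proof.
case: b => f tf; last exact: rule_slide_r.
change (run [:: LA; LD; LA] [:: (0, xl); (0, xm)] f = run [:: LA; LD; LA] [:: (0, xm); (0, xl)] f).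
rw rule_l [::] 0 [:: (0, xm)].
rwl rule_assoc [:: (0, xn')] 0 [::].
rwl rule_l [:: (0, xm)] 0 [::].
fin.
Qed.

Lemma rule_mA b : rule [:: LA; LD; LA] [:: (2, xA b); (0, xm)] [:: (0, xm); (0, xA b)].
Proof.
case: b => f tf; first exact: rule_slide_l.
change (run [:: LA; LD; LA] [:: (2, xr); (0, xm)] f = run [:: LA; LD; LA] [:: (0, xm); (0, xr)] f).
rw rule_r [::] 2 [:: (0, xm)].
rw rule_assoc [:: (3, xn)] 0 [::].
rwl rule_r [:: (0, xm)] 0 [::].
fin.
Qed.

Lemma rule_Aw0 b : rule [:: LA] [:: (0, xA b); (0, xw)] [:: (0, xw); (0, xA b)].
Proof.
move=> f tf.
rw rule_w1 [:: (0, xA b)] 0 [::].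
rw (rule_Am b) [:: (1, xn); (2, xn')] 0 [::].
rwl rule_w1 [::] 0 [:: (0, xA b)].
fin.
Qed.

Lemma rule_Aw2 b : rule [:: LA] [:: (0, xA b); (0, xw)] [:: (0, xw); (2, xA b)].
Proof.
move=> f tf.
rw rule_w2 [:: (0, xA b)] 0 [::].
rw (rule_mA b) [:: (0, xn'); (1, xn)] 2 [::].
rwl rule_w2 [::] 0 [:: (2, xA b)].
fin.
Qed.

Lemma rule_cup_A b : rule [::] [:: (0, xn'); (0, xA b)] [:: (0, xn'); (1, xD b)].
Proof.
case: b => f tf; symmetry.
  change (run [::] [:: (0, xn'); (1, xlD)] f = run [::] [:: (0, xn'); (0, xl)] f).
  rw rule_lD [:: (0, xn')] 1 [::].
  rwl rule_cup_w [::] 0 [:: (2, xe)].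
  rw rule_w1 [:: (0, xn')] 0 [:: (2, xe)].
  rw ruleS2 [:: (0, xn')] 1 [:: (2, xn'); (0, xm)].
  rwl rule_l [:: (0, xn')] 0 [::].
  fin.
change (run [::] [:: (0, xn'); (1, xrD)] f = run [::] [:: (0, xn'); (0, xr)] f).
rw rule_rD [:: (0, xn')] 1 [::].
rwl rule_cup_w [::] 0 [:: (1, xe')].
rw rule_w_r [:: (0, xn')] 0 [::].
fin.
Qed.

Lemma rule_cup_D b : rule [::] [:: (0, xn); (0, xD b)] [:: (0, xn); (1, xA b)].
Proof.
case: b => f tf.
  change (run [::] [:: (0, xn); (0, xlD)] f = run [::] [:: (0, xn); (1, xl)] f).
  rw rule_lD [:: (0, xn)] 0 [::].
  rw rule_cup_v [::] 0 [:: (1, xe)].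
  rw rule_w_l [:: (0, xn)] 1 [::].
  fin.
change (run [::] [:: (0, xn); (0, xrD)] f = run [::] [:: (0, xn); (1, xr)] f).
rw rule_rD [:: (0, xn)] 0 [::].
rw rule_cup_v [::] 0 [:: (0, xe')].
rw rule_w2 [:: (0, xn)] 1 [:: (0, xe')].
rw ruleS3 [:: (0, xn)] 0 [:: (0, xn); (1, xm)].
rwl rule_r [:: (0, xn)] 1 [::].
fin.
Qed.

Lemma rule_wD b : rule [:: LA] [:: (0, xw); (1, xD b)] [:: (0, xw); (2, xA b)].
Proof.
move=> f tf.
rw rule_w2 [::] 0 [:: (1, xD b)].
rw (rule_cup_D b) [:: (0, xn')] 1 [:: (2, xm)].
rw (rule_Am b) [:: (0, xn'); (1, xn)] 2 [::].
rwl rule_w2 [::] 0 [:: (2, xA b)].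
fin.
Qed.

Lemma rule_v0D b : rule [:: LD] [:: (0, xv); (0, xD b)] [:: (0, xv); (1, xA b)].
Proof.
move=> f tf.
rw rule_v [::] 0 [:: (0, xD b)].
rw (rule_cup_D b) [::] 0 [:: (3, xn'); (1, xm)].
rw (rule_Am b) [:: (0, xn); (3, xn')] 1 [::].
rwl rule_v [::] 0 [:: (1, xA b)].
fin.
Qed.

Lemma rule_v2D b : rule [:: LD] [:: (0, xv); (2, xD b)] [:: (0, xv); (1, xA b)].
Proof.
move=> f tf.
rw rule_v [::] 0 [:: (2, xD b)].
rwl (rule_cup_A b) [:: (0, xn)] 3 [:: (1, xm)].
rw (rule_mA b) [:: (0, xn); (3, xn')] 1 [::].
rwl rule_v [::] 0 [:: (1, xA b)].
fin.
Qed.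

(** The right loop is a cup followed by a multiplication, which the left loop passes by
    associativity. *)
Lemma rule_lr : rule [:: LA] [:: (0, xl); (0, xr)] [:: (0, xr); (0, xl)].
Proof.
move=> f tf.
rw rule_r [:: (0, xl)] 0 [::].
rw (rule_Am true : rule _ [:: (0, xl); (0, xm)] [:: (0, xm); (0, xl)]) [:: (1, xn)] 0 [::].
rwl rule_r [::] 0 [:: (0, xl)].
fin.
Qed.

End Local.

(** * Spiders *)

Lemma cat_cons_split (T : eqType) (a b p v : seq T) y : a ++ b = p ++ y :: v ->
  (exists v1, a = p ++ y :: v1 /\ v = v1 ++ b) \/
  (exists p1, p = a ++ p1 /\ b = p1 ++ y :: v).
Proof.
elim: a p => [|z a IHa] [|t p] /=.
- by move=> e; right; exists [::].
- by move=> e; right; exists (t :: p).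
- by case=> -> <-; left; exists a.
case=> -> /IHa [[v1 [-> ->]]|[p1 [-> ->]]]; first by left; exists v1.
by right; exists p1.
Qed.

(* [Loop true] is the left loop, [Loop false] the right one. *)
Inductive op : Type := Comul | Loop of bool.

Definition eq_op (o o' : op) : bool :=
  match o, o' with Comul, Comul => true | Loop b, Loop b' => b == b' | _, _ => false end.
Lemma eq_opP : Equality.axiom eq_op.
Proof.
case=> [|b] [|b'] /=; try by constructor.
by case: eqP => [->|ne]; constructor => //; case.
Qed.
HB.instance Definition _ := hasDecEq.Build op eq_opP.

Definition osz (o : op) : nat := if o is Comul then 2 else 0.
Definition ow (o : op) (x : leg) : seq leg := if o is Comul then [:: x; dual x; x] else [:: x].
Definition len (ops : seq op) : nat := sumn (map osz ops).

Fixpoint altw (x : leg) (n : nat) : seq leg :=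
  if n is n'.+1 then x :: altw (dual x) n' else [::].

Lemma size_altw x n : size (altw x n) = n.
Proof. by elim: n x => //= n IHn x; rewrite IHn. Qed.

Lemma altw_cat x m n : altw x (m + n) = altw x m ++ altw (iter m dual x) n.
Proof. by elim: m x => //= m IHm x; rewrite IHm -iterSr iterS. Qed.

(** Operations add legs in pairs, so the first and last legs of a spider always have opposite
    types. *)
Lemma odd_len ops : odd (len ops) = false.
Proof. by elim: ops => //= o ops IHops; rewrite /len /= oddD IHops; case: o. Qed.

Lemma iter_dual x n : iter n dual x = if odd n then dual x else x.
Proof. by elim: n => //= n ->; case: (odd n) => //=; rewrite dualK. Qed.

Lemma altw_ow o x n : altw x (osz o + n).+1 = ow o x ++ altw (dual x) n.
Proof. by case: o => //=; rewrite !dualK. Qed.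

Lemma altw_split o x n p y v : altw x n = p ++ y :: v ->
  altw x (osz o + n) = p ++ ow o y ++ v.
Proof.
elim: p x n => [|z p IHp] x [|n] //=; rewrite addnS.
  by case=> -> <-; rewrite altw_ow.
by case=> -> /IHp <-.
Qed.

Lemma altw_unsplit x n p z y t v : altw x n.+2 = p ++ [:: z, y, t & v] ->
  z = t /\ altw x n = p ++ t :: v.
Proof.
elim: p x n => [|a p IHp] x [|n] // e.
- by case: e; rewrite dualK => -> _ <- <-; rewrite /= ?dualK.
- by case: e => _ {IHp}; case: p => [|? []].
by case: e => -> /IHp[-> /= ->].
Qed.

Lemma altw_del x n p y v : altw x n.+2 = p ++ y :: dual y :: v -> p ++ v = altw x n.
Proof.
elim: p x n => [|a p IHp] x n; first by case=> _ _ <-; rewrite dualK.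
case: n => [|n]; first by case: p {IHp} => [|? []].
by case=> -> /IHp /= <-.
Qed.

Lemma altw_rcons x n : altw x n.+1 = altw x n ++ [:: iter n dual x].
Proof. by rewrite -addn1 altw_cat. Qed.

Section Spiders.
Variables (C : smcat) (F : frob3 C).
Hypothesis hslide : sliding F.
Implicit Types (u v w p q : seq leg) (f : mor C) (o : op) (x y : leg).

Local Notation hom := (hom F).
Local Notation act := (act F).
Local Notation to := (to F).
Local Notation idw := (idw F).
Local Notation I1 := (idm (unito C)).

Lemma act_act2 p p1 p2 v v1 v2 a b c d g h f : hom a b g -> hom c d h ->
  p1 ++ b ++ v1 = p2 ++ c ++ v2 -> to (p ++ (p1 ++ a ++ v1) ++ v) f ->
  act (p ++ p2) h (v2 ++ v) (act (p ++ p1) g (v1 ++ v) f)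
  = act p (lay F p2 h v2 ∘ lay F p1 g v1) v f.
Proof.
move=> hg hh e tf; rewrite (@act_comp _ _ _ _ (p1 ++ a ++ v1) (p1 ++ b ++ v1) (p2 ++ d ++ v2)) //.
- by rewrite !act_lay.
- exact: hom_lay.
by rewrite e; apply: hom_lay.
Qed.

Lemma act_lay_id p v a b g : hom a b g -> act p g v (idw (p ++ a ++ v)) = lay F p g v.
Proof. by move=> hg; rewrite /act (comp_id (hom_lay p v hg)). Qed.

(** Transports an identity between two-layer diagrams, known on the wires [a] alone, into any
    context [p], [v]. The many word arguments only record where each box sits. *)
Lemma act_ctx a p1 g v1 p2 h v2 q1 g' r1 q2 h' r2 b1 c1 b2 c2 b3 c3 b4 c4 :
  (forall e, to a e -> act p2 h v2 (act p1 g v1 e) = act q2 h' r2 (act q1 g' r1 e)) ->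
  hom b1 c1 g -> hom b2 c2 h -> hom b3 c3 g' -> hom b4 c4 h' ->
  a = p1 ++ b1 ++ v1 -> p1 ++ c1 ++ v1 = p2 ++ b2 ++ v2 ->
  a = q1 ++ b3 ++ r1 -> q1 ++ c3 ++ r1 = q2 ++ b4 ++ r2 ->
  forall p v f, to (p ++ a ++ v) f ->
  act (p ++ p2) h (v2 ++ v) (act (p ++ p1) g (v1 ++ v) f)
  = act (p ++ q2) h' (r2 ++ v) (act (p ++ q1) g' (r1 ++ v) f).
Proof.
move=> E hg hh hg' hh' ea e1 ea' e2 p v f tf.
rewrite (act_act2 hg hh) -?ea // (act_act2 hg' hh') -?ea' //.
congr (act p _ v f).
have := E _ (hom_cod (hom_idw F a)).
by rewrite {1}ea ea' (act_lay_id _ _ hg) (act_lay_id _ _ hg').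
Qed.

Definition op_mor o x : mor C :=
  match o, x with
  | Comul, LA => fw F
  | Comul, LD => bmor (xv F)
  | Loop b, LA => bmor (xA F b)
  | Loop b, LD => bmor (xD F b)
  end.
Local Notation gm := op_mor.

Lemma hom_gm o x : hom [:: x] (ow o x) (gm o x).
Proof.
case: o x => [|b] [] /=.
- exact: bhom (xw F).
- exact: bhom (xv F).
- exact: bhom (xA F b).
- exact: bhom (xD F b).
Qed.

(** Indexed so that one letter governs a whole snake: [cp x] has legs [x], [dual x], and [cq x]
    contracts [dual x] with a further [x]. *)
Definition cp x : mor C := cup F (dual x).
Definition cq x : mor C := cap F (dual x).

Lemma hom_cp x : hom [::] [:: x; dual x] (cp x).
Proof. by case: x; [apply: hom_eta' | apply: hom_eta]. Qed.
Lemma hom_cq x : hom [:: dual x; x] [::] (cq x).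
Proof. by case: x; [apply: hom_eps' | apply: hom_eps]. Qed.
Lemma hom_cap x : hom [:: x; dual x] [::] (cap F x).
Proof. by case: x; [apply: hom_eps | apply: hom_eps']. Qed.

Lemma snake_a p v x f : to (p ++ [:: dual x] ++ v) f ->
  act p (cq x) (dual x :: v) (act (p ++ [:: dual x]) (cp x) v f) = f.
Proof.
have S e : to [:: dual x] e -> act [::] (cq x) [:: dual x] (act [:: dual x] (cp x) [::] e) = e.
  by case: x => te; [apply: (ruleS3 (F := F) te) | apply: (ruleS1 (F := F) te)].
move=> tf.
have := @act_act2 p [:: dual x] [::] v [::] [:: dual x] _ _ _ _ _ _ f (hom_cp x) (hom_cq x).
rewrite (cats0 p) => -> //.
have {2}<- : act p (idw [:: dual x]) v f = f by rewrite act_id.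
congr (act p _ v f); rewrite -[RHS]S; last exact: hom_cod (hom_idw F _).
by rewrite (act_lay_id [:: dual x] [::] (hom_cp x)).
Qed.

Lemma snake_b p v x f : to (p ++ [:: x] ++ v) f ->
  act (p ++ [:: x]) (cq x) v (act p (cp x) (x :: v) f) = f.
Proof.
have S e : to [:: x] e -> act [:: x] (cq x) [::] (act [::] (cp x) [:: x] e) = e.
  by case: x => te; [apply: (ruleS4 (F := F) te) | apply: (ruleS2 (F := F) te)].
move=> tf.
have := @act_act2 p [::] [:: x] v [:: x] [::] _ _ _ _ _ _ f (hom_cp x) (hom_cq x).
rewrite (cats0 p) => -> //.
have {2}<- : act p (idw [:: x]) v f = f by rewrite act_id.
congr (act p _ v f); rewrite -[RHS]S; last exact: hom_cod (hom_idw F _).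
by rewrite (act_lay_id [::] [:: x] (hom_cp x)).
Qed.

Lemma cup_slide o x :
  act [::] (gm o x) [:: dual x] (cp x) = act [:: x] (gm o (dual x)) [::] (cp x).
Proof.
have t1 : to [::] I1 by rewrite /to /= cod_idm.
have e0 : act [::] (cp x) [::] I1 = cp x by rewrite act0 (comp_id (hom_cp x)).
rewrite -[in LHS]e0 -[in RHS]e0.
case: o x {e0} => [|b] [].
- exact: (rule_cup_w (F := F) t1).
- exact: (rule_cup_v (F := F) t1).
- exact: (rule_cup_A (F := F) b t1).
- exact: (rule_cup_D (F := F) b t1).
Qed.

(** Bending is injective, because a snake recovers the morphism. *)
Lemma cp_cancel x w f f' : hom [:: dual x] w f -> hom [:: dual x] w f' ->
  act [:: x] f [::] (cp x) = act [:: x] f' [::] (cp x) -> f = f'.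
Proof.
have K g : hom [:: dual x] w g ->
  g = act [::] (cq x) w (act [:: dual x] (act [:: x] g [::] (cp x)) [::] (idw [:: dual x])).
  move=> hg.
  rewrite (act_comp (a := [::]) (b := [:: x; dual x]) (c := x :: w)) //; first last.
  - exact: hom_cod (hom_idw F _).
  - by have := hom_lay [:: x] [::] hg; rewrite !cats0.
  - exact: hom_cp.
  rewrite act_lay.
  have te : to [:: dual x] (idw [:: dual x]) by apply: hom_cod (hom_idw F _).
  have := @act_exch _ F [::] [::] [::] [:: dual x; x] [::] [:: dual x] w _ g
     (act [:: dual x] (cp x) [::] (idw [:: dual x])) (hom_cq x) hg.
  rewrite !cats0 /= => ->; last first.
    exact: (to_act (u := [:: dual x]) (v := [::]) (hom_cp x) te).
  by rewrite (snake_a (p := [::]) (v := [::])) // act0 (comp_id hg).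
by move=> hf hf' e; rewrite (K f) // e -K.
Qed.

Lemma act_nil a b g : hom a b g -> act [::] g [::] (idw a) = g.
Proof. by move=> hg; rewrite act0 (comp_id hg). Qed.

Lemma ow_cons o x : ow o x = x :: behead (ow o x).
Proof. by case: o. Qed.

(** A finite check: for each operation and each leg created by [o'], the claim is a local identity
    or a chain of them. *)
Lemma legs_eq o o' x p y v : ow o' x = p ++ y :: v ->
  act p (gm o y) v (gm o' x) = act [::] (gm o x) (behead (ow o' x)) (gm o' x).
Proof.
have e0 : act [::] (gm o' x) [::] (idw [:: x]) = gm o' x := act_nil (hom_gm o' x).
have t0 z : to [:: z] (idw [:: z]) by apply: hom_cod (hom_idw F _).
rewrite -e0 {e0}; case: o' => [|b'] /=; last by case: p => [|z []] //= [-> <-].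
case: p => [|z1 [|z2 [|z3 []]]] //=.
- by case=> -> <-.
- case=> <- <- <-; case: o x => [|b] [] /=.
  + exact: (eq_trans (rule_w01 (F := F) (t0 _)) (rule_w02 (t0 _))).
  + exact: esym (rule_v01 (F := F) (t0 _)).
  + apply: (eq_trans (rule_wD hslide b (t0 _))).
    apply: (eq_trans (esym (rule_Aw2 hslide b (t0 _)))).
    exact: (rule_Aw0 hslide b (t0 _)).
  + exact: esym (rule_v0D hslide b (t0 _)).
case=> <- <- <- <-; case: o x => [|b] [] /=.
- exact: (rule_w02 (F := F) (t0 _)).
- apply: (eq_trans (rule_v02 (F := F) (t0 _))).
  exact: esym (rule_v01 (F := F) (t0 _)).
- apply: (eq_trans (esym (rule_Aw2 hslide b (t0 _)))).
  exact: (rule_Aw0 hslide b (t0 _)).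
- apply: (eq_trans (rule_v2D hslide b (t0 _))).
  exact: esym (rule_v0D hslide b (t0 _)).
Qed.

Lemma ops_commA o o' :
  act [::] (gm o LA) (behead (ow o' LA)) (gm o' LA)
  = act [::] (gm o' LA) (behead (ow o LA)) (gm o LA).
Proof.
have t0 : to [:: LA] (idw [:: LA]) by apply: hom_cod (hom_idw F _).
rewrite -{1}(act_nil (hom_gm o' LA)) -{2}(act_nil (hom_gm o LA)).
case: o o' => [|b] [|b'] //=.
- exact: (rule_Aw0 hslide b' t0).
- exact: esym (rule_Aw0 hslide b t0).
case: b b' => [] [] //.
- exact: esym (rule_lr hslide t0).
- exact: (rule_lr hslide t0).
Qed.

Lemma hom_gm2 o o' x :
  hom [:: x] (ow o x ++ behead (ow o' x))
    (act [::] (gm o x) (behead (ow o' x)) (gm o' x)).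
Proof.
apply: (hom_act (u := [::]) (hom_gm o x)); rewrite /= -ow_cons; exact: hom_gm.
Qed.

Lemma ow_swap o o' x : ow o x ++ behead (ow o' x) = ow o' x ++ behead (ow o x).
Proof. by case: o o' => [|b] [|b']. Qed.

(** On an [LD] leg both operations are transferred to the other end of a cup, where [ops_commA]
    applies, and the cup is cancelled. *)
Lemma ops_comm o o' x :
  act [::] (gm o x) (behead (ow o' x)) (gm o' x)
  = act [::] (gm o' x) (behead (ow o x)) (gm o x).
Proof.
case: x; first exact: ops_commA.
apply: (@cp_cancel LA (ow o LD ++ behead (ow o' LD))).
- exact: hom_gm2.
- by rewrite ow_swap; apply: hom_gm2.
(* Both operations performed on the [LA] end of the cup; [TC] is [ops_commA] in this context. *)
pose T o o' := act [::] (gm o LA) (behead (ow o' LA) ++ [:: LD])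
  (act [::] (gm o' LA) [:: LD] (cp LA)).
have tc := hom_cod (hom_cp LA).
have TC o1 o2 : T o1 o2 = T o2 o1.
  apply: (@act_ctx [:: LA] [::] (gm o2 LA) [::] [::] (gm o1 LA) (behead (ow o2 LA))
     [::] (gm o1 LA) [::] [::] (gm o2 LA) (behead (ow o1 LA))
     _ _ _ _ _ _ _ _ _ (hom_gm _ _) (hom_gm _ _) (hom_gm _ _) (hom_gm _ _)
     _ _ _ _ [::] [:: LD]) => //.
  - move=> e te.
    have := congr1 (fun g => act [::] g [::] e) (ops_commA o1 o2).
    rewrite (act_comp (u := [::]) (v := [::]) (c := ow o1 LA ++ behead (ow o2 LA)) (hom_gm o2 LA) _ te); last first.
      by have := hom_lay [::] (behead (ow o2 LA)) (hom_gm o1 LA); rewrite /= -ow_cons.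
    rewrite (act_comp (u := [::]) (v := [::]) (c := ow o2 LA ++ behead (ow o1 LA)) (hom_gm o1 LA) _ te); last first.
      by have := hom_lay [::] (behead (ow o1 LA)) (hom_gm o2 LA); rewrite /= -ow_cons.
    by rewrite !act_lay !cats0.
  - by rewrite /= cats0 -ow_cons.
  - by rewrite /= cats0 -ow_cons.
suff K o1 o2 : act [:: LA] (act [::] (gm o1 LD) (behead (ow o2 LD)) (gm o2 LD)) [::] (cp LA)
    = T o1 o2 by rewrite !K TC.
rewrite (act_comp (u := [:: LA]) (v := [::]) (c := ow o1 LD ++ behead (ow o2 LD)) (hom_gm o2 LD) _ tc); last first.
  by have := hom_lay [::] (behead (ow o2 LD)) (hom_gm o1 LD); rewrite /= -ow_cons.
rewrite act_lay -(cup_slide o2 LA).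
(* After a comultiplication, [o1] acts on an [LD] leg that it created, and [legs_eq] applies. A loop
   creates no leg, so [o1] is slid round the cup instead. *)
case: o2 => [|b].
  apply: (@act_ctx [:: LA] [::] (gm Comul LA) [::] [:: LA] (gm o1 LD) [:: LA]
     [::] (gm Comul LA) [::] [::] (gm o1 LA) [:: LD; LA]
     _ _ _ _ _ _ _ _ _ (hom_gm _ _) (hom_gm _ _) (hom_gm _ _) (hom_gm _ _)
     _ _ _ _ [::] [:: LD]) => //.
  move=> e te.
  have := congr1 (fun g => act [::] g [::] e) (@legs_eq o1 Comul LA [:: LA] LD [:: LA] erefl).
  rewrite (act_comp (u := [::]) (v := [::]) (c := LA :: ow o1 LD ++ [:: LA])
     (hom_gm Comul LA) _ te); last exact: (hom_lay [:: LA] [:: LA] (hom_gm o1 LD)).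
  rewrite (act_comp (u := [::]) (v := [::]) (c := ow o1 LA ++ [:: LD; LA])
     (hom_gm Comul LA) _ te); last exact: (hom_lay [::] [:: LD; LA] (hom_gm o1 LA)).
  by rewrite !act_lay.
have := act_exch (u := [::]) (m := [::]) (v := [::]) (hom_gm (Loop b) LA) (hom_gm o1 LD) tc.
rewrite /= !cats0 => <-; rewrite -(cup_slide o1 LA).
by rewrite -[RHS]TC /T /= ; case: o1.
Qed.

(* All operations act on the first leg; [om_leg] and [sp_leg] show that any
   other leg would do as well. *)
Fixpoint ops_mor x (ops : seq op) : mor C :=
  if ops is o :: ops' then act [::] (gm o x) (altw (dual x) (len ops')) (ops_mor x ops')
  else idw [:: x].
Local Notation om := ops_mor.

Lemma hom_om x ops : hom [:: x] (altw x (len ops).+1) (om x ops).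
Proof.
elim: ops => [|o ops IHops]; first exact: hom_idw.
by rewrite [len _]/= altw_ow; apply: (hom_act (u := [::]) (hom_gm o x)).
Qed.

Lemma behead_altw x n : behead (altw x n.+1) = altw (dual x) n.
Proof. by []. Qed.

Lemma act_ow x o o' n f : to (x :: altw (dual x) n) f ->
  act [::] (gm o x) (behead (ow o' x) ++ altw (dual x) n)
    (act [::] (gm o' x) (altw (dual x) n) f)
  = act [::] (gm o' x) (behead (ow o x) ++ altw (dual x) n)
    (act [::] (gm o x) (altw (dual x) n) f).
Proof.
move=> tf.
apply: (@act_ctx [:: x] [::] (gm o' x) [::] [::] (gm o x) (behead (ow o' x))
     [::] (gm o x) [::] [::] (gm o' x) (behead (ow o x))
     _ _ _ _ _ _ _ _ _ (hom_gm _ _) (hom_gm _ _) (hom_gm _ _) (hom_gm _ _)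
     _ _ _ _ [::] _) => //.
- move=> e te.
  have := congr1 (fun g => act [::] g [::] e) (ops_comm o o' x).
  rewrite (act_comp (u := [::]) (v := [::]) (c := ow o x ++ behead (ow o' x)) (hom_gm o' x) _ te);
    last by have := hom_lay [::] (behead (ow o' x)) (hom_gm o x); rewrite /= -ow_cons.
  rewrite (act_comp (u := [::]) (v := [::]) (c := ow o' x ++ behead (ow o x)) (hom_gm o x) _ te);
    last by have := hom_lay [::] (behead (ow o x)) (hom_gm o' x); rewrite /= -ow_cons.
  by rewrite !act_lay !cats0.
- by rewrite /= cats0 -ow_cons.
- by rewrite /= cats0 -ow_cons.
Qed.

Lemma om_swap x o o' ops : om x [:: o, o' & ops] = om x [:: o', o & ops].
Proof.
have := @act_ow x o o' (len ops) _ (hom_cod (hom_om x ops)).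
have bw z : behead (ow z x) ++ altw (dual x) (len ops) = altw (dual x) (osz z + len ops).
  by rewrite -[RHS]behead_altw altw_ow ow_cons.
by rewrite !bw.
Qed.

(** Either the leg was created by the last operation, and [legs_eq] moves [o] to the first leg, or
    the last operation does not touch it, and interchange, induction and [om_swap] finish. *)
Lemma om_leg x ops o p y v : altw x (len ops).+1 = p ++ y :: v ->
  act p (gm o y) v (om x ops) = om x (o :: ops).
Proof.
elim: ops p v => [|o' ops IHops] p v.
  by case: p => [|z []] //= [-> <-].
rewrite [len _]/= altw_ow.
have th := hom_cod (hom_om x ops).
case/cat_cons_split => [[v1 [e ->]]|[p1 [-> e]]].
  have bw : behead (ow o' x) ++ altw (dual x) (len ops) = altw (dual x) (len (o' :: ops)).
    by rewrite -[RHS]behead_altw altw_ow ow_cons.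
  rewrite [RHS]/= -bw.
  apply: (@act_ctx [:: x] [::] (gm o' x) [::] p (gm o y) v1
     [::] (gm o' x) [::] [::] (gm o x) (behead (ow o' x))
     _ _ _ _ _ _ _ _ _ (hom_gm _ _) (hom_gm _ _) (hom_gm _ _) (hom_gm _ _)
     _ _ _ _ [::] _) => //.
  - move=> a ta.
    have := congr1 (fun g => act [::] g [::] a) (legs_eq o e).
    rewrite (act_comp (u := [::]) (v := [::]) (c := p ++ ow o y ++ v1) (hom_gm o' x) _ ta);
      last by have := hom_lay p v1 (hom_gm o y); rewrite /= -e.
    rewrite (act_comp (u := [::]) (v := [::]) (c := ow o x ++ behead (ow o' x)) (hom_gm o' x) _ ta);
      last by have := hom_lay [::] (behead (ow o' x)) (hom_gm o x); rewrite /= -ow_cons.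
    by rewrite !act_lay !cats0.
  - by rewrite cats0.
  - by rewrite /= cats0 -ow_cons.
rewrite om_swap [RHS]/= [om x (o' :: ops)]/=.
have e2 : altw x (len ops).+1 = (x :: p1) ++ y :: v by rewrite /= e.
have := IHops _ _ e2; rewrite [RHS]/= => <-.
rewrite e.
have := act_exch (u := [::]) (m := p1) (v := v) (hom_gm o' x) (hom_gm o y)
   (f := om x ops).
rewrite /= -e => <- //.
congr act.
by have := altw_split o e2; rewrite addnS => -[].
Qed.

(** An operation may also be performed before all the others. This is the form in which operations
    arrive from the other end of a cup, and it matches the recursion of [wpow]. *)
Lemma om_cons_in x o ops : act [::] (om x ops) (behead (ow o x)) (gm o x) = om x (o :: ops).
Proof.
elim: ops => [|o' ops IHops].
  rewrite /= (act_nil (hom_gm o x)) (act_id (u := [::])) //=.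
  by rewrite -ow_cons; apply: hom_cod (hom_gm _ _).
rewrite om_swap -[RHS]/(act [::] (gm o' x) (altw (dual x) (len (o :: ops))) (om x (o :: ops))).
rewrite -IHops.
have hl : hom (altw x (len ops).+1) (altw x (len (o' :: ops)).+1)
   (lay F [::] (gm o' x) (altw (dual x) (len ops))).
  by rewrite [len _]/= altw_ow; apply: (hom_lay [::] _ (hom_gm o' x)).
rewrite (act_comp (u := [::]) (hom_om x ops) hl); last first.
  by rewrite /= -ow_cons; apply: hom_cod (hom_gm _ _).
rewrite act_lay /=; congr act.
suff : altw x (len ops).+1 ++ behead (ow o x) = altw x (osz o + len ops).+1 by case.
case: o {IHops hl} => [|b]; last by rewrite cats0.
rewrite [osz _]/= -addnS addnC altw_cat iter_dual [odd _]/= odd_len.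
by rewrite [behead _]/= [altw _ 2]/= dualK.
Qed.

Definition spider x ops : mor C := act [::] (om x ops) [:: dual x] (cp x).
Local Notation sp := spider.

Lemma altw_even x ops : altw x (len ops).+2 = altw x (len ops).+1 ++ [:: dual x].
Proof. by rewrite altw_rcons iter_dual /= odd_len. Qed.

Lemma hom_sp x ops : hom [::] (altw x (len ops).+2) (sp x ops).
Proof. by rewrite altw_even; apply: (hom_act (u := [::]) (hom_om x ops)) (hom_cp x). Qed.

(** All legs but the last are covered by [om_leg]. The last one is the untouched end of the cup: the
    operation slides round the cup and becomes the first one performed. *)
Lemma sp_leg x ops o p y v : altw x (len ops).+2 = p ++ y :: v ->
  act p (gm o y) v (sp x ops) = sp x (o :: ops).
Proof.
rewrite altw_even => /cat_cons_split[[v1 [e ->]]|[p1 [-> e]]].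
  have hl : hom (altw x (len ops).+1) (p ++ ow o y ++ v1) (lay F p (gm o y) v1).
    by rewrite e; apply: hom_lay (hom_gm o y).
  rewrite /sp; have := act_lay F [::] p (gm o y) v1 [:: dual x]; rewrite /= => <-.
  rewrite -(act_comp (u := [::]) (v := [:: dual x]) (hom_om x ops) hl).
    by rewrite -/(act p (gm o y) v1 (om x ops)) (om_leg o e).
  exact: hom_cod (hom_cp x).
case: p1 e => [|z []] //= [<- <-].
have := act_exch (u := [::]) (m := [::]) (v := [::]) (hom_om x ops) (hom_gm o (dual x))
   (hom_cod (hom_cp x)).
rewrite /sp !cats0 /= => <-; rewrite -cup_slide.
have -> : ow o (dual x) = behead (ow o x) ++ [:: dual x] by case: o; rewrite //= dualK.
have hl : hom (ow o x) (altw x (len ops).+1 ++ behead (ow o x))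
    (lay F [::] (om x ops) (behead (ow o x))).
  by have := hom_lay [::] (behead (ow o x)) (hom_om x ops); rewrite /= -ow_cons.
have := act_lay F [::] [::] (om x ops) (behead (ow o x)) [:: dual x]; rewrite /= => <-.
rewrite -(act_comp (u := [::]) (v := [:: dual x]) (hom_gm o x) hl).
  by rewrite -[lay _ _ _ _ ∘ _]/(act [::] (om x ops) (behead (ow o x)) (gm o x)) om_cons_in.
exact: hom_cod (hom_cp x).
Qed.

(** A spider can equally be grown from the second end of its cup, as [merge_right] requires. *)
Lemma sp_om2 x ops : sp x ops = act [:: x] (om (dual x) ops) [::] (cp x).
Proof.
have tc := hom_cod (hom_cp x).
elim: ops => [|o ops IHops].
  by rewrite /sp /= (act_id (u := [::]) (v := [:: dual x])) // (act_id (u := [:: x]) (v := [::])).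
have e : altw x (len ops).+2 = [:: x] ++ dual x :: altw x (len ops) by rewrite /= dualK.
rewrite -(sp_leg o e) IHops [om (dual x) (o :: ops)]/= dualK.
have hl : hom (altw (dual x) (len ops).+1) (ow o (dual x) ++ altw x (len ops))
   (lay F [::] (gm o (dual x)) (altw x (len ops))).
  by have := hom_lay [::] (altw x (len ops)) (hom_gm o (dual x)); rewrite /= dualK.
rewrite (act_comp (u := [:: x]) (v := [::]) (hom_om (dual x) ops) hl) //.
by rewrite act_lay /= cats0.
Qed.

(** The cap straightens the cup of the spider and leaves its operations on the contracted wire. *)
Lemma merge_right p v x ops f : to (p ++ dual x :: v) f ->
  act p (cq x) (altw (dual x) (len ops).+1 ++ v) (act (p ++ [:: dual x]) (sp x ops) v f)
  = act p (om (dual x) ops) v f.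
Proof.
move=> tf; rewrite sp_om2.
have t2 : to ((p ++ [:: dual x]) ++ [::] ++ v) f by rewrite -catA.
rewrite (act_comp (hom_cp x) (hom_lay [:: x] [::] (hom_om (dual x) ops)) t2).
rewrite act_lay /= -catA /=.
have tg := to_act (hom_cp x) t2.
have := act_exch (u := p) (m := [::]) (v := v) (hom_cq x) (hom_om (dual x) ops)
  (f := act (p ++ [:: dual x]) (cp x) v f).
rewrite /= cats0 => ->; last by move: tg; rewrite -!catA.
by rewrite (snake_a (x := x)).
Qed.

Lemma merge_left p v x ops f : to (p ++ x :: v) f ->
  act (p ++ altw x (len ops).+1) (cq x) v (act p (sp x ops) (x :: v) f)
  = act p (om x ops) v f.
Proof.
move=> tf.
rewrite /sp (act_comp (a := [::]) (u := p) (hom_cp x) (hom_lay [::] [:: dual x] (hom_om x ops)) tf).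
rewrite act_lay /= cats0.
have tg := to_act (a := [::]) (u := p) (hom_cp x) tf.
have := act_exch (u := p) (m := [::]) (v := v) (hom_om x ops) (hom_cq x) tg.
by rewrite /= cats0 => <-; rewrite (snake_b (x := x)).
Qed.

Lemma om_front x o ops : o \in ops ->
  exists ops', om x ops = om x (o :: ops') /\ len ops = osz o + len ops'.
Proof.
elim: ops => // o' ops IHops; rewrite in_cons.
have [<- _|_ /=] := eqVneq o o'; first by exists ops.
move=> /IHops[ops' [e el]]; exists (o' :: ops'); split.
  rewrite -[LHS]/(act [::] (gm o' x) (altw (dual x) (len ops)) (om x ops)) e el.
  exact: om_swap.
by change (osz o' + len ops = osz o + (osz o' + len ops')); rewrite el addnCA.
Qed.

Lemma len_Comul ops : len ops != 0 -> Comul \in ops.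
Proof. by elim: ops => // -[|b] ops IHops //=; rewrite add0n => /IHops. Qed.

Definition is_A x : bool := if x is LA then true else false.

Lemma split_cap1 x : act [::] (cap F x) [:: x] (gm Comul x) = gm (Loop (is_A x)) x.
Proof.
have t0 : to [:: x] (idw [:: x]) by apply: hom_cod (hom_idw F _).
rewrite -(act_nil (hom_gm Comul x)) -[RHS](act_nil (hom_gm (Loop _) x)).
case: x t0 => t0; first exact: (rule_w_l (F := F) t0).
exact: esym (rule_rD (F := F) t0).
Qed.

Lemma split_cap2 x : act [:: x] (cap F (dual x)) [::] (gm Comul x) = gm (Loop (is_A (dual x))) x.
Proof.
have t0 : to [:: x] (idw [:: x]) by apply: hom_cod (hom_idw F _).
rewrite -(act_nil (hom_gm Comul x)) -[RHS](act_nil (hom_gm (Loop _) x)).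
case: x t0 => t0; first exact: (rule_w_r (F := F) t0).
exact: esym (rule_lD (F := F) t0).
Qed.

(** The comultiplication is placed so that it creates both capped legs, and capping these gives a
    loop. *)
Lemma sp_cap_split x ops p y v : altw x (osz Comul + (len ops).+2) = p ++ y :: dual y :: v ->
  act p (cap F y) v (sp x (Comul :: ops)) = sp x (Loop (is_A y) :: ops).
Proof.
have ts := hom_cod (hom_sp x ops).
(* With no leg to the left, the first leg is split and its first two new legs are capped; otherwise
   the preceding leg is split and its last two new legs are capped. *)
case/lastP: p => [|p z].
  case=> <- _ ev; have -> : v = x :: altw (dual x) (len ops).+1 by rewrite -ev /= !dualK.
  set v' := altw (dual x) _.
  have e : altw x (len ops).+2 = [::] ++ x :: v' by [].
  rewrite -(sp_leg Comul e) -(sp_leg (Loop (is_A x)) e) -split_cap1.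
  have hl := hom_lay [::] [:: x] (hom_cap x).
  by rewrite (act_comp (u := [::]) (hom_gm Comul x) hl) ?act_lay.
rewrite cat_rcons => e.
have [-> e'] := altw_unsplit e.
rewrite -(sp_leg Comul e') -(sp_leg (Loop (is_A y)) e').
have := split_cap2 (dual y); rewrite dualK => <-.
have hg : hom [:: dual y] [:: dual y; y; dual y] (gm Comul (dual y)).
  by have := hom_gm Comul (dual y); rewrite /= dualK.
rewrite e' in ts.
by rewrite -cats1 (act_comp hg (hom_lay [:: dual y] [::] (hom_cap y)) ts) act_lay.
Qed.

(** A spider with more than two legs contains a comultiplication, which can be made the last
    operation performed. *)
Lemma sp_cap x ops p y v : altw x (len ops).+2 = p ++ y :: dual y :: v -> len ops != 0 ->
  exists ops', act p (cap F y) v (sp x ops) = sp x ops' /\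
    p ++ v = altw x (len ops').+2.
Proof.
move=> e /len_Comul /(om_front x)[ops' [eo el]].
exists (Loop (is_A y) :: ops'); rewrite (altw_del e) el; split=> //.
by rewrite {1}/sp eo -/(sp x _); apply: sp_cap_split; rewrite -e el.
Qed.

End Spiders.

(** * Planar states *)

(** Each leg is paired with the label of its connected component. *)
Notation lword := (seq (leg * nat)).
Definition ty (w : lword) : seq leg := [seq z.1 | z <- w].
Definition lb (w : lword) : seq nat := [seq z.2 | z <- w].
Definition mark (c : nat) (u : seq leg) : lword := [seq (x, c) | x <- u].
Definition rl (h : nat -> nat) (w : lword) : lword := [seq (z.1, h z.2) | z <- w].

Lemma ty_cat u v : ty (u ++ v) = ty u ++ ty v. Proof. exact: map_cat. Qed.
Lemma lb_cat u v : lb (u ++ v) = lb u ++ lb v. Proof. exact: map_cat. Qed.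
Lemma rl_cat h u v : rl h (u ++ v) = rl h u ++ rl h v. Proof. exact: map_cat. Qed.
Lemma ty_mark c u : ty (mark c u) = u. Proof. by rewrite /ty -map_comp map_id. Qed.
Lemma lb_mark c u : lb (mark c u) = nseq (size u) c.
Proof. by elim: u => //= x u ->. Qed.
Lemma rl_mark h c u : rl h (mark c u) = mark (h c) u.
Proof. by rewrite /rl /mark -map_comp. Qed.
Lemma ty_rl h w : ty (rl h w) = ty w. Proof. by rewrite /ty -map_comp. Qed.
Lemma lb_rl h w : lb (rl h w) = map h (lb w). Proof. by rewrite /lb -!map_comp. Qed.
Lemma rl_id h w : {in lb w, forall c, h c = c} -> rl h w = w.
Proof.
move=> H; rewrite -[RHS]map_id; apply/eq_in_map => -[x c] zw /=.
by rewrite H //; apply: (map_f snd zw).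
Qed.
Lemma rl_comp h h' w : rl h (rl h' w) = rl (h \o h') w.
Proof. by rewrite /rl -map_comp. Qed.

Lemma mark_split c u p y a q : mark c u = p ++ (y, a) :: q ->
  [/\ a = c, p = mark c (ty p), q = mark c (ty q) & u = ty p ++ y :: ty q].
Proof.
elim: u p => [|x u IHu] [|z p] //=.
  by case=> -> <- <-; rewrite ty_mark.
by case=> <- /IHu[-> ep eq ->]; split; rewrite /= -?ep -?eq.
Qed.

(** The common image must be one of the two labels; this keeps labels of other blocks distinct from
    it, as [merges_notin] shows. *)
Definition merges (h : nat -> nat) (a b : nat) : Prop :=
  [/\ h a = h b, h a = a \/ h a = b & forall c, c != a -> c != b -> h c = c].

Definition repl (a b c : nat) : nat := if c == a then b else c.

Lemma merges_notin h a b c u : merges h a b -> c != a -> c != b -> c \notin u ->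
  c \notin map h u.
Proof.
move=> [hab hor hid] ca cb cu; apply/mapP => -[n nu en].
have [ea|na] := eqVneq n a.
  by case: hor => E; move: en ca cb; rewrite ea E => ->; rewrite eqxx.
have [eb|nb] := eqVneq n b.
  by case: hor => E; move: en ca cb; rewrite eb -hab E => ->; rewrite eqxx.
by move: cu; rewrite en hid // nu.
Qed.

Lemma merges_replr a b : merges (repl a b) a b.
Proof.
rewrite /merges /repl eqxx; split; first by case: ifP.
  by right.
by move=> c /negPf ->.
Qed.

Lemma merges_repll a b : merges (repl b a) a b.
Proof.
rewrite /merges /repl eqxx; split; first by case: ifP.
  by left; case: ifP.
by move=> c _ /negPf ->.
Qed.

Lemma rl_fresh c d w : c \notin lb w -> rl (repl c d) w = w.
Proof.
move=> fr; apply: rl_id => n nu; rewrite /repl; case: eqP => // en.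
by move: fr; rewrite -en nu.
Qed.

Section Planar.
Variables (C : smcat) (F : frob3 C).
Hypothesis hslide : sliding F.
Implicit Types (u v : seq leg) (w : lword) (f : mor C) (o : op) (x y : leg).

Local Notation hom := (hom F).
Local Notation act := (act F).
Local Notation to := (to F).
Local Notation idw := (idw F).
Local Notation I1 := (idm (unito C)).
Local Notation gm := (op_mor F).
Local Notation om := (ops_mor F).
Local Notation sp := (spider F).

(* Noncrossing collections of spiders, each block carrying its own label; in any
   such collection some block has contiguous legs, and it is the last one added. *)
Inductive pst : lword -> mor C -> Prop :=
| PstNil : pst [::] I1
| PstBlock w1 w2 c x ops f :
    pst (w1 ++ w2) f -> c \notin lb (w1 ++ w2) ->
    pst (w1 ++ mark c (altw x (len ops).+2) ++ w2)
        (act (ty w1) (sp x ops) (ty w2) f).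

Lemma pst_hom w f : pst w f -> hom [::] (ty w) f.
Proof.
elim=> [|w1 w2 c x ops {}f _ IH _]; first exact: (hom_idw F [::]).
rewrite !ty_cat ty_mark.
by apply: hom_act (hom_sp F x ops) _; rewrite -ty_cat.
Qed.

Lemma pst_to w f : pst w f -> to (ty w) f.
Proof. by move=> /pst_hom; apply: hom_cod. Qed.

Lemma mem_lb_op w1 w2 x c n u : n \in lb (w1 ++ mark c (x :: u) ++ w2) =
  (n \in lb (w1 ++ (x, c) :: w2)).
Proof.
rewrite !lb_cat lb_mark /= !mem_cat !in_cons mem_cat mem_nseq.
by case: (n == c); rewrite ?orbT ?andbF ?andbT.
Qed.

(** Induction on the blocks: the leg lies to the left of the last block, in it, or to its right. In
    the outer cases the operation commutes with the creation of the block. *)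
Lemma pst_op w1 w2 x c o f : pst (w1 ++ (x, c) :: w2) f ->
  pst (w1 ++ mark c (ow o x) ++ w2) (act (ty w1) (gm o x) (ty w2) f).
Proof.
move e: (w1 ++ (x, c) :: w2) => w P.
elim: P w1 w2 e => [|v1 v2 d y ops {}f P IH fr] w1 w2 e; first by case: w1 e.
have tf := pst_to P.
case/esym/cat_cons_split: e => [[t [ev ->]]|[p1 [-> e]]].
  have := IH w1 (t ++ v2); rewrite ev -!catA /= => /(_ erefl) P'.
  have := PstBlock y ops (w1 := w1 ++ mark c (ow o x) ++ t) (w2 := v2) (c := d).
  rewrite -!catA => /(_ _ P') P2.
  have -> : act (ty w1) (gm o x) (ty (t ++ mark d (altw y (len ops).+2) ++ v2))
       (act (ty (w1 ++ (x, c) :: t)) (sp y ops) (ty v2) f)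
     = act (ty (w1 ++ mark c (ow o x) ++ t)) (sp y ops) (ty v2)
         (act (ty w1) (gm o x) (ty (t ++ v2)) f).
    rewrite !ty_cat !ty_mark /=.
    have := act_exch (u := ty w1) (m := ty t) (v := ty v2) (hom_gm F o x) (hom_sp F y ops) (f := f).
    by rewrite /= => ->; first by []; move: tf; rewrite ev !ty_cat /= -catA.
  apply: P2; rewrite ow_cons mem_lb_op.
  by move: fr; rewrite ev -catA.
case/cat_cons_split: e => [[t [ev ->]]|[p2 [-> ev]]].
  have [-> ep et eu] := mark_split ev.
  rewrite !ty_cat -!catA.
  have hg := hom_lay (ty p1) (ty t) (hom_gm F o x).
  rewrite /= -eu in hg.
  have := act_comp (u := ty v1) (v := ty v2) (hom_sp F y ops) hg (f := f).
  rewrite act_lay => <-; last by move: tf; rewrite ty_cat.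
  rewrite -[lay _ _ _ _ ∘ _]/(act (ty p1) (gm o x) (ty t) (sp y ops)) (sp_leg hslide o eu).
  suff -> : p1 ++ mark d (ow o x) ++ t ++ v2 = mark d (altw y (len (o :: ops)).+2) ++ v2.
    exact: PstBlock.
  rewrite [len _]/= -!addnS (altw_split o eu) ep et /mark !map_cat -!catA.
  by rewrite -/(mark d _) -/(mark d _) !ty_mark.
have := IH (v1 ++ p2) w2; rewrite ev -!catA => /(_ erefl) P'.
have := PstBlock y ops (w1 := v1) (w2 := p2 ++ mark c (ow o x) ++ w2) (c := d) P'.
have -> : act (ty (v1 ++ mark d (altw y (len ops).+2) ++ p2)) (gm o x) (ty w2)
       (act (ty v1) (sp y ops) (ty (p2 ++ (x, c) :: w2)) f)
     = act (ty v1) (sp y ops) (ty (p2 ++ mark c (ow o x) ++ w2))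
         (act (ty (v1 ++ p2)) (gm o x) (ty w2) f).
  rewrite !ty_cat !ty_mark /=.
  have := act_exch (u := ty v1) (m := ty p2) (v := ty w2) (hom_sp F y ops) (hom_gm F o x) (f := f).
  by rewrite /= => ->; first by []; move: tf; rewrite ev !ty_cat /=.
apply.
have := mem_lb_op (v1 ++ p2) w2 x c d (behead (ow o x)).
by rewrite -ow_cons -!catA => ->; move: fr; rewrite ev.
Qed.

Lemma mark_cat c u v : mark c (u ++ v) = mark c u ++ mark c v.
Proof. exact: map_cat. Qed.

Lemma pst_om w1 w2 x c ops f : pst (w1 ++ (x, c) :: w2) f ->
  pst (w1 ++ mark c (altw x (len ops).+1) ++ w2) (act (ty w1) (om x ops) (ty w2) f).
Proof.
move=> P; elim: ops => [|o ops IHops].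
  by rewrite act_id //; have := pst_to P; rewrite ty_cat.
have := @pst_op w1 (mark c (altw (dual x) (len ops)) ++ w2) x c o _ IHops.
rewrite ty_cat ty_mark.
have hl := hom_lay [::] (altw (dual x) (len ops)) (hom_gm F o x).
have tf : to (ty w1 ++ [:: x] ++ ty w2) f by have := pst_to P; rewrite ty_cat.
have := act_comp (hom_om F x ops) hl tf; rewrite act_lay cats0 => <-.
by rewrite [len _]/= altw_ow mark_cat -!catA.
Qed.

(** Since the last block has contiguous legs, the contracted pair lies beside it, inside it, or
    across one of its ends. The second alternative arises when the pair is a whole spider, which the
    cap closes. *)
Lemma pst_cap w1 w2 y a b f : pst (w1 ++ [:: (y, a), (dual y, b) & w2]) f ->
  (exists h, merges h a b /\
     pst (rl h (w1 ++ w2)) (act (ty w1) (cap F y) (ty w2) f)) \/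
  (a = b /\ a \notin lb (w1 ++ w2)).
Proof.
move e: (w1 ++ _) => w P.
elim: P w1 w2 e => [|v1 v2 c x ops {}f P IH fr] w1 w2 e; first by case: w1 e.
have tf := pst_to P.
case/esym/cat_cons_split: e => [[[|z t] [ev e]]|[p1 [-> e]]].
(* The right leg of the pair is the first leg of the block. *)
- case: e => ex eb ev2; left; exists (repl b a); split; first exact: merges_repll.
  subst x c v1.
  have ew2 : w2 = mark b (altw y (len ops).+1) ++ v2 by rewrite ev2 /= dualK.
  have := @merge_right _ F hslide (ty w1) (ty v2) (dual y) ops f.
  rewrite /cq dualK ew2 !ty_cat !ty_mark => ->; last by move: tf; rewrite !ty_cat -catA.
  move: fr; rewrite !lb_cat !mem_cat !negb_or => /andP[/andP[fr1 _] fr2].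
  rewrite !rl_cat rl_mark !rl_fresh // {1}/repl eqxx.
  by apply: pst_om; move: P; rewrite -catA.
(* Both legs lie to the left of the block. *)
- case: e => ez ew2'; subst v1 z.
  have ew2 : w2 = t ++ mark c (altw x (len ops).+2) ++ v2 by [].
  have E : w1 ++ [:: (y, a), (dual y, b) & t ++ v2]
         = (w1 ++ [:: (y, a), (dual y, b) & t]) ++ v2 by rewrite -catA.
  have [[h [hm hP]]|[eab da]] := IH _ _ E.
  + left; exists h; split=> //.
    have [ca cb] : c != a /\ c != b.
      by move: fr; rewrite !lb_cat /= !mem_cat !in_cons !negb_or => /andP[/andP[_ /and3P[-> ->]]].
    have ehc : h c = c by case: hm => _ _; apply.
    have hP2 : pst (rl h (w1 ++ t) ++ rl h v2) (act (ty w1) (cap F y) (ty (t ++ v2)) f).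
      by rewrite -rl_cat -catA.
    have := PstBlock x ops hP2 (c := c).
    rewrite -rl_cat -catA lb_rl.
    have -> : c \notin map h (lb (w1 ++ t ++ v2)).
      apply: (merges_notin hm) => //; move: fr; rewrite !lb_cat /= !mem_cat !in_cons !negb_or.
      by case/andP=> /andP[-> /and3P[_ _ ->]] ->.
    rewrite ew2 !rl_cat rl_mark ehc !ty_cat !ty_rl !ty_mark -!catA => /(_ isT).
    have := act_exch (u := ty w1) (m := ty t) (v := ty v2) (hom_cap F y) (hom_sp F x ops) (f := f).
    by rewrite /= => -> //; move: tf; rewrite !ty_cat /= -catA.
  have ca : (a == c) = false.
    apply/negbTE; rewrite eq_sym; move: fr; rewrite !lb_cat /= !mem_cat !in_cons !negb_or.
    by case/andP=> /andP[_ /and3P[]].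
  right; split=> //; rewrite ew2 !lb_cat lb_mark !mem_cat mem_nseq ca andbF /=.
  by move: da; rewrite !lb_cat !mem_cat.
case/cat_cons_split: e => [[[|z t] [ev e]]|[p2 [-> ev]]].
(* The left leg of the pair is the last leg of the block. *)
- have [ea ep _ eu] := mark_split ev.
  move: eu; rewrite altw_even cats1 cats1 => /rcons_inj [eu ey].
  left; exists (repl a b); split; first exact: merges_replr.
  subst a y; move: e; rewrite dualK => /esym e; rewrite /= in e; subst v2.
  rewrite !ty_cat -eu.
  have := @merge_left _ F (ty v1) (ty w2) x ops f.
  rewrite /cq => ->; last by move: tf; rewrite !ty_cat.
  move: fr; rewrite !lb_cat /= !mem_cat in_cons !negb_or => /and3P[fr1 _ fr2].
  rewrite !rl_cat ep -eu rl_mark !rl_fresh // {1}/repl eqxx -catA.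
  exact: pst_om.
(* Both legs belong to the block, which closes up if it has no others. *)
- case: e => ez ew2; subst z.
  have [ea ep et eu] := mark_split ev.
  have [eb et'] : b = c /\ t = mark c (ty t) by case: et.
  rewrite ew2; subst a b.
  have eu2 : altw x (len ops).+2 = ty p1 ++ [:: y, dual y & ty t] by rewrite eu.
  have [l0|l0] := eqVneq (len ops) 0.
    right; split=> //; move: (congr1 size eu2); rewrite l0 size_altw size_cat /= !addnS.
    move=> -[] /esym/eqP; rewrite addn_eq0 !size_map !size_eq0 => /andP[/eqP-> /eqP->].
    by rewrite cats0.
  left; exists id; split; first by split=> //; left.
  have [ops' [e1 e2]] := sp_cap hslide eu2 l0.
  rewrite rl_id // !ty_cat -[act _ _ _ _](_ : act (ty v1) (sp x ops') (ty v2) f = _).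
    have -> : (v1 ++ p1) ++ t ++ v2 = v1 ++ mark c (altw x (len ops').+2) ++ v2.
      by rewrite -e2 mark_cat -ep -et' -!catA.
    exact: PstBlock.
  rewrite -e1.
  have hl := hom_lay (ty p1) (ty t) (hom_cap F y).
  rewrite /= -eu2 in hl.
  have := act_comp (u := ty v1) (v := ty v2) (hom_sp F x ops) hl (f := f).
  by rewrite act_lay; apply; move: tf; rewrite ty_cat.
(* Both legs lie to the right of the block. *)
subst v2.
have E : (v1 ++ p2) ++ [:: (y, a), (dual y, b) & w2]
         = v1 ++ p2 ++ [:: (y, a), (dual y, b) & w2] by rewrite -catA.
have [[h [hm hP]]|[eab da]] := IH _ _ E.
  left; exists h; split=> //.
  have [ca cb] : c != a /\ c != b.
    by move: fr; rewrite !lb_cat /= !mem_cat !in_cons !negb_or => /and3P[_ _ /and3P[-> ->]].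
  have ehc : h c = c by case: hm => _ _; apply.
  have hP2 : pst (rl h v1 ++ rl h (p2 ++ w2)) (act (ty (v1 ++ p2)) (cap F y) (ty w2) f).
    by rewrite -rl_cat catA.
  have := PstBlock x ops hP2 (c := c).
  rewrite -rl_cat lb_rl.
  have -> : c \notin map h (lb (v1 ++ p2 ++ w2)).
    apply: (merges_notin hm) => //; move: fr; rewrite !lb_cat /= !mem_cat !in_cons !negb_or.
    by case/and3P=> -> -> /and3P[_ _ ->].
  rewrite !rl_cat rl_mark ehc !ty_cat !ty_rl !ty_mark -!catA => /(_ isT).
  have := act_exch (u := ty v1) (m := ty p2) (v := ty w2) (hom_sp F x ops) (hom_cap F y) (f := f).
  by rewrite /= => -> //; move: tf; rewrite !ty_cat /=.
have ca : (a == c) = false.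
  apply/negbTE; rewrite eq_sym; move: fr; rewrite !lb_cat /= !mem_cat !in_cons !negb_or.
  by case/and3P=> _ _ /and3P[].
right; split=> //; rewrite !lb_cat lb_mark !mem_cat mem_nseq ca andbF /=.
by move: da; rewrite !lb_cat !mem_cat -orbA.
Qed.

End Planar.

(** * Labelled words and evaluation of terms *)

Lemma ty_zip u l : size l = size u -> ty (zip u l) = u.
Proof. by move=> e; rewrite /ty -/(unzip1 _) unzip1_zip ?e. Qed.
Lemma lb_zip u l : size l = size u -> lb (zip u l) = l.
Proof. by move=> e; rewrite /lb -/(unzip2 _) unzip2_zip ?e. Qed.
Lemma rl_zip h u l : rl h (zip u l) = zip u (map h l).
Proof. by elim: u l => [|x u IHu] [|c l] //=; rewrite IHu. Qed.

Lemma zip_map_eq (T1 T2 T3 : eqType) (p : T1 -> T3) (q : T2 -> T3) s t a b :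
  map p s = map q t -> (a, b) \in zip s t -> p a = q b.
Proof.
elim: s t => [|x s IHs] [|y t] //= [exy est]; rewrite in_cons => /orP[/eqP[-> ->] //|].
exact: IHs.
Qed.

Section Evaluation.
Variables (C : smcat) (F : frob3 C) (G : signature) (I : gen G -> mor C).
Hypothesis hI : forall g, hom F (gin g) (gout g) (I g).

Lemma hom_eval t : well_typed t -> hom F (tin t) (tout t) (eval F I t).
Proof.
elim: t => [u|g|t2 IH2 t1 IH1|t1 IH1 t2 IH2] //=.
- by move=> _; apply: hom_idw.
- by move=> [/IH2 h2 /IH1 h1 e]; apply: hom_comp h2 _; rewrite -e.
- by move=> [/IH1 h1 /IH2 h2]; apply: hom_tens.
Qed.

Lemma act_tens u v a b a' b' g g' f : hom F a b g -> hom F a' b' g' ->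
  to F (u ++ a ++ a' ++ v) f ->
  act F u (g ⊗ g') v f = act F (u ++ b) g' v (act F u g (a' ++ v) f).
Proof.
move=> hg hg' tf.
have -> : g ⊗ g' = lay F b g' [::] ∘ lay F [::] g a'.
  rewrite /lay idw0 tens1m tensm1 -(tens_comp (hom_idw F b) (hom_cod hg) hg' (hom_cod (hom_idw F a'))).
  by rewrite (comp_id hg') (id_comp (hom_cod hg)).
have h1 := hom_lay [::] a' hg.
have h2 := hom_lay b [::] hg'; rewrite cats0 in h2.
rewrite (act_comp h1 h2); last by rewrite /= -catA.
by rewrite !act_lay /= cats0.
Qed.

End Evaluation.

(** * States of connected diagrams *)

Section Generic.
Variables (C : smcat) (F : frob3 C).
Local Notation act := (act F).
Local Notation hom := (hom F).
Local Notation to := (to F).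

(* [St L w f]: the state [f] with legs [w], whose connected components carry the
   labels [L]. *)
Variable St : seq nat -> lword -> mor C -> Prop.
Hypothesis St_lb : forall L w f, St L w f -> {subset lb w <= L}.
Hypothesis St_to : forall L w f, St L w f -> to (ty w) f.

(* A diagram with nodes [N] acts on states: the labels are merged by [h], and the
   nodes of the diagram are labelled by [l] compatibly with its edges. *)
Definition acts (a b : seq leg) (N : finType) (e : rel N) (nin nout : seq N) (m : mor C) :=
  forall L w1 k w2 f, size k = size a -> St L (w1 ++ zip a k ++ w2) f ->
  exists h (l : N -> nat) L',
  [/\ map l nin = map h k /\ (forall x y, e x y -> l x = l y),
      St L' (rl h w1 ++ zip b (map l nout) ++ rl h w2) (act (ty w1) m (ty w2) f),
      (forall c, c \in L -> h c \in L'),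
      (forall z, l z \in L')
    & (forall c, c \in L' -> (exists2 c0, c0 \in L & c = h c0) \/ exists z, c = l z)].

Variables (G : signature) (I : gen G -> mor C).
Hypothesis hI : forall g, hom (gin g) (gout g) (I g).
Hypothesis size_gin : forall g : gen G, size (gstrand_in g) = size (gin g).
Hypothesis size_gout : forall g : gen G, size (gstrand_out g) = size (gout g).
Hypothesis acts_gen : forall g : gen G,
  acts (gin g) (gout g) (fun _ _ : gstrand g => false) (gstrand_in g) (gstrand_out g) (I g).

Lemma size_node_in (t : term G) : size (node_in t) = size (tin t).
Proof.
elim: t => [u|g|t2 IH2 t1 IH1|t1 IH1 t2 IH2] //=.
- by rewrite size_enum_ord.
- by rewrite size_map.
- by rewrite !size_cat !size_map IH1 IH2.
Qed.

Lemma size_node_out (t : term G) : size (node_out t) = size (tout t).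
Proof.
elim: t => [u|g|t2 IH2 t1 IH1|t1 IH1 t2 IH2] //=.
- by rewrite size_enum_ord.
- by rewrite size_map.
- by rewrite !size_cat !size_map IH1 IH2.
Qed.

Lemma map_nth_enum (k : seq nat) n : size k = n ->
  [seq nth 0 k (val i) | i <- enum 'I_n] = k.
Proof.
move=> e; rewrite (map_comp (nth 0 k) val) val_enum_ord -e.
by rewrite map_nth_iota0 // take_size.
Qed.

(** In a composite or a tensor product the second part may merge labels further, so the node labels
    found for the first part are updated by [h2]. *)
Lemma acts_term (t : term G) : well_typed t ->
  acts (tin t) (tout t) (@edge G t) (node_in t) (node_out t) (eval F I t).
Proof.
elim: t => [u|g|t2 IH2 t1 IH1|t1 IH1 t2 IH2] /=.
- move=> _ L w1 k w2 f sk hSt.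
  exists id, (fun i : 'I_(size u) => nth 0 k i), L; rewrite map_nth_enum // map_id.
  split=> //.
  + rewrite !rl_id // act_id //.
    by have := St_to hSt; rewrite !ty_cat ty_zip.
  + move=> i; apply: (St_lb hSt); rewrite !lb_cat lb_zip // !mem_cat.
    by rewrite mem_nth ?orbT // sk.
  + by move=> c cL; left; exists c.
- by move=> _; apply: acts_gen.
- move=> [wt2 wt1 eio] L w1 k w2 f sk hSt.
  have [h1 [l1 [L1 [[E1 g1] S1 a1 b1 c1]]]] := IH1 wt1 _ _ _ _ _ sk hSt.
  have sk2 : size (map l1 (node_out t1)) = size (tin t2).
    by rewrite size_map size_node_out eio.
  rewrite eio in S1.
  have [h2 [l2 [L2 [[E2 g2] S2 a2 b2 c2]]]] := IH2 wt2 _ _ _ _ _ sk2 S1.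
  exists (h2 \o h1), (fun z => match z with inl a => h2 (l1 a) | inr b => l2 b end), L2.
  split.
  + split; first by rewrite (map_comp h2 h1) -E1 -!map_comp.
    case=> [a|a] [b|b] //.
    * by move=> /g1 ->.
    (* An edge of the composite joins an output of the first diagram to the input that receives its
       label. *)
    * by move=> ab; apply: (zip_map_eq (p := h2 \o l1) _ ab); rewrite E2 -map_comp.
    * exact: g2.
  + rewrite -!(rl_comp h2 h1) -map_comp.
    have he : hom (tout t1) (tout t2) (eval F I t2) by rewrite eio; apply: hom_eval.
    move: S2; rewrite !ty_rl -(act_comp (hom_eval hI wt1) he) //.
    by have := St_to hSt; rewrite !ty_cat ty_zip.
  + by move=> c cL; apply: a2; apply: a1.
  + by case=> z; [apply: a2; apply: b1 | apply: b2].
  + move=> c /c2 [[c0 /c1[[c1' cL ->]|[z ->]] ->]|[z ->]].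
    * by left; exists c1'.
    * by right; exists (inl z).
    * by right; exists (inr z).
- move=> [wt1 wt2] L w1 k w2 f; rewrite size_cat => sk.
  pose k1 := take (size (tin t1)) k; pose k2 := drop (size (tin t1)) k.
  have ek : k = k1 ++ k2 by rewrite cat_take_drop.
  have sk1 : size k1 = size (tin t1) by rewrite size_takel // sk leq_addr.
  have sk2 : size k2 = size (tin t2) by rewrite size_drop sk addKn.
  rewrite ek zip_cat // -catA => hSt.
  have [h1 [l1 [L1 [[E1 g1] S1 a1 b1 c1]]]] := IH1 wt1 _ _ _ _ _ sk1 hSt.
  have sk2' : size (map h1 k2) = size (tin t2) by rewrite size_map.
  rewrite rl_cat rl_zip catA in S1.
  have [h2 [l2 [L2 [[E2 g2] S2 a2 b2 c2]]]] := IH2 wt2 _ _ _ _ _ sk2' S1.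
  exists (h2 \o h1), (fun z => match z with inl a => h2 (l1 a) | inr b => l2 b end), L2.
  split.
  + split.
      rewrite !map_cat -!map_comp /= E2 -map_comp; congr (_ ++ _).
      by rewrite (map_comp h2 h1) -E1 -map_comp.
    case=> [a|a] [b|b] //; first by move=> /g1 ->.
    exact: g2.
  + move: S2; rewrite map_cat -!map_comp /= zip_cat ?size_map ?size_node_out //.
    rewrite -!(rl_comp h2 h1) rl_cat rl_zip -map_comp -!catA !ty_cat !ty_rl.
    rewrite !ty_zip ?size_map ?size_node_out //.
    rewrite (act_tens (hom_eval hI wt1) (hom_eval hI wt2)) //.
    by have := St_to hSt; rewrite !ty_cat !ty_zip.
  + by move=> c cL; apply: a2; apply: a1.
  + by case=> z; [apply: a2; apply: b1 | apply: b2].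
  + move=> c /c2 [[c0 /c1[[c1' cL ->]|[z ->]] ->]|[z ->]].
    * by left; exists c1'.
    * by right; exists (inl z).
    * by right; exists (inr z).
Qed.

End Generic.

(** * Families of states preserved by the pieces of a diagram *)

Section Pieces.
Variables (C : smcat) (F : frob3 C).
Local Notation act := (act F).
Local Notation hom := (hom F).
Local Notation to := (to F).

Variable St : seq nat -> lword -> mor C -> Prop.

(* Multiplications need not be considered: [m] is [w] followed by two caps. *)
Record closed_states : Prop := ClosedStates {
  st_lb : forall L w f, St L w f -> {subset lb w <= L};
  st_hom : forall L w f, St L w f -> hom [::] (ty w) f;
  st_nil : St [::] [::] (idm (unito C));
  st_cup : forall L w1 w2 f c (x : leg), St L (w1 ++ w2) f -> c \notin L ->
    St (c :: L) (w1 ++ mark c [:: dual x; x] ++ w2) (act (ty w1) (cup F x) (ty w2) f);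
  st_split : forall L w1 w2 f c, St L (w1 ++ (LA, c) :: w2) f ->
    St L (w1 ++ mark c [:: LA; LD; LA] ++ w2) (act (ty w1) (fw F) (ty w2) f);
  st_cap : forall L w1 w2 f (y : leg) a b, St L (w1 ++ [:: (y, a), (dual y, b) & w2]) f ->
    exists h, h a = h b /\
      St (map h L) (rl h (w1 ++ w2)) (act (ty w1) (cap F y) (ty w2) f)
}.

Hypothesis hSt : closed_states.

Lemma st_to L w f : St L w f -> to (ty w) f.
Proof. by move=> /(st_hom hSt); apply: hom_cod. Qed.

Definition fresh (L : seq nat) : nat := (\max_(c <- L) c).+1.

Lemma freshP L : fresh L \notin L.
Proof.
apply/negP => fL; have : fresh L <= \max_(c <- L) c by apply: (@leq_bigmax_seq _ L predT id).
by rewrite ltnn.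
Qed.

Lemma hom_cup x : hom [::] [:: dual x; x] (cup F x).
Proof. by case: x; [apply: hom_eta | apply: hom_eta']. Qed.

Lemma hom_piece (p : piece) : hom (piece_in p) (piece_out p) (piece_mor F p).
Proof.
case: p => /=; [exact: hom_fm | exact: hom_fw | exact: hom_eta | exact: hom_eta'
 | exact: hom_eps | exact: hom_eps'].
Qed.

Definition acts_piece_spec (p : piece) (N : finType) (z : N) : Prop :=
  acts F St (piece_in p) (piece_out p) (fun _ _ : N => false)
    (nseq (size (piece_in p)) z) (nseq (size (piece_out p)) z) (piece_mor F p).

Lemma acts_cup x : acts F St [::] [:: dual x; x] (fun _ _ : unit => false) [::] [:: tt; tt] (cup F x).
Proof.
move=> L w1 [|//] w2 f _ S0.
exists id, (fun _ => fresh L), (fresh L :: L); split=> //.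
- by have := st_cup hSt x S0 (freshP L); rewrite !rl_id.
- by move=> c cL; rewrite in_cons cL orbT.
- by move=> _; apply: mem_head.
by move=> c; rewrite in_cons => /orP[/eqP->|cL]; [right; exists tt | left; exists c].
Qed.

Lemma acts_cap x : acts F St [:: x; dual x] [::] (fun _ _ : unit => false) [:: tt; tt] [::] (cap F x).
Proof.
move=> L w1 [|a [|b []]] // w2 f _ S0.
have [h [hab S1]] := st_cap hSt S0.
exists h, (fun _ => h a), (map h L); split=> //.
- by split=> //=; rewrite hab.
- by rewrite -rl_cat.
- by move=> c; apply: map_f.
- by move=> _; apply/map_f/(st_lb hSt S0); rewrite lb_cat mem_cat mem_head orbT.
by move=> c /mapP[c0 c0L ->]; left; exists c0.
Qed.

Lemma fm_of_fw w1 w2 f : to (w1 ++ [:: LA; LD; LA] ++ w2) f ->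
  act w1 (fm F) w2 f
  = act (w1 ++ [:: LA]) (cap F LD) w2
      (act (w1 ++ [:: LA; LD]) (cap F LA) (LA :: w2)
        (act w1 (fw F) [:: LD, LA & w2] f)).
Proof.
move=> tf.
have t0 : to [:: LA; LD; LA] (idw F [:: LA; LD; LA]) by apply: hom_cod (hom_idw F _).
have E := rule_m1 (F := F) t0.
have h1 : hom [:: LA; LD; LA] [:: LA; LD; LA; LD; LA] (lay F [::] (fw F) [:: LD; LA]).
  exact: (hom_lay [::] [:: LD; LA] (hom_fw F)).
have h2 : hom [:: LA; LD; LA; LD; LA] [:: LA; LD; LA] (lay F [:: LA; LD] (eps F) [:: LA]).
  exact: (hom_lay [:: LA; LD] [:: LA] (hom_eps F)).
have h3 : hom [:: LA; LD; LA] [:: LA] (lay F [:: LA] (eps' F) [::]).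
  exact: (hom_lay [:: LA] [::] (hom_eps' F)).
have Em : fm F = lay F [:: LA] (eps' F) [::] ∘ (lay F [:: LA; LD] (eps F) [:: LA]
     ∘ lay F [::] (fw F) [:: LD; LA]).
  rewrite -[LHS](act_nil (hom_fm F)).
  by rewrite -[X in _ ∘ (_ ∘ X)](comp_id h1); exact: esym E.
rewrite Em (act_comp (hom_comp h2 h1) h3 tf) (act_comp h1 h2 tf).
by rewrite !act_lay /= cats0.
Qed.

Lemma acts_m : acts F St [:: LA; LD; LA] [:: LA] (fun _ _ : unit => false)
  [:: tt; tt; tt] [:: tt] (fm F).
Proof.
move=> L w1 [|a [|b [|c []]]] // w2 f _ S0.
have tf := st_to S0; rewrite ty_cat in tf.
have S1 := st_split hSt S0.
have := @st_cap hSt L (w1 ++ mark a [:: LA; LD]) ((LA, c) :: w2) _ LA a b.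
rewrite -catA => /(_ _ S1) [h1 [hab S2]].
have := @st_cap hSt (map h1 L) (rl h1 w1 ++ [:: (LA, h1 a)]) (rl h1 w2) _ LD (h1 a) (h1 c).
rewrite -catA; move: S2; rewrite -catA rl_cat => S2 /(_ _ S2) [h2 [hac S3]].
exists (h2 \o h1), (fun _ => h2 (h1 a)), (map h2 (map h1 L)); split.
- by split=> //=; rewrite -hac hab.
- move: S3; rewrite !ty_cat !ty_rl -!fm_of_fw // -!(rl_comp h2 h1).
  by rewrite -catA rl_cat.
- by move=> d dL; do 2!apply: map_f.
- move=> _; do 2!apply: map_f; apply: (st_lb hSt S0).
  by rewrite lb_cat mem_cat mem_head orbT.
by move=> d /mapP[_ /mapP[d0 dL ->] ->]; left; exists d0.
Qed.

Lemma acts_w : acts F St [:: LA] [:: LA; LD; LA] (fun _ _ : unit => false)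
  [:: tt] [:: tt; tt; tt] (fw F).
Proof.
move=> L w1 [|a []] // w2 f _ S0.
have S1 := st_split hSt S0.
exists id, (fun _ => a), L; split=> //.
- by rewrite !rl_id.
- by move=> _; apply: (st_lb hSt S0); rewrite lb_cat mem_cat mem_head orbT.
by move=> c cL; left; exists c.
Qed.

Lemma acts_piece (p : piece) : acts_piece_spec p tt.
Proof.
case: p; [exact: acts_m | exact: acts_w | exact: (acts_cup LA) | exact: (acts_cup LD)
 | exact: (acts_cap (x := LA)) | exact: (acts_cap (x := LD))].
Qed.

Definition ustar (u : seq leg) : seq leg := rev (map dual u).

Fixpoint cups (u : seq leg) : mor C :=
  if u is x :: u' then act (ustar u') (cup F x) u' (cups u') else idm (unito C).

Lemma ustar_cons x u : ustar (x :: u) = ustar u ++ [:: dual x].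
Proof. by rewrite /ustar /= rev_cons cats1. Qed.

Lemma hom_cups u : hom [::] (ustar u ++ u) (cups u).
Proof.
elim: u => [|x u IHu]; first exact: (hom_idw F [::]).
by rewrite ustar_cons -catA; apply: hom_act (hom_cup x) IHu.
Qed.

(** Each wire shares a fresh label with its bent copy, so every label of this state belongs to an
    input. *)
Lemma st_cups u : exists L k, [/\ size k = size u, L =i k &
  St L (zip (ustar u) (rev k) ++ zip u k) (cups u)].
Proof.
elim: u => [|x u [L [k [sk eL S0]]]].
  by exists [::], [::]; split=> //; apply: st_nil.
exists (fresh L :: L), (fresh L :: k); split=> //=; first by rewrite sk.
  by move=> c; rewrite !in_cons eL.
have := st_cup hSt x S0 (freshP L).
rewrite !ty_zip ?size_rev ?size_map // ustar_cons rev_cons -cats1 zip_cat -?catA //.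
by rewrite !size_rev size_map sk.
Qed.

(* Bends all inputs of [f : u -> v] to the left, in one step. *)
Definition bendl (u : seq leg) (f : mor C) : mor C := act (ustar u) f [::] (cups u).

Section Connected.
Variables (G : signature) (I : gen G -> mor C).
Hypothesis hI : forall g, hom (gin g) (gout g) (I g).
Hypothesis size_gout : forall g : gen G, size (gstrand_out g) = size (gout g).
Hypothesis acts_gen : forall g : gen G,
  acts F St (gin g) (gout g) (fun _ _ : gstrand g => false)
    (gstrand_in g) (gstrand_out g) (I g).

(** Connectedness in terms of labellings: [acts_term] produces one, and the condition passes to bent
    diagrams without following paths. *)
Definition label_connected (t : term G) : Prop :=
  forall l : node t -> nat, (forall x y, edge x y -> l x = l y) -> forall x y, l x = l y.

Lemma connected_label (t : term G) : nonempty_connected t -> label_connected t.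
Proof.
move=> [_ ct] l hl x y; have /connectP[p] := ct x y.
elim: p x => [|z p IHp] x /=; first by move=> _ ->.
by move=> /andP[/orP[/hl->|/hl<-] /IHp H] /H.
Qed.

Lemma connected_state (t : term G) : well_typed t -> label_connected t ->
  exists L w, [/\ St L w (bendl (tin t) (eval F I t)), ty w = ustar (tin t) ++ tout t,
    (forall c d, c \in L -> d \in L -> c = d) &
    (0 < #|node t| -> L != [::])].
Proof.
move=> wt ct.
have [L [k [sk eL S0]]] := st_cups (tin t).
have := @acts_term _ F St (st_lb hSt) st_to G I hI size_gout acts_gen t wt
  L (zip (ustar (tin t)) (rev k)) k [::] _ sk.
rewrite cats0 => /(_ _ S0) [h [l [L' [[El gl] S1 a1 b1 c1]]]].
rewrite /= cats0 ty_zip ?size_rev ?size_map // in S1.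
exists L', (rl h (zip (ustar (tin t)) (rev k)) ++ zip (tout t) [seq l i | i <- node_out t]).
(* All initial labels belong to inputs, hence every label in [L'] is the label of a node. *)
have cl c : c \in L' -> exists z, c = l z.
  move=> /c1 [[c0 c0L ->]|//].
  have : h c0 \in map l (node_in t) by rewrite El map_f // -eL.
  by case/mapP => z _ ->; exists z.
split=> //.
- rewrite ty_cat ty_rl !ty_zip ?size_rev ?size_map //.
  by rewrite (size_node_out size_gout).
- by move=> c d /cl[z ->] /cl[z' ->]; apply: ct.
move=> /card_gt0P[z _]; apply/eqP => L0; have := b1 z; by rewrite L0.
Qed.

End Connected.
End Pieces.

(** * Planar diagrams as spiders, and the inverse of bending *)

Section PlanarDiagrams.
Variables (C : smcat) (F : frob3 C).
Hypothesis hslide : sliding F.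
Local Notation act := (act F).
Local Notation hom := (hom F).
Local Notation to := (to F).
Local Notation idw := (idw F).
Local Notation sp := (spider F).
Local Notation I1 := (idm (unito C)).

(* A label of [L] missing from [w] belongs to a closed component; the state is
   then irrelevant. *)
Definition planar_state (L : seq nat) (w : lword) (f : mor C) : Prop :=
  [/\ hom [::] (ty w) f, {subset lb w <= L}
    & (exists2 c, c \in L & c \notin lb w) \/ pst F w f].

Lemma sp_nil x : sp x [::] = cp F x.
Proof. by rewrite /sp (act_id (u := [::]) (v := [:: dual x])) //; apply: hom_cod (hom_cp F x). Qed.

Lemma planar_closed : closed_states F planar_state.
Proof.
split.
- by move=> L w f [].
- by move=> L w f [].
- by split; [apply: (hom_idw F [::]) | | right; apply: PstNil].
- move=> L w1 w2 f c x [hf sub H] fr.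
  have hg := hom_cup F x.
  split.
  + rewrite !ty_cat ty_mark; apply: hom_act hg _.
    by rewrite -ty_cat.
  + move=> d; rewrite !lb_cat lb_mark !mem_cat mem_nseq in_cons /=.
    case/or3P=> [dw|->//|dw]; rewrite sub ?orbT // lb_cat mem_cat dw ?orbT //.
  case: H => [[d dL dw]|P].
    left; exists d; first by rewrite in_cons dL orbT.
    have dc : (d == c) = false by apply/negbTE; apply: contraNneq fr => <-.
    by move: dw; rewrite !lb_cat lb_mark !mem_cat mem_nseq dc.
  right; have := PstBlock (dual x) [::] P (c := c).
  rewrite sp_nil /cp dualK /= dualK; apply.
  by apply: contra fr => /sub.
- move=> L w1 w2 f c [hf sub H].
  have hg := hom_fw F.
  have mem_lb d : (d \in lb (w1 ++ mark c [:: LA; LD; LA] ++ w2))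
      = (d \in lb (w1 ++ (LA, c) :: w2)) by apply: mem_lb_op.
  split.
  + rewrite !ty_cat ty_mark; apply: hom_act hg _.
    by move: hf; rewrite ty_cat.
  + by move=> d; rewrite mem_lb => /sub.
  case: H => [[d dL dw]|P]; first by left; exists d; rewrite ?mem_lb.
  by right; have := pst_op hslide Comul P.
move=> L w1 w2 f y a b [hf sub H].
have hg := hom_cap F y.
have hr h : hom [::] (ty (rl h (w1 ++ w2))) (act (ty w1) (cap F y) (ty w2) f).
  rewrite ty_rl ty_cat; apply: (hom_act (b := [::]) hg).
  by move: hf; rewrite ty_cat.
have sr h : {subset lb (rl h (w1 ++ w2)) <= map h L}.
  move=> d; rewrite lb_rl => /mapP[d0 d0w ->]; apply/map_f/sub.
  by move: d0w; rewrite !lb_cat /= !mem_cat !in_cons => /orP[] ->; rewrite ?orbT.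
case: H => [[d dL dw]|P].
  (* With a closed component already present, any merging of [a] and [b] will do; this one fixes the
     label [d], which no leg carries. *)
  exists (repl a b); split; first by case: (merges_replr a b).
  split=> //; left; exists (repl a b d); first exact: map_f.
  move: dw; rewrite lb_rl !lb_cat /= !mem_cat !in_cons !negb_or.
  case/and3P=> d1 da /andP[db d2].
  have -> : repl a b d = d by rewrite /repl (negPf da).
  apply: (merges_notin (merges_replr a b)) => //.
  by rewrite mem_cat negb_or d1.
have [[h [hm hP]]|[eab da]] := pst_cap hslide P.
  by exists h; split; [case: hm | split=> //; right].
(* A spider has just been closed: its label stays in [L] but has left the word. *)
exists id; split; first by rewrite eab.
split=> //; left; exists a; last by rewrite rl_id.
by rewrite map_id; apply: sub; rewrite lb_cat mem_cat mem_head orbT.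
Qed.

(** The last block has a label absent from the rest, so the rest is empty when only one label
    occurs. *)
Lemma pst_single w f : pst F w f -> w != [::] ->
  (forall c d, c \in lb w -> d \in lb w -> c = d) ->
  exists x ops, ty w = altw x (len ops).+2 /\ f = sp x ops.
Proof.
case=> // w1 w2 c x ops {}f P fr _ H; exists x, ops.
have e0 : w1 ++ w2 = [::].
  case e: (w1 ++ w2) fr => [//|z u] /negP[].
  rewrite (H c z.2); first by rewrite mem_head.
    by rewrite !lb_cat lb_mark !mem_cat mem_nseq size_altw eqxx orbT.
  have : z.2 \in lb (w1 ++ w2) by rewrite e mem_head.
  by rewrite !lb_cat !mem_cat => /orP[] ->; rewrite ?orbT.
have [e1 e2] : w1 = [::] /\ w2 = [::] by case: (w1) e0.
rewrite {}e1 {}e2 in e0 P *; rewrite /= cats0 ty_mark; split=> //.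
have -> : f = I1.
  inversion P as [|v1 v2 d y ops' g _ _ e] => //.
  by move: e; case: (v1).
by rewrite act0 (comp_id (hom_sp F x ops)).
Qed.

Lemma acts_frob3 (g : gen frob3_sig) :
  acts F planar_state (gin g) (gout g) (fun _ _ : gstrand g => false)
    (gstrand_in g) (gstrand_out g) (piece_mor F g).
Proof. exact: (acts_piece planar_closed). Qed.

Lemma connected_spider (t : term frob3_sig) : well_typed t -> label_connected t ->
  0 < size (tin t) ->
  exists x ops, bendl F (tin t) (eval F (piece_mor F) t) = sp x ops /\
    ustar (tin t) ++ tout t = altw x (len ops).+2.
Proof.
move=> wt ct t0.
have sg (g : gen frob3_sig) : size (gstrand_out g) = size (gout g) by rewrite size_nseq.
have [L [w [[hf sub H] ew cL _]]] :=
  connected_state (G := frob3_sig) planar_closed (hom_piece F) sg acts_frob3 wt ct.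
have w0 : w != [::].
  by apply: contraTneq t0 => w0; move: (congr1 size ew); rewrite w0 size_cat
     size_rev size_map /= => /esym/eqP; rewrite addn_eq0 -leqNgt leqn0 => /andP[].
(* No label can be without legs: all labels coincide, and some leg exists because there is an
   input. *)
case: H => [[c cLc /negP[]]|P].
  case: w w0 sub {ew hf} => // z w _ sub.
  rewrite (cL c z.2) ?mem_head //; apply: sub; exact: mem_head.
have [x [ops [e ->]]] := pst_single P w0 (fun c d cw dw => cL _ _ (sub _ cw) (sub _ dw)).
by exists x, ops; rewrite -ew.
Qed.

Fixpoint capsw (u : seq leg) : mor C :=
  if u is x :: u' then cap F x ∘ lay F [:: x] (capsw u') [:: dual x] else I1.

Lemma hom_capsw u : hom (u ++ ustar u) [::] (capsw u).
Proof.
elim: u => [|x u IHu]; first exact: (hom_idw F [::]).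
rewrite ustar_cons; apply: (hom_comp (hom_cap F x)).
by have := hom_lay [:: x] [:: dual x] IHu; rewrite -catA.
Qed.

Lemma act_capsw_cons p x u v f :
  to (p ++ (x :: u ++ ustar u ++ [:: dual x]) ++ v) f ->
  act p (capsw (x :: u)) v f
  = act p (cap F x) v (act (p ++ [:: x]) (capsw u) (dual x :: v) f).
Proof.
move=> tf.
have h1 : hom (x :: u ++ ustar u ++ [:: dual x]) [:: x; dual x]
    (lay F [:: x] (capsw u) [:: dual x]).
  by have := hom_lay [:: x] [:: dual x] (hom_capsw u); rewrite -catA.
by rewrite (act_comp h1 (hom_cap F x) tf) act_lay.
Qed.

(** Inverse of [bendl]: nested caps straighten the bent inputs. *)
Definition unbendl u v (s : mor C) : mor C :=
  act [::] (capsw u) v (act u s [::] (idw u)).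

(** The snake identity for words: contracting [u] first leaves a single snake for [x]. *)
Lemma zigzag u : unbendl u u (cups F u) = idw u.
Proof.
rewrite /unbendl; elim: u => [|x u IHu].
  by have e := comp_id (hom_idw F [::]); rewrite !act0; rewrite /idw /= in e *; rewrite !e.
have ti : to (x :: u) (idw (x :: u)) by apply: hom_cod (hom_idw F _).
have t1 : to ((x :: u) ++ [::] ++ [::]) (idw (x :: u)) by rewrite !cats0.
have hu := hom_cups F u; have hc := hom_lay (ustar u) u (hom_cup F x).
have t2 : to (x :: u ++ ustar u ++ u) (act (x :: u) (cups F u) [::] (idw (x :: u))).
  by have := to_act hu t1; rewrite cats0.
rewrite [cups F _]/= (act_comp hu hc t1) act_lay cats0.
rewrite (act_capsw_cons (p := [::])); last first.
  have := to_act (u := x :: u ++ ustar u) (v := u) (hom_cup F x) (f := act (x :: u) (cups F u) [::] (idw (x :: u))).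
  by rewrite /= -!catA; apply.
have := act_exch (u := [:: x]) (m := [::]) (v := u) (hom_capsw u) (hom_cup F x)
  (f := act (x :: u) (cups F u) [::] (idw (x :: u))).
rewrite /= cats0 -catA => -> //.
have -> : act [:: x] (capsw u) u (act (x :: u) (cups F u) [::] (idw (x :: u))) = idw (x :: u).
  have h2 := hom_lay [::] u (hom_capsw u).
  have h1 := hom_lay u [::] hu; rewrite !cats0 in h1; rewrite /= -catA in h2.
  have := act_comp (u := [:: x]) (v := [::]) h1 h2.
  rewrite cats0 => /(_ _ ti); rewrite !act_lay /= cats0 => <-.
  have -> : lay F [::] (capsw u) u ∘ lay F u (cups F u) [::] = idw u.
    by rewrite -[RHS]IHu [X in _ = act _ _ _ X](comp_id h1).
  by rewrite act_id // cats0.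
have := @snake_a _ F [::] u (dual x) (idw (x :: u)).
by rewrite /cq /cp dualK => ->.
Qed.

Lemma unbendl_act u v w g s : hom v w g -> hom [::] (ustar u ++ v) s ->
  unbendl u w (act (ustar u) g [::] s) = g ∘ unbendl u v s.
Proof.
move=> hg hs; rewrite /unbendl.
have ti : to u (idw u) by apply: hom_cod (hom_idw F _).
have t1 : to (u ++ [::] ++ [::]) (idw u) by rewrite !cats0.
have hl := hom_lay (ustar u) [::] hg; rewrite !cats0 in hl.
rewrite (act_comp hs hl t1) act_lay.
have := act_exch (u := [::]) (m := [::]) (v := [::]) (hom_capsw u) hg (f := act u s [::] (idw u)).
rewrite /= !cats0 => ->; last by have := to_act hs t1; rewrite cats0 -catA.
by rewrite act0.
Qed.

Lemma bendlK u v g : hom u v g -> unbendl u v (bendl F u g) = g.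
Proof.
by move=> hg; rewrite (unbendl_act hg (hom_cups F u)) zigzag (comp_id hg).
Qed.

End PlanarDiagrams.

(** * Spiders as normal forms *)

Lemma nf_word_altw p : nf_word p = altw LA p.*2.+1.
Proof. by rewrite /nf_word; elim: p => //= p ->. Qed.

Lemma len_cons o a : len (o :: a) = osz o + len a. Proof. by []. Qed.

Lemma len_cat a b : len (a ++ b) = len a + len b.
Proof. by rewrite /len map_cat sumn_cat. Qed.

Lemma nf_word_rcons p : nf_word p ++ [:: LD; LA] = nf_word p.+1.
Proof.
rewrite !nf_word_altw doubleS -[_.+3]/(p.*2.+1.+2) -[_.+1.+2]addn2 altw_cat iter_dual.
by rewrite [odd _]/= odd_double.
Qed.

Section NormalForms.
Variables (C : smcat) (F : frob3 C).
Hypothesis hslide : sliding F.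
Local Notation act := (act F).
Local Notation hom := (hom F).
Local Notation to := (to F).
Local Notation idw := (idw F).
Local Notation om := (ops_mor F).
Local Notation sp := (spider F).
Local Notation gm := (op_mor F).

Lemma om_congr x o a b : om x a = om x b -> len a = len b -> om x (o :: a) = om x (o :: b).
Proof.
move=> e el; change (act [::] (gm o x) (altw (dual x) (len a)) (om x a)
  = act [::] (gm o x) (altw (dual x) (len b)) (om x b)).
by rewrite e el.
Qed.

Lemma om_move x a o b : om x (a ++ o :: b) = om x (o :: a ++ b).
Proof.
elim: a => // o' a IHa; rewrite cat_cons om_swap //.
by apply: om_congr => //; rewrite len_cons !len_cat len_cons addnCA.
Qed.

Lemma om_sort x ops : exists q k k',
  om x ops = om x (nseq q Comul ++ nseq k' (Loop false) ++ nseq k (Loop true)) /\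
  len ops = q.*2.
Proof.
elim: ops => [|o ops [q [k [k' [e el]]]]]; first by exists 0, 0, 0.
have lL b n : len (nseq n (Loop b)) = 0 by elim: n.
have lC n : len (nseq n Comul) = n.*2 by elim: n => //= n; rewrite /len /= => ->.
have E := om_congr o e.
rewrite !len_cat !lL lC !addn0 in E; rewrite {}E //.
case: o => [|[]].
- by exists q.+1, k, k'; rewrite len_cons el.
- exists q, k.+1, k'; split; last by rewrite len_cons el.
  by rewrite -[nseq k.+1 _]/(Loop true :: nseq k _) [in RHS]catA om_move -catA.
exists q, k, k'.+1; split; last by rewrite len_cons el.
by rewrite -[nseq k'.+1 _]/(Loop false :: nseq k' _) cat_cons om_move.
Qed.

(** With [len b = 0] the operations [b] keep a single leg, so the two morphisms compose without
    whiskering. *)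
Lemma om_cat x a b : len b = 0 -> om x (a ++ b) = om x a ∘ om x b.
Proof.
move=> b0.
have hb := hom_om F x b; rewrite b0 in hb.
elim: a => [|o a IHa]; first by rewrite /= id_comp //; apply: hom_cod hb.
rewrite [LHS]/= len_cat b0 addn0 IHa [om x (o :: a)]/= {1}/act (compA_hom (hom_om F x a)) //.
  by case: (hom_lay [::] (altw (dual x) (len a)) (hom_gm F o x)).
exact: hom_cod hb.
Qed.

Lemma om_comul q : om LA (nseq q Comul) = wpow F q.
Proof.
elim: q => [|q IHq]; first exact: idw1.
by rewrite -(om_cons_in hslide) IHq /= /act /lay idw0 tens1m -[[:: LD; LA]]/([:: LD] ++ [:: LA])
  idw_cat !idw1 tensmA.
Qed.

Lemma om_loop b k :
  om LA (nseq k (Loop b)) = endo_pow F (if b then lam F else rho F) k.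
Proof.
elim: k => [|k IHk]; first exact: idw1.
have e0 : len (nseq k (Loop b)) = 0 by elim: (k).
by rewrite [LHS]/= e0 IHk /= act0.
Qed.

Lemma om_sorted q k k' :
  om LA (nseq q Comul ++ nseq k' (Loop false) ++ nseq k (Loop true))
  = wpow F q ∘ endo_pow F (rho F) k' ∘ endo_pow F (lam F) k.
Proof.
have l0 b n : len (nseq n (Loop b)) = 0 by elim: n.
rewrite !om_cat ?len_cat ?l0 // om_comul !om_loop.
have h b n : hom [:: LA] [:: LA] (endo_pow F (if b then lam F else rho F) n).
  by rewrite -om_loop; have := hom_om F LA (nseq n (Loop b)); rewrite l0.
rewrite (compA_hom (h false _)) //; last exact: hom_cod (h true _).
by rewrite -om_comul; case: (hom_om F LA (nseq q Comul)).
Qed.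

Lemma om_catC x a b : om x (a ++ b) = om x (b ++ a).
Proof.
elim: a => [|o a IHa]; first by rewrite cats0.
by rewrite om_move; apply: om_congr => //; rewrite !len_cat addnC.
Qed.

Lemma sp_om_leg x ops ops' p y v : altw x (len ops).+2 = p ++ y :: v ->
  act p (om y ops') v (sp x ops) = sp x (ops' ++ ops) /\
  altw x (len (ops' ++ ops)).+2 = p ++ altw y (len ops').+1 ++ v.
Proof.
move=> e; have ts : to (p ++ [:: y] ++ v) (sp x ops).
  by have := hom_cod (hom_sp F x ops); rewrite e.
elim: ops' => [|o ops' [IH1 IH2]]; first by rewrite act_id.
have hl := hom_lay [::] (altw (dual y) (len ops')) (hom_gm F o y).
have -> : om y (o :: ops') = lay F [::] (gm o y) (altw (dual y) (len ops')) ∘ om y ops' by [].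
have := act_comp (hom_om F y ops') hl ts; rewrite act_lay cats0 => ->.
rewrite IH1; split; first exact: sp_leg.
by rewrite cat_cons !len_cons altw_ow -!addnS (altw_split o IH2) -catA.
Qed.

Lemma mpowS p : mpow F p.+1 = fm F ∘ lay F [::] (mpow F p) [:: LD; LA].
Proof.
by rewrite /= /lay idw0 tens1m -[[:: LD; LA]]/([:: LD] ++ [:: LA]) idw_cat !idw1 tensmA.
Qed.

Lemma hom_mpow p : hom (nf_word p) [:: LA] (mpow F p).
Proof.
elim: p => [|p IHp]; first by rewrite -[mpow F 0]/(idm (obj F LA)) -idw1; apply: hom_idw.
rewrite mpowS -nf_word_rcons; apply: hom_comp (hom_fm F) _.
exact: (hom_lay [::] [:: LD; LA] IHp).
Qed.

(** Associativity turns the left-nested recursion of [mpow] into a right-nested one, suited to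
    [unbendl], which treats the word of inputs from its left end. *)
Lemma mpowSr p : mpow F p.+1 = fm F ∘ lay F [:: LA; LD] (mpow F p) [::].
Proof.
elim: p => [|p IHp].
  rewrite mpowS; congr (_ ∘ _); rewrite -[mpow F 0]/(idm (obj F LA)) -idw1.
  by rewrite !lay_id.
have hm := hom_mpow p; have hf := hom_fm F.
have h1 := hom_lay [:: LA; LD] [:: LD; LA] hm.
have h2 := hom_lay [:: LA; LD] [::] hf.
have h3 := hom_lay [::] [:: LD; LA] hf.
have h4 := hom_lay [:: LA; LD] [::] hm; rewrite !cats0 in h4.
have h5 := hom_lay [::] [:: LD; LA] hm.
have E : fm F ∘ lay F [:: LA; LD] (fm F) [::] = fm F ∘ lay F [::] (fm F) [:: LD; LA].
  have t0 : to [:: LA; LD; LA; LD; LA] (idw [:: LA; LD; LA; LD; LA]).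
    by apply: hom_cod (hom_idw F _).
  have := rule_assoc (F := F) t0.
  rewrite -[run _ _ _]/(act [::] (fm F) [::] (act [:: LA; LD] (fm F) [::] (idw _))).
  rewrite -[in RHS]/(run _ _ _) -[run _ [:: (0, _); _] _]/(act [::] (fm F) [::] (act [::] (fm F) [:: LD; LA] (idw _))).
  by rewrite !act0 /act (comp_id h2) (comp_id h3).
have tY := hom_cod h1.
rewrite mpowS IHp (lay_comp _ _ h4 hf) lay_lay -IHp.
rewrite (compA_hom (F := F) h3 _ tY); last by case: hf.
rewrite -E -(compA_hom (F := F) h2 _ tY); last by case: hf.
congr (_ ∘ _); rewrite mpowS (lay_comp _ _ h5 hf) lay_lay.
by [].
Qed.

Lemma unbendl_ctx p u v s : hom [::] (ustar u ++ v) s ->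
  act p (capsw F u) v (act (p ++ u) s [::] (idw (p ++ u))) = lay F p (unbendl F u v s) [::].
Proof.
move=> hs; have ti : to (p ++ u) (idw (p ++ u)) by apply: hom_cod (hom_idw F _).
have h2 := hom_lay [::] v (hom_capsw F u).
have h1 := hom_lay u [::] hs; rewrite !cats0 in h1; rewrite /= -catA in h2.
have := act_comp (u := p) (v := [::]) h1 h2.
rewrite cats0 => /(_ _ ti); rewrite !act_lay !cats0 => <-.
have := act_lay_id p [::] (hom_comp h2 h1); rewrite cats0 => ->.
by rewrite /unbendl [X in _ = lay _ _ (act _ _ _ X) _](comp_id h1).
Qed.

Lemma m_of_fw e : to [:: LA; LD; LA] e ->
  act [::] (cap F LA) [:: LA] (act [:: LA] (cap F LD) [:: LD; LA] (act [:: LA; LD] (fw F) [::] e))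
  = fm F ∘ e.
Proof. by move=> te; rewrite -(act0 F); apply: (rule_m2 (F := F) te). Qed.

(** Two of the three legs created by the comultiplication become the new leftmost inputs, and
    [rule_m2] recognises a multiplication. *)
Lemma unbendl_fw u s : hom [::] (ustar u ++ [:: LA]) s ->
  unbendl F [:: LA, LD & u] [:: LA] (act (ustar u) (fw F) [::] s)
  = fm F ∘ lay F [:: LA; LD] (unbendl F u [:: LA] s) [::].
Proof.
move=> hs; rewrite /unbendl; set z := idw _.
have tz : to ([:: LA, LD & u] ++ [::] ++ [::]) z.
  by rewrite !cats0; apply: hom_cod (hom_idw F _).
have hw := hom_lay (ustar u) [::] (hom_fw F); rewrite cats0 in hw.
have te := to_act hs tz.
rewrite (act_comp hs hw tz) act_lay !cats0.
have tX : to ([:: LA, LD & u ++ ustar u] ++ [:: LA; LD; LA])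
    (act [:: LA, LD & u ++ ustar u] (fw F) [::] (act [:: LA, LD & u] s [::] z)).
  rewrite -[[:: LA; LD; LA]]cats0; apply: (to_act (hom_fw F)).
  by move: te; rewrite /= !cats0 -catA.
rewrite (act_capsw_cons (p := [::])); last first.
  by move: tX; rewrite ustar_cons /= -!catA.
rewrite act_capsw_cons; last by move: tX; rewrite /= -!catA.
have := act_exch (u := [:: LA; LD]) (m := [::]) (v := [::]) (hom_capsw F u) (hom_fw F)
  (f := act [:: LA, LD & u] s [::] z).
rewrite /= !cats0 => ->; last by move: te; rewrite /= !cats0 -catA.
rewrite (unbendl_ctx [:: LA; LD] hs) m_of_fw //.
have tu : hom u [:: LA] (unbendl F u [:: LA] s).
  apply: (hom_act (u := [::]) (hom_capsw F u)).
  have := hom_act (u := u) (v := [::]) hs (c := u) (f := idw u).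
  by rewrite !cats0 -catA; apply; apply: hom_idw.
by have := hom_cod (hom_lay [:: LA; LD] [::] tu).
Qed.

(** Bending the inputs of an iterated multiplication gives a spider without loops. Its first leg is
    the bent last input, hence the type [LD]. *)
Lemma unbendl_mpow p : unbendl F (nf_word p) [:: LA] (sp LD (nseq p Comul)) = mpow F p /\
  ustar (nf_word p) ++ [:: LA] = altw LD (len (nseq p Comul)).+2.
Proof.
elim: p => [|p [IHp IHw]].
  split=> //; rewrite sp_nil -[cp F LD]/(cup F LA).
  have := zigzag F [:: LA]; rewrite /= act0 (comp_id (hom_eta F)) => ->.
  exact: idw1.
have [s1 s2] := sp_om_leg [:: Comul] (esym IHw).
have hs := hom_sp F LD (nseq p Comul); rewrite -IHw in hs.
have ew : ustar (nf_word p.+1) = ustar (nf_word p) ++ [:: LA; LD].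
  by rewrite -[nf_word p.+1]/(LA :: LD :: nf_word p) !ustar_cons -catA.
split; last by rewrite ew -catA -[nseq p.+1 _]/([:: Comul] ++ nseq p Comul) s2.
rewrite -[nseq p.+1 _]/([:: Comul] ++ nseq p Comul) -s1.
have -> : om LA [:: Comul] = fw F by apply: (act_nil (hom_fw F)).
by rewrite -[nf_word p.+1]/(LA :: LD :: nf_word p) unbendl_fw // IHp mpowSr.
Qed.

Lemma spider_nf p q g : hom (nf_word p) (nf_word q) g ->
  forall ops, bendl F (nf_word p) g = sp LD ops ->
  ustar (nf_word p) ++ nf_word q = altw LD (len ops).+2 ->
  exists k k', g = wpow F q ∘ endo_pow F (rho F) k' ∘ endo_pow F (lam F) k ∘ mpow F p.
Proof.
move=> hg ops eg ew.
have [n [k [k' [eo el]]]] := om_sort LD ops; exists k, k'.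
have en : n = q + p.
  move: (congr1 size ew); rewrite size_cat size_rev size_map !nf_word_altw !size_altw el.
  by rewrite addnS addSn -doubleD addnC => -[] /double_inj.
pose a := nseq q Comul ++ nseq k' (Loop false) ++ nseq k (Loop true).
have lN m : len (nseq m Comul) = m.*2 by elim: m => //= m; rewrite len_cons => ->.
have lL b m : len (nseq m (Loop b)) = 0 by elim: m.
have la : len a = q.*2 by rewrite !len_cat lN !lL !addn0.
have [em ewp] := unbendl_mpow p.
have [es _] := sp_om_leg a (esym ewp).
have hs := hom_sp F LD (nseq p Comul); rewrite -ewp in hs.
have ha := hom_om F LA a; rewrite la -nf_word_altw in ha.
rewrite -[LHS](bendlK hg) eg.
(* Of the [q + p] comultiplications, [p] build the spider of [mpow F p]; the other [q] and all loops
   go to its output leg. *)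
have -> : sp LD ops = sp LD (a ++ nseq p Comul).
  rewrite /sp om_catC /a catA -nseqD addnC -en -eo.
  by [].
by rewrite -es (unbendl_act ha hs) em om_sorted.
Qed.

End NormalForms.

(** * Planar normal forms *)

Lemma ustar_altw x u : ustar u = altw x (size u) -> u = altw (iter (size u) dual x) (size u).
Proof.
elim: u => //= a u IHu; rewrite ustar_cons -[x :: _]/(altw x (size u).+1) altw_rcons.
rewrite !cats1 => /rcons_inj[/IHu eu ea]; rewrite -{}ea in eu *.
by rewrite {1}eu !dualK.
Qed.

(** * Bending of planar terms *)

Section Bending.
Local Notation sg := frob3_sig.
Implicit Types (t : term sg) (x y : leg) (u v : seq leg).

Definition pcup x : gen sg := if x is LA then Peta else Peta'.
Definition pcap x : gen sg := if x is LA then Peps else Peps'.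

(** Bending is carried out on terms, so that the result is again a connected diagram and
    [connected_nf] applies to it. *)
Definition tbend_in_left x u t : term sg :=
  Comp (Tens (Id _ [:: dual x]) t) (Tens (Gen (pcup x)) (Id _ u)).
Definition tbend_in_right u x t : term sg :=
  Comp (Tens t (Id _ [:: dual x])) (Tens (Id _ u) (Gen (pcup (dual x)))).
Definition tbend_out_right v y t : term sg :=
  Comp (Tens (Id _ v) (Gen (pcap y))) (Tens t (Id _ [:: dual y])).

Lemma well_typed_bil x u t : well_typed t -> tin t = x :: u -> well_typed (tbend_in_left x u t).
Proof. by case: x => wt e; split=> //=; rewrite e. Qed.
Lemma well_typed_bir u x t : well_typed t -> tin t = rcons u x -> well_typed (tbend_in_right u x t).
Proof. by case: x => wt e; split=> //=; rewrite e -cats1 -catA. Qed.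
Lemma well_typed_bor v y t : well_typed t -> tout t = rcons v y -> well_typed (tbend_out_right v y t).
Proof. by case: y => wt e; split=> //=; rewrite e -cats1 -catA. Qed.

Lemma comp_labels (f g : term sg) (l : node (Comp g f) -> nat) :
  (forall a b, edge a b -> l a = l b) -> size (node_out f) = size (node_in g) ->
  map (l \o inl) (node_out f) = map (l \o inr) (node_in g).
Proof.
move=> hl.
have H z : z \in zip (node_out f) (node_in g) -> l (inl z.1) = l (inr z.2).
  by case: z => a b zst; apply: (hl (inl a) (inr b)).
move: (node_out f) (node_in g) H => s t.
elim: s t => [|a s IHs] [|b t] //= H [] /IHs ->; last first.
  by move=> z zst; apply: H; rewrite in_cons zst orbT.
by rewrite (H (a, b)) ?mem_head.
Qed.

Lemma labels_const (T : eqType) (l : T -> nat) c (k : seq T) :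
  (forall z, l z = c) -> map l k = nseq (size k) c.
Proof. by move=> H; elim: k => //= z k ->; rewrite H. Qed.

Let size_gin (g : gen sg) : size (gstrand_in g) = size (gin g). Proof. exact: size_nseq. Qed.
Let size_gout (g : gen sg) : size (gstrand_out g) = size (gout g). Proof. exact: size_nseq. Qed.

Lemma cons_nseq_cat (T : Type) (a : T) n s : a :: nseq n a ++ s = nseq n a ++ a :: s.
Proof. by elim: n => //= n ->. Qed.

Lemma map_const_nseq (T : eqType) (l : T -> nat) (k : seq T) c n :
  map l k = nseq n c -> {in k, forall z, l z = c}.
Proof. by move=> e z zk; apply/eqP; have := map_f l zk; rewrite e mem_nseq => /andP[]. Qed.

(** All nodes of [t] share a label [c], and the edges between the two layers of the bend carry it to
    the new cup and identity wires. The other two bends are treated in the same way. *)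
Lemma label_bil x u t : tin t = x :: u -> label_connected t ->
  label_connected (tbend_in_left x u t).
Proof.
move=> et ct l hl.
have sz : size (node_in t) = (size u).+1 by rewrite (size_node_in size_gin) et.
have [z0 _] : exists z0, z0 \in node_in t.
  by case: (node_in t) sz => // z0 s _; exists z0; rewrite mem_head.
have rz z : l (inr (inr z)) = l (inr (inr z0)).
  by apply: (ct (fun z => l (inr (inr z)))) => a b ab; apply: (hl (inr (inr a)) (inr (inr b))).
move: (l (inr (inr z0))) rz => c rz.
have := comp_labels hl.
rewrite [node_in _]/= [node_out _]/= !map_cat
  -!(map_comp (l \o inl) inl) -!(map_comp (l \o inl) inr) -!(map_comp (l \o inr) inl)
  -!(map_comp (l \o inr) inr).
rewrite (@labels_const _ _ c (node_in t)); last by move=> z; apply: rz.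
rewrite (@labels_const _ _ (l (inr (inl ord0))) (enum 'I_1)); last by move=> z /=; rewrite [z]ord1.
rewrite !size_cat !(size_map inl) !(size_map inr) sz !size_enum_ord ?size_nseq.
have -> : piece_out (pcup x) = [:: dual x; x] by case: x {et l hl rz}.
have ha (b : unit) : b = tt by case: b.
move=> /(_ erefl) /= [e1 e2 /map_const_nseq e3].
suff K z : l z = c by move=> z z'; rewrite !K.
case: z => [[b|i]|[i|z]].
- by rewrite (ha b) e2.
- by apply: (e3 i); rewrite mem_enum.
- by rewrite [i]ord1 -e1 e2.
- exact: rz.
Qed.

Lemma label_bir x u t : tin t = rcons u x -> label_connected t ->
  label_connected (tbend_in_right u x t).
Proof.
move=> et ct l hl.
have sz : size (node_in t) = (size u).+1 by rewrite (size_node_in size_gin) et size_rcons.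
have [z0 _] : exists z0, z0 \in node_in t.
  by case: (node_in t) sz => // z0 s _; exists z0; rewrite mem_head.
have rz z : l (inr (inl z)) = l (inr (inl z0)).
  by apply: (ct (fun z => l (inr (inl z)))) => a b ab; apply: (hl (inr (inl a)) (inr (inl b))).
move: (l (inr (inl z0))) rz => c rz.
have := comp_labels hl.
rewrite [node_in _]/= [node_out _]/= !map_cat
  -!(map_comp (l \o inl) inl) -!(map_comp (l \o inl) inr) -!(map_comp (l \o inr) inl)
  -!(map_comp (l \o inr) inr).
rewrite (@labels_const _ _ c (node_in t)); last by move=> z; apply: rz.
rewrite (@labels_const _ _ (l (inr (inr ord0))) (enum 'I_1)); last by move=> z /=; rewrite [z]ord1.
rewrite !size_cat !(size_map inl) !(size_map inr) sz !size_enum_ord ?size_nseq.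
have -> : piece_out (pcup (dual x)) = [:: x; dual x] by case: x {et l hl rz}.
have ha (b : unit) : b = tt by case: b.
rewrite addn2 addn1 => /(_ erefl) /=.
rewrite cons_nseq_cat => /eqP; rewrite eqseq_cat;
  last by rewrite size_nseq size_map size_enum_ord.
case/andP=> /eqP /map_const_nseq e3 /eqP /= [e1 e2].
suff K z : l z = c by move=> z z'; rewrite !K.
case: z => [[i|b]|[z|i]].
- by apply: (e3 i); rewrite mem_enum.
- by rewrite (ha b) e1.
- exact: rz.
- by rewrite [i]ord1 -e2 e1.
Qed.

Lemma label_bor v y t : tout t = rcons v y -> label_connected t ->
  label_connected (tbend_out_right v y t).
Proof.
move=> et ct l hl.
have sz : size (node_out t) = (size v).+1 by rewrite (size_node_out size_gout) et size_rcons.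
have [z0 _] : exists z0, z0 \in node_out t.
  by case: (node_out t) sz => // z0 s _; exists z0; rewrite mem_head.
have rz z : l (inl (inl z)) = l (inl (inl z0)).
  by apply: (ct (fun z => l (inl (inl z)))) => a b ab; apply: (hl (inl (inl a)) (inl (inl b))).
move: (l (inl (inl z0))) rz => c rz.
have := comp_labels hl.
rewrite [node_in _]/= [node_out _]/= !map_cat
  -!(map_comp (l \o inl) inl) -!(map_comp (l \o inl) inr) -!(map_comp (l \o inr) inl)
  -!(map_comp (l \o inr) inr).
rewrite (@labels_const _ _ c (node_out t)); last by move=> z; apply: rz.
rewrite (@labels_const _ _ (l (inl (inr ord0))) (enum 'I_1)); last by move=> z /=; rewrite [z]ord1.
rewrite !size_cat !(size_map inl) !(size_map inr) sz !size_enum_ord ?size_nseq.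
have -> : piece_in (pcap y) = [:: y; dual y] by case: y {et l hl rz}.
have ha (b : unit) : b = tt by case: b.
rewrite addn2 addn1 => /(_ erefl) /=.
rewrite cons_nseq_cat => /eqP; rewrite eqseq_cat;
  last by rewrite size_nseq size_map size_enum_ord.
case/andP=> /eqP /esym /map_const_nseq e3 /eqP /= [e1 e2].
suff K z : l z = c by move=> z z'; rewrite !K.
case: z => [[z|i]|[i|b]].
- exact: rz.
- by rewrite [i]ord1 e2 -e1.
- by apply: (e3 i); rewrite mem_enum.
- by rewrite (ha b) -e1.
Qed.

End Bending.

Section PlanarTheorem.
Variables (C : smcat) (F : frob3 C).
Hypothesis hslide : sliding F.
Local Notation den := (denote F (piece_mor F)).

Lemma connected_nf (t : term frob3_sig) p q : well_typed t -> label_connected t ->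
  tin t = nf_word p -> tout t = nf_word q -> normal_form F (den t).
Proof.
move=> wt ct ei eo.
have ht := hom_eval (G := frob3_sig) (hom_piece F) wt.
have [|x [ops [eb ew]]] := connected_spider hslide wt ct; first by rewrite ei.
have [_ ewp] := unbendl_mpow hslide p.
(* Both words begin with the dual of the last input. *)
have ex : x = LD.
  move: ew ewp; rewrite ei; case: (ustar _) (size_rev (map dual (nf_word p))) => // y u _.
  by case=> -> _ [->].
subst x; rewrite ei eo in eb ew ht.
have [k [k' e]] := spider_nf hslide ht eb ew.
by exists p, q, k, k'; rewrite -e -ei -eo.
Qed.

Lemma planar_theorem (d : term frob3_sig) : is_diagram d -> 0 < size (tin d) ->
  exists Y, bent_at_most_one F (den d) Y /\ normal_form F Y.
Proof.
move=> [wt /connected_label ct] d0.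
have [x [ops [_ ew]]] := connected_spider hslide wt ct d0.
pose s := size (tin d); pose r := size (tout d).
have sr : (len ops).+2 = s + r.
  by rewrite -(size_altw x (len ops).+2) -ew size_cat size_rev size_map.
move: ew; rewrite sr altw_cat => /eqP.
rewrite eqseq_cat ?size_altw ?size_rev ?size_map // => /andP[/eqP /ustar_altw eu /eqP ev].
rewrite -/s in eu; move: eu ev; move: (iter s dual x) => z eu ev.
(* The legs alternate, so their types are determined by [z], the common type of the
   first input and the first output, and by the parities of [s] and [r]. *)
have odd_sr : odd s = odd r.
  by have := congr1 odd sr; rewrite /= odd_len oddD; case: (odd s) (odd r) => [] [].
have ed a u v : tin d = u -> tout d = v -> eval F (piece_mor F) d = a -> den d = LMor u v a.
  by move=> <- <- <-.
have rE n : odd n -> n = n./2.*2.+1 by move=> on; rewrite -[LHS]odd_double_half on.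
have rO n : ~~ odd n -> n = n./2.*2 by move=> /negPf on; rewrite -[LHS]odd_double_half on.
case: (boolP (odd s)) => os.
  have or : odd r by rewrite -odd_sr.
  move: eu ev; rewrite (rE s os) (rE r or); move: s./2 r./2 => p q.
  case: z => eu ev.
    (* Odd lengths with first type [LA] are already the words of a normal form. *)
    exists (den d); split; first exact: BentNone.
    by apply: (connected_nf (p := p) (q := q)) => //; rewrite nf_word_altw.
  (* Both words begin and end with [LD]: the leftmost input and the rightmost output are bent, on
     opposite sides. *)
  pose t1 := tbend_in_left LD (altw LA p.*2) d.
  pose t := tbend_out_right (LA :: altw LD q.*2) LD t1.
  have wt1 : well_typed t1 by apply: well_typed_bil.
  have ct1 : label_connected t1 by apply: label_bil.
  have eq : altw LD q.*2.+1 = altw LD q.*2 ++ [:: LD].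
    by rewrite altw_rcons iter_dual odd_double.
  have et1 : tout t1 = rcons (LA :: altw LD q.*2) LD by rewrite /= ev eq cats1.
  exists (den t); split; last first.
    apply: (connected_nf (p := p) (q := q)).
    - exact: well_typed_bor.
    - exact: label_bor.
    - by rewrite nf_word_altw altw_rcons iter_dual odd_double.
    - by rewrite nf_word_altw /= cats0.
  rewrite (ed _ _ _ eu (etrans ev (etrans eq (cats1 _ _))) erefl).
  have -> : den t = LMor (rcons (altw LA p.*2) (dual LD)) (dual LD :: altw LD q.*2)
     (bend_out_right F (dual LD :: altw LD q.*2) LD
        (bend_in_left F LD (altw LA p.*2) (eval F (piece_mor F) d))).
    by rewrite /denote /= cats1 cats0 /bend_out_right /bend_in_left /= !tenso1.
  exact: BentInLeftOutRight.
have or : ~~ odd r by rewrite -odd_sr.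
(* An even number of inputs is at least two, since there is an input. *)
have es : s./2.*2 = (s./2).-1.*2.+2.
  by rewrite -doubleS prednK // -double_gt0 -(rO s os).
move: eu ev; rewrite (rO s os) (rO r or) es; move: s./2.-1 r./2 => p q.
case: z => eu ev; last first.
  (* Both words have even length and start with [LD]; bending the first input puts [LA] in front of
     both. *)
  exists (den (tbend_in_left LD (altw LA p.*2.+1) d)); split.
    apply: BentIn; rewrite (ed _ _ _ eu erefl erefl).
    have -> : den (tbend_in_left LD (altw LA p.*2.+1) d)
      = LMor (altw LA p.*2.+1) (dual LD :: tout d)
          (bend_in_left F LD (altw LA p.*2.+1) (eval F (piece_mor F) d)).
      by rewrite /denote /bend_in_left /= !tenso1.
    exact: BendInLeft.
  apply: (connected_nf (p := p) (q := q)).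
  - exact: well_typed_bil.
  - exact: label_bil.
  - by rewrite nf_word_altw.
  - by rewrite nf_word_altw /= ev.
(* The input word ends with [LD]; bending that input gives the outputs the final [LA] they lack. *)
have ep : altw LA p.*2.+2 = rcons (altw LA p.*2.+1) LD.
  by rewrite altw_rcons iter_dual [odd _]/= odd_double cats1.
rewrite ep in eu.
exists (den (tbend_in_right (altw LA p.*2.+1) LD d)); split.
  apply: BentIn; rewrite (ed _ _ _ eu erefl erefl).
  have -> : den (tbend_in_right (altw LA p.*2.+1) LD d)
    = LMor (altw LA p.*2.+1) (rcons (tout d) (dual LD))
        (bend_in_right F (altw LA p.*2.+1) LD (eval F (piece_mor F) d)).
    by rewrite /denote /bend_in_right /= !tenso1 cats0 cats1.
  exact: BendInRight.
apply: (connected_nf (p := p) (q := q)).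
- exact: well_typed_bir.
- exact: label_bir.
- by rewrite nf_word_altw /= cats0.
- by rewrite [tout _]/= ev nf_word_altw altw_rcons iter_dual odd_double.
Qed.

End PlanarTheorem.

(** * Permutations of wires *)

Section PermInd.
Variable T : eqType.

(** Induction along adjacent transpositions: the next letter of [w'] is bubbled to the front of [w]
    and then absorbed into the prefix [p]. *)
Lemma perm_swap_ind (Q : seq T -> Prop) w w' : Q w ->
  (forall p x y q, Q (p ++ [:: x, y & q]) -> Q (p ++ [:: y, x & q])) ->
  perm_eq w w' -> Q w'.
Proof.
move=> Qw Qs; suff H p : Q (p ++ w) -> perm_eq w w' -> Q (p ++ w') by apply: (H [::]).
elim: w' w {Qw} p => [|x w' IHw] w p Qw.
  by move=> pw; have e := size0nil (perm_size pw); rewrite e in Qw.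
move=> pw; have xw : x \in w by rewrite (perm_mem pw) mem_head.
case/splitPr: xw Qw pw => a b Qw pw.
rewrite -cat_rcons; apply: (IHw (a ++ b)).
  elim/last_ind: a {pw} b Qw => [|a y IHa] b Qw; first by rewrite cat_rcons.
  rewrite (cat_rcons y a); apply: IHa; rewrite catA; apply: Qs; rewrite -catA.
  by move: Qw; rewrite cat_rcons.
rewrite -(perm_cons x); apply: perm_trans pw.
by rewrite -(cat1s x b) -(cat1s x (a ++ b)) perm_catCA.
Qed.

End PermInd.

(** * Symmetries between words *)

Section Symmetries.
Variables (C : smcat) (F : frob3 C) (S : symmetry C).
Implicit Types (a b c u v : seq leg) (f g : mor C).
Local Notation act := (act F).
Local Notation hom := (hom F).
Local Notation to := (to F).
Local Notation idw := (idw F).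

Definition sym_words a b : mor C := sym S (objs F a) (objs F b).
Local Notation sw := sym_words.

Lemma hom_sw a b : hom (a ++ b) (b ++ a) (sw a b).
Proof. by case: (sym_hom S (objs F a) (objs F b)) => d c; split; rewrite objs_cat. Qed.

Lemma sw_nat a a' b b' f g : hom a a' f -> hom b b' g ->
  sw a' b' ∘ (f ⊗ g) = (g ⊗ f) ∘ sw a b.
Proof. by move=> [da ca] [db cb]; rewrite /sw -da -ca -db -cb sym_natural. Qed.

Lemma swK a b : sw b a ∘ sw a b = idw (a ++ b).
Proof. by rewrite /sw sym_inv /idw objs_cat. Qed.

Lemma sw_catl a b c : sw (a ++ b) c = (sw a c ⊗ idw b) ∘ (idw a ⊗ sw b c).
Proof. by rewrite /sw objs_cat sym_hexagon. Qed.

Lemma hom_inj a b f g g' : hom a b f -> hom b a g -> hom b a g' ->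
  f ∘ g = idw b -> g' ∘ f = idw a -> g = g'.
Proof.
move=> hf hg hg' e e'.
rewrite -(id_comp (hom_cod hg)) -e' -(compA_hom hf) ?e ?(comp_id hg') //.
  by case: hg'.
exact: hom_cod hg.
Qed.

(** The second hexagon follows from the first, as both sides are inverse to the same symmetry. *)
Lemma sw_catr a b c : sw a (b ++ c) = (idw b ⊗ sw a c) ∘ (sw a b ⊗ idw c).
Proof.
have h1 := hom_tens (hom_sw b a) (hom_idw F c).
have h2 := hom_tens (hom_idw F b) (hom_sw c a).
have h3 := hom_tens (hom_sw a b) (hom_idw F c).
have h4 := hom_tens (hom_idw F b) (hom_sw a c).
have hs := hom_sw (b ++ c) a; have hs' := hom_sw a (b ++ c).
rewrite -!catA in h1 h2 h3 h4 hs hs'.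
apply: (hom_inj hs hs'); [exact: hom_comp h4 h3 | exact: swK |].
rewrite sw_catl.
have tI := hom_cod h2.
rewrite -(compA_hom h3) //; [|by case: h4|exact: hom_cod (hom_comp h1 h2)].
rewrite (compA_hom h1) //; last by case: h3.
have -> : (sw a b ⊗ idw c) ∘ (sw b a ⊗ idw c) = idw (b ++ a ++ c).
  rewrite -(tens_comp (hom_sw a b) (hom_cod (hom_sw b a)) (hom_idw F c) (hom_cod (hom_idw F c))).
  by rewrite swK (id_comp (hom_cod (hom_idw F c))) -idw_cat catA.
rewrite id_comp //.
rewrite -(tens_comp (hom_idw F b) (hom_cod (hom_idw F b)) (hom_sw a c) (hom_cod (hom_sw c a))).
by rewrite swK (id_comp (hom_cod (hom_idw F b))) -idw_cat.
Qed.

(** The hexagon makes this symmetry idempotent; being invertible, it is an identity. *)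
Lemma sw_0l c : sw [::] c = idw c.
Proof.
have h : hom c c (sw [::] c) by have := hom_sw [::] c; rewrite cats0.
have h' : hom c c (sw c [::]) by have := hom_sw c [::]; rewrite cats0.
have e : sw [::] c = sw [::] c ∘ sw [::] c.
  by have := sw_catl [::] [::] c; rewrite idw0 tens1m tensm1.
have k : sw c [::] ∘ sw [::] c = idw c by rewrite swK.
have := compA_hom h (_ : dom (sw c [::]) = objs F c) (hom_cod h).
by rewrite -e k (id_comp (hom_cod h)) => -> //; case: h'.
Qed.

Lemma sw_0r c : sw c [::] = idw c.
Proof.
have h' : hom c c (sw c [::]) by have := hom_sw c [::]; rewrite cats0.
by have := swK [::] c; rewrite sw_0l (comp_id h').
Qed.

Lemma act_sw_l u v a a' b g f : hom a a' g -> to (u ++ a ++ b ++ v) f ->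
  act u (sw a' b) v (act u g (b ++ v) f) = act (u ++ b) g v (act u (sw a b) v f).
Proof.
move=> hg tf.
have tf' : to (u ++ (a ++ b) ++ v) f by rewrite -catA.
have hb := hom_idw F b.
have h1 : hom (a ++ b) (a' ++ b) (lay F [::] g b) := hom_lay [::] b hg.
have h2 : hom (b ++ a) (b ++ a') (lay F b g [::]).
  by have := hom_lay b [::] hg; rewrite !cats0.
have := act_comp h1 (hom_sw a' b) tf'; rewrite act_lay cats0 /= => <-.
have := act_comp (hom_sw a b) h2 tf'; rewrite act_lay => <-.
congr (act u _ v f).
by rewrite /lay idw0 tens1m tensm1 (sw_nat hg hb).
Qed.

Lemma act_sw_r u v a b b' g f : hom b b' g -> to (u ++ a ++ b ++ v) f ->
  act u (sw a b') v (act (u ++ a) g v f) = act u g (a ++ v) (act u (sw a b) v f).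
Proof.
move=> hg tf.
have tf' : to (u ++ (a ++ b) ++ v) f by rewrite -catA.
have ha := hom_idw F a.
have h1 : hom (b ++ a) (b' ++ a) (lay F [::] g a) := hom_lay [::] a hg.
have h2 : hom (a ++ b) (a ++ b') (lay F a g [::]).
  by have := hom_lay a [::] hg; rewrite !cats0.
have := act_comp (hom_sw a b) h1 tf'; rewrite act_lay cats0 /= => <-.
have := act_comp h2 (hom_sw a b') tf'; rewrite act_lay => <-.
congr (act u _ v f).
by rewrite /lay idw0 tens1m tensm1 (sw_nat ha hg).
Qed.

Lemma act_sw_catl u v a b c f : to (u ++ a ++ b ++ c ++ v) f ->
  act u (sw (a ++ b) c) v f = act u (sw a c) (b ++ v) (act (u ++ a) (sw b c) v f).
Proof.
move=> tf; rewrite sw_catl.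
have tf' : to (u ++ (a ++ b ++ c) ++ v) f by rewrite -!catA.
have h1 : hom (a ++ b ++ c) (a ++ c ++ b) (lay F a (sw b c) [::]).
  by have := hom_lay a [::] (hom_sw b c); rewrite !cats0.
have h2 : hom (a ++ c ++ b) ((c ++ a) ++ b) (lay F [::] (sw a c) b).
  by have := hom_lay [::] b (hom_sw a c); rewrite -!catA.
have := act_comp h1 h2 tf'; rewrite !act_lay cats0 /= => <-.
by rewrite /lay idw0 tens1m tensm1.
Qed.

Lemma act_sw_catr u v a b c f : to (u ++ a ++ b ++ c ++ v) f ->
  act u (sw a (b ++ c)) v f = act (u ++ b) (sw a c) v (act u (sw a b) (c ++ v) f).
Proof.
move=> tf; rewrite sw_catr.
have tf' : to (u ++ (a ++ b ++ c) ++ v) f by rewrite -!catA.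
have h1 : hom (a ++ b ++ c) (b ++ a ++ c) (lay F [::] (sw a b) c).
  by have := hom_lay [::] c (hom_sw a b); rewrite -!catA.
have h2 : hom (b ++ a ++ c) (b ++ c ++ a) (lay F b (sw a c) [::]).
  by have := hom_lay b [::] (hom_sw a c); rewrite !cats0.
have := act_comp h1 h2 tf'; rewrite !act_lay cats0 /= => <-.
by rewrite /lay idw0 tens1m tensm1.
Qed.

Lemma act_swK u v a b f : to (u ++ a ++ b ++ v) f ->
  act u (sw b a) v (act u (sw a b) v f) = f.
Proof.
move=> tf; have tf' : to (u ++ (a ++ b) ++ v) f by rewrite -catA.
by rewrite -(act_comp (hom_sw a b) (hom_sw b a) tf') swK act_id.
Qed.

Lemma to_sw u v a b f : to (u ++ a ++ b ++ v) f -> to (u ++ b ++ a ++ v) (act u (sw a b) v f).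
Proof. by move=> tf; have := to_act (u := u) (v := v) (hom_sw a b) (f := f); rewrite -!catA; apply. Qed.

End Symmetries.

(** * Canonical isomorphisms between orderings of wires *)

Section Permutations.
Variables (C : smcat) (F : frob3 C) (S : symmetry C).
Variables (N : eqType) (tn : N -> leg).
Implicit Types (u v : seq leg) (a b c p q w : seq N) (x y : N) (f g : mor C).
Local Notation act := (act F).
Local Notation hom := (hom F).
Local Notation to := (to F).
Local Notation idw := (idw F).
Local Notation sw := (sym_words F S).
Local Notation tw := (map tn).

(* The canonical isomorphism from the wires [w] to the wires [w'], for a
   duplicate-free word [w] and a permutation [w'] of it. *)
Fixpoint perm_mor (w' w : seq N) : mor C :=
  if w' is x :: q then
    let i := index x w in
    lay F [:: tn x] (perm_mor q (take i w ++ drop i.+1 w)) [::]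
      ∘ lay F [::] (sw (tw (take i w)) [:: tn x]) (tw (drop i.+1 w))
  else idw [::].
Local Notation P := perm_mor.

Lemma P_cons x q a b : x \notin a ->
  P (x :: q) (a ++ x :: b) = lay F [:: tn x] (P q (a ++ b)) [::]
    ∘ lay F [::] (sw (tw a) [:: tn x]) (tw b).
Proof.
move=> xa /=; rewrite index_cat (negPf xa) /= eqxx addn0.
by rewrite take_size_cat // -cat_rcons drop_size_cat ?size_rcons.
Qed.

Arguments perm_mor : simpl never.

Lemma perm_take x q w : uniq w -> perm_eq w (x :: q) ->
  exists a b, [/\ w = a ++ x :: b, x \notin a & perm_eq (a ++ b) q].
Proof.
move=> uw pw; have xw : x \in w by rewrite (perm_mem pw) mem_head.
case/splitPr: xw uw pw => a b uw pw; exists a, b; split=> //.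
  by move: uw; rewrite cat_uniq /= negb_or => /and3P[_ /andP[]].
rewrite -(perm_cons x); apply: perm_trans pw.
by rewrite -(cat1s x b) -(cat1s x (a ++ b)) perm_catCA.
Qed.

Lemma hom_P w w' : uniq w -> perm_eq w w' -> hom (tw w) (tw w') (P w' w).
Proof.
elim: w' w => [|x w' IHw] w uw pw.
  by rewrite (size0nil (perm_size pw)); apply: hom_idw.
have [a [b [ew xa pab]]] := perm_take uw pw.
subst w; rewrite P_cons //.
have uab : uniq (a ++ b).
  by move: uw; rewrite -(cat1s x b) uniq_catCA /= => /andP[].
have h1 : hom (tw (a ++ x :: b)) (tn x :: tw (a ++ b))
   (lay F [::] (sw (tw a) [:: tn x]) (tw b)).
  by have := hom_lay [::] (tw b) (hom_sw F S (tw a) [:: tn x]); rewrite !map_cat /= -catA.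
apply: hom_comp h1.
by have := hom_lay [:: tn x] [::] (IHw _ uab pab); rewrite !cats0.
Qed.

Lemma act_P_cons u v x q a b f : uniq (a ++ x :: b) -> perm_eq (a ++ b) q ->
  to (u ++ tw (a ++ x :: b) ++ v) f ->
  act u (P (x :: q) (a ++ x :: b)) v f
  = act (u ++ [:: tn x]) (P q (a ++ b)) v
      (act u (sw (tw a) [:: tn x]) (tw b ++ v) f).
Proof.
move=> uw pab tf.
have xa : x \notin a by move: uw; rewrite cat_uniq /= negb_or => /and3P[_ /andP[]].
have uab : uniq (a ++ b).
  by move: uw; rewrite -(cat1s x b) uniq_catCA /= => /andP[].
rewrite P_cons //.
have h1 : hom (tw (a ++ x :: b)) (tn x :: tw (a ++ b))
   (lay F [::] (sw (tw a) [:: tn x]) (tw b)).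
  by have := hom_lay [::] (tw b) (hom_sw F S (tw a) [:: tn x]); rewrite !map_cat /= -catA.
have h2 : hom (tn x :: tw (a ++ b)) (tn x :: tw q) (lay F [:: tn x] (P q (a ++ b)) [::]).
  by have := hom_lay [:: tn x] [::] (hom_P uab pab); rewrite !cats0.
by rewrite (act_comp h1 h2 tf) !act_lay cats0.
Qed.

Lemma act_P_id u v w f : uniq w -> to (u ++ tw w ++ v) f -> act u (P w w) v f = f.
Proof.
elim: w u => [|x w IHw] u uw tf; first by rewrite act_id.
rewrite (act_P_cons (a := [::])) // sw_0l act_id //.
by apply: IHw; [case/andP: uw | rewrite -catA].
Qed.

Lemma P_id w : uniq w -> P w w = idw (tw w).
Proof.
move=> uw; have h := hom_P uw (perm_refl w).
rewrite -[LHS](comp_id h) -(act0 F) act_P_id //= cats0.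
exact: hom_cod (hom_idw F _).
Qed.

Lemma uniq_cat_cons a x b : uniq (a ++ x :: b) -> uniq (a ++ b).
Proof. by rewrite -(cat1s x b) uniq_catCA /= => /andP[]. Qed.

(** Here [x] precedes [y] in the source: if [y] is extracted first it also crosses [x], and the
    hexagon splits off this extra crossing. *)
Lemma act_P_swap0 u v x y q a b c f :
  uniq (a ++ x :: b ++ y :: c) -> perm_eq (a ++ b ++ c) q ->
  to (u ++ tw (a ++ x :: b ++ y :: c) ++ v) f ->
  act u (P [:: y, x & q] (a ++ x :: b ++ y :: c)) v f
  = act u (sw [:: tn x] [:: tn y]) (tw q ++ v)
      (act u (P [:: x, y & q] (a ++ x :: b ++ y :: c)) v f).
Proof.
move=> uw pq tf.
have exy : a ++ x :: b ++ y :: c = (a ++ x :: b) ++ y :: c by rewrite -catA.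
have u1 := uniq_cat_cons uw.
have u1' : uniq ((a ++ b) ++ y :: c) by rewrite -catA.
have u2' : uniq ((a ++ x :: b) ++ y :: c) by rewrite -exy.
have u2 := uniq_cat_cons u2'.
have p1 : perm_eq (a ++ b ++ y :: c) (y :: q).
  rewrite catA -(cat1s y) perm_catCA /= perm_cons -catA; exact: pq.
have p2 : perm_eq ((a ++ x :: b) ++ c) (x :: q).
  by rewrite -catA /= -(cat1s x) perm_catCA /= perm_cons.
have p3 : perm_eq ((a ++ b) ++ c) q by rewrite -catA.
have u3 : uniq (a ++ x :: b ++ c) by move: u2; rewrite -catA.
have tfx := tf; rewrite !map_cat /= !map_cat /= -!catA /= -!catA in tfx.
have t1 := @to_sw _ F S _ _ (tw a) [:: tn x] _ tfx.
have t2 : to (u ++ [:: tn y] ++ tw (a ++ x :: b) ++ tw c ++ v)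
    (act u (sw (tw (a ++ x :: b)) [:: tn y]) (tw c ++ v) f).
  by apply: to_sw; move: tf; rewrite exy (map_cat _ (a ++ x :: b)) /= -catA.
have E1 : act u (P [:: y, x & q] (a ++ x :: b ++ y :: c)) v f
  = act (u ++ [:: tn y; tn x]) (P q (a ++ b ++ c)) v
      (act (u ++ [:: tn y]) (sw (tw a) [:: tn x]) (tw (b ++ c) ++ v)
        (act u (sw (tw (a ++ x :: b)) [:: tn y]) (tw c ++ v) f)).
  have := act_P_cons (v := v) u2' p2 (f := f); rewrite -exy => -> //.
  have := act_P_cons (u := u ++ [:: tn y]) (v := v) u3 pq
    (f := act u (sw (tw (a ++ x :: b)) [:: tn y]) (tw c ++ v) f).
  rewrite -!catA /= => -> //.
  by move: t2; rewrite !map_cat /= !map_cat -!catA /= -!catA.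
have E2 : act u (P [:: x, y & q] (a ++ x :: b ++ y :: c)) v f
  = act (u ++ [:: tn x; tn y]) (P q (a ++ b ++ c)) v
      (act (u ++ [:: tn x]) (sw (tw (a ++ b)) [:: tn y]) (tw c ++ v)
        (act u (sw (tw a) [:: tn x]) (tw (b ++ y :: c) ++ v) f)).
  rewrite (act_P_cons uw p1) //.
  have := act_P_cons (u := u ++ [:: tn x]) (v := v) u1' p3
    (f := act u (sw (tw a) [:: tn x]) (tw (b ++ y :: c) ++ v) f).
  rewrite -!catA /= => -> //.
  by move: t1; rewrite !map_cat /= -!catA /=.
rewrite {}E1 {}E2.
have hq : hom (tw (a ++ b ++ c)) (tw q) (P q (a ++ b ++ c)).
  by apply: hom_P => //; rewrite catA; apply: uniq_cat_cons u1'.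
have := act_exch (u := u) (m := [::]) (v := v) (hom_sw F S [:: tn x] [:: tn y]) hq
  (f := act (u ++ [:: tn x]) (sw (tw (a ++ b)) [:: tn y]) (tw c ++ v)
        (act u (sw (tw a) [:: tn x]) (tw (b ++ y :: c) ++ v) f)).
rewrite /= => ->; last first.
  have := @to_sw _ F S (u ++ [:: tn x]) (tw c ++ v) (tw (a ++ b)) [:: tn y]
    (act u (sw (tw a) [:: tn x]) (tw (b ++ y :: c) ++ v) f).
  rewrite ?(map_cat, cat_cons) -?catA /= ?map_cat -?catA; apply.
  by move: t1; rewrite ?map_cat -?catA /= ?map_cat -?catA.
congr act.
have := @act_sw_catl _ F S u (tw c ++ v) [:: tn x] (tw (a ++ b)) [:: tn y]
  (act u (sw (tw a) [:: tn x]) (tw (b ++ y :: c) ++ v) f).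
rewrite [tw (a ++ b ++ c)]map_cat [tw (b ++ c)]map_cat [tw (a ++ b)]map_cat -!catA => <-; last first.
  by move: t1; rewrite map_cat /= -!catA.
have hl : hom (tw (a ++ x :: b)) (tn x :: tw a ++ tw b) (lay F [::] (sw (tw a) [:: tn x]) (tw b)).
  by have := hom_lay [::] (tw b) (hom_sw F S (tw a) [:: tn x]); rewrite map_cat /= -catA.
have := @act_sw_l _ F S u (tw c ++ v) _ _ [:: tn y] _ f hl.
rewrite map_cat /= -!catA => /(_ tfx).
have := act_lay F u [::] (sw (tw a) [:: tn x]) (tw b) (tn y :: tw c ++ v) f.
rewrite cats0 map_cat /= -!catA => -> ->.
by rewrite act_lay cats0.
Qed.

(** When [y] precedes [x] in the source, [act_P_swap0] is used with the two exchanged and the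
    symmetry is inverted. *)
Lemma act_P_swap u v p q x y w f :
  uniq w -> perm_eq w (p ++ [:: x, y & q]) -> to (u ++ tw w ++ v) f ->
  act u (P (p ++ [:: y, x & q]) w) v f
  = act (u ++ tw p) (sw [:: tn x] [:: tn y]) (tw q ++ v)
      (act u (P (p ++ [:: x, y & q]) w) v f).
Proof.
elim: p u w f => [|z p IHp] u w f uw pw tf; last first.
  have [a [b [ew za pab]]] := perm_take uw pw; subst w.
  have pab' : perm_eq (a ++ b) (p ++ [:: y, x & q]).
    by apply: perm_trans pab _; rewrite perm_cat2l -(cat1s x) -(cat1s y) perm_catCA.
  rewrite !cat_cons !act_P_cons // IHp //.
  - by rewrite -catA.
  - exact: uniq_cat_cons uw.
  have := @to_sw _ F S u (tw b ++ v) (tw a) [:: tn z] f.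
  by rewrite !map_cat /= -!catA /=; apply; move: tf; rewrite map_cat /= -!catA.
have xw : x \in w by rewrite (perm_mem pw) mem_head.
have yw : y \in w by rewrite (perm_mem pw) in_cons mem_head orbT.
rewrite /= cats0.
case/splitPr: xw uw pw tf yw => a c uw pw tf yw.
have nxy : x != y.
  by move: uw; rewrite (perm_uniq pw) /= in_cons negb_or => /andP[/andP[]].
have pac : perm_eq (a ++ c) (y :: q).
  rewrite -(perm_cons x); apply: perm_trans pw.
  by rewrite -(cat1s x c) -(cat1s x (a ++ c)) perm_catCA.
have {yw} yac : (y \in a) || (y \in c).
  by move: yw; rewrite mem_cat in_cons eq_sym (negPf nxy).
have [ya|ya] := boolP (y \in a).
  case/splitPr: ya uw pw tf pac {yac} => a1 a2; rewrite -!catA /= => uw pw tf pac.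
  have pq : perm_eq (a1 ++ a2 ++ c) q.
    rewrite -(perm_cons y); apply: perm_trans pac.
    by rewrite -(cat1s y (a2 ++ c)) -(cat1s y (a1 ++ _)) perm_catCA.
  rewrite (act_P_swap0 uw pq tf) act_swK //.
  have hq := hom_P uw (_ : perm_eq _ [:: y, x & q]).
  have := to_act (u := u) (v := v) (hq _) tf; rewrite /=; apply.
  by apply: perm_trans pw _; rewrite -(cat1s x) -(cat1s y) perm_catCA.
move: yac; rewrite (negPf ya) /= => yc.
case/splitPr: yc uw pw tf pac => c1 c2 uw pw tf pac.
apply: act_P_swap0 => //.
rewrite -(perm_cons y); apply: perm_trans pac.
by rewrite catA -(cat1s y c2) -(cat1s y (_ ++ _)) (catA a) perm_catCA -!catA.
Qed.

Lemma to_P u v w w' f : uniq w -> perm_eq w w' -> to (u ++ tw w ++ v) f ->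
  to (u ++ tw w' ++ v) (act u (P w' w) v f).
Proof. by move=> uw pw; apply: to_act (hom_P uw pw). Qed.

(** The coherence statement on which all later permutation calculations rest, by induction along
    adjacent transpositions from [w'] to [w'']. *)
Lemma act_P_comp u v w w' w'' f :
  uniq w -> perm_eq w w' -> perm_eq w' w'' -> to (u ++ tw w ++ v) f ->
  act u (P w'' w') v (act u (P w' w) v f) = act u (P w'' w) v f.
Proof.
move=> uw pw pw' tf.
have uw' : uniq w' by rewrite -(perm_uniq pw).
have tf' := to_P uw pw tf.
suff [] : perm_eq w' w'' /\
  act u (P w'' w') v (act u (P w' w) v f) = act u (P w'' w) v f by [].
apply: (@perm_swap_ind _ (fun z => perm_eq w' z /\
  act u (P z w') v (act u (P w' w) v f) = act u (P z w) v f) w') => //.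
  by split=> //; rewrite act_P_id.
move=> p x y q [pz e].
have sp : perm_eq (p ++ [:: x, y & q]) (p ++ [:: y, x & q]).
  by rewrite perm_cat2l -(cat1s x) -(cat1s y) perm_catCA.
split; first exact: perm_trans pz sp.
rewrite (act_P_swap uw' pz tf') (act_P_swap uw (perm_trans pw pz) tf).
by rewrite e.
Qed.

Lemma act_P_inv u v w w' f : uniq w -> perm_eq w w' -> to (u ++ tw w ++ v) f ->
  act u (P w w') v (act u (P w' w) v f) = f.
Proof.
move=> uw pw tf; rewrite act_P_comp ?act_P_id //; by rewrite perm_sym.
Qed.

Lemma act_P_catl u v a w w' f : uniq (a ++ w) -> perm_eq w w' ->
  to (u ++ tw (a ++ w) ++ v) f ->
  act u (P (a ++ w') (a ++ w)) v f = act (u ++ tw a) (P w' w) v f.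
Proof.
elim: a u => [|x a IHa] u uw pw tf; first by rewrite /= cats0.
rewrite (act_P_cons (a := [::])) ?perm_cat2l // sw_0l act_id //.
rewrite IHa -?catA //; by case/andP: uw.
Qed.

Lemma act_P_catr u v b w w' f : uniq (w ++ b) -> perm_eq w w' ->
  to (u ++ tw (w ++ b) ++ v) f ->
  act u (P (w' ++ b) (w ++ b)) v f = act u (P w' w) (tw b ++ v) f.
Proof.
elim: w' u w f => [|x w' IHw] u w f uw pw tf.
  rewrite (size0nil (perm_size pw)) /= act_P_id // ?act_id //; move: uw tf;
    by rewrite (size0nil (perm_size pw)).
have uw0 : uniq w by move: uw; rewrite cat_uniq => /andP[].
have [a [c [ew xa pac]]] := perm_take uw0 pw; subst w.
have tf2 : to (u ++ tw (a ++ x :: c) ++ tw b ++ v) f.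
  by move: tf; rewrite (map_cat _ _ b) -catA.
have e : (a ++ x :: c) ++ b = a ++ x :: (c ++ b) by rewrite -catA.
have pw1 : perm_eq (a ++ (c ++ b)) (w' ++ b) by rewrite catA perm_cat2r.
have uab : uniq ((a ++ c) ++ b) by move: uw; rewrite e -catA; apply: uniq_cat_cons.
have t1 : to ((u ++ [:: tn x]) ++ tw ((a ++ c) ++ b) ++ v)
    (act u (sw (tw a) [:: tn x]) (tw (c ++ b) ++ v) f).
  have := @to_sw _ F S u (tw (c ++ b) ++ v) (tw a) [:: tn x] f.
  rewrite ?map_cat -?catA /= ?map_cat -?catA; apply; move: tf2.
  by rewrite ?map_cat -?catA /= ?map_cat -?catA.
rewrite (act_P_cons (v := tw b ++ v) uw0 pac tf2); rewrite e in uw tf *.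
rewrite cat_cons (act_P_cons uw pw1 tf) (catA a) (IHw _ _ _ uab pac t1).
by rewrite map_cat -catA.
Qed.

(** Identifies a block symmetry as a canonical isomorphism, so that [act_P_comp] can absorb it. *)
Lemma act_P_block u v a w1 w2 f : uniq (a ++ w1 ++ w2) ->
  to (u ++ tw (a ++ w1 ++ w2) ++ v) f ->
  act u (P (w1 ++ a ++ w2) (a ++ w1 ++ w2)) v f = act u (sw (tw a) (tw w1)) (tw w2 ++ v) f.
Proof.
elim: w1 u f => [|x w1 IHw] u f uw tf.
  by rewrite /= act_P_id // sw_0r act_id //; move: tf; rewrite map_cat -?catA.
rewrite !cat_cons act_P_cons //; last by rewrite perm_catCA.
rewrite IHw; [|exact: uniq_cat_cons uw|]; last first.
  have := @to_sw _ F S u (tw (w1 ++ w2) ++ v) (tw a) [:: tn x] f.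
  rewrite ?map_cat -?catA /= ?map_cat -?catA; apply.
  by move: tf; rewrite ?map_cat -?catA /= ?map_cat -?catA.
have := @act_sw_catr _ F S u (tw w2 ++ v) (tw a) [:: tn x] (tw w1) f.
rewrite /= => ->; first by rewrite map_cat -catA.
by move: tf; rewrite ?map_cat -?catA /= ?map_cat -?catA.
Qed.

Lemma act_P_block' u v a w1 w2 f : uniq (w1 ++ a ++ w2) ->
  to (u ++ tw (w1 ++ a ++ w2) ++ v) f ->
  act u (P (a ++ w1 ++ w2) (w1 ++ a ++ w2)) v f = act u (sw (tw w1) (tw a)) (tw w2 ++ v) f.
Proof.
move=> uw tf.
have tf2 : to (u ++ tw w1 ++ tw a ++ tw w2 ++ v) f.
  by move: tf; rewrite ?map_cat -?catA.
have ts := to_sw S tf2.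
have uw' : uniq (a ++ w1 ++ w2) by rewrite uniq_catCA.
rewrite -{1}(act_swK S tf2) -act_P_block //; last by move: ts; rewrite ?map_cat -?catA.
rewrite act_P_inv //; first by rewrite perm_catCA.
by move: ts; rewrite ?map_cat -?catA.
Qed.

Lemma act_P2 u v (i j : N) f : i != j -> to (u ++ [:: tn i; tn j] ++ v) f ->
  act u (P [:: j; i] [:: i; j]) v f = act u (sw [:: tn i] [:: tn j]) v f.
Proof.
move=> ne tf; have := act_P_block (u := u) (v := v) (a := [:: i]) (w1 := [:: j]) (w2 := [::]) (f := f).
by rewrite [uniq _]/= in_cons in_nil orbF ne; apply.
Qed.

Lemma act_P3 u v (i j k : N) f : uniq [:: i; j; k] -> to (u ++ [:: tn i; tn j; tn k] ++ v) f ->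
  act u (P [:: k; j; i] [:: i; j; k]) v f
  = act u (sw [:: tn j] [:: tn k]) (tn i :: v)
      (act u (sw [:: tn i] [:: tn j; tn k]) v f).
Proof.
move=> uq tf.
have := act_P_block (u := u) (v := v) (a := [:: i]) (w1 := [:: j; k]) (w2 := [::]) (f := f) uq tf.
rewrite /= => <-.
have p1 : perm_eq [:: i; j; k] [:: j; k; i] by rewrite -(cat1s i) perm_catC.
have u1 : uniq [:: j; k; i] by rewrite -(perm_uniq p1).
have t1 := to_P uq p1 tf.
have := act_P_block (u := u) (v := v) (a := [:: j]) (w1 := [:: k]) (w2 := [:: i]) u1 t1.
rewrite /= => <-.
rewrite act_P_comp //.
exact: permEl (perm_catCA [:: j] [:: k] [:: i]).
Qed.

Lemma act_P_nat u v a b w1 w2 w3 w4 g f : hom (tw a) (tw b) g ->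
  uniq (w3 ++ a ++ w4) -> uniq (w3 ++ b ++ w4) -> perm_eq (w3 ++ w4) (w1 ++ w2) ->
  to (u ++ tw (w3 ++ a ++ w4) ++ v) f ->
  act (u ++ tw w1) g (tw w2 ++ v) (act u (P (w1 ++ a ++ w2) (w3 ++ a ++ w4)) v f)
  = act u (P (w1 ++ b ++ w2) (w3 ++ b ++ w4)) v (act (u ++ tw w3) g (tw w4 ++ v) f).
Proof.
move=> hg ua ub pw.
(* The permutation is factored: the block [c] moves to the front, the other wires are permuted, and
   the block moves to its place. *)
have D c e : uniq (w3 ++ c ++ w4) -> to (u ++ tw (w3 ++ c ++ w4) ++ v) e ->
  act u (P (w1 ++ c ++ w2) (w3 ++ c ++ w4)) v e
  = act u (sw (tw c) (tw w1)) (tw w2 ++ v)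
      (act (u ++ tw c) (P (w1 ++ w2) (w3 ++ w4)) v
         (act u (sw (tw w3) (tw c)) (tw w4 ++ v) e)).
  move=> uc te.
  have uc1 : uniq (c ++ w3 ++ w4) by rewrite uniq_catCA.
  have pc : perm_eq (c ++ w3 ++ w4) (c ++ w1 ++ w2) by rewrite perm_cat2l.
  have uc2 : uniq (c ++ w1 ++ w2) by rewrite -(perm_uniq pc).
  have p1 : perm_eq (w3 ++ c ++ w4) (c ++ w3 ++ w4) by rewrite perm_catCA.
  have p2 : perm_eq (c ++ w1 ++ w2) (w1 ++ c ++ w2) by rewrite perm_catCA.
  have t1 := to_P uc p1 te.
  have t2 := to_P uc1 pc t1.
  rewrite -(act_P_comp uc (perm_trans p1 pc) p2 te) -(act_P_comp uc p1 pc te).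
  rewrite -(act_P_block' uc te) -(act_P_catl uc1 pw t1).
  exact: act_P_block.
move=> tf.
have tf2 : to (u ++ tw w3 ++ tw a ++ tw w4 ++ v) f by move: tf; rewrite ?map_cat -?catA.
have tg := to_act (u := u ++ tw w3) (v := tw w4 ++ v) hg (f := f).
rewrite -!catA in tg; have {}tg := tg tf2.
have u12 : uniq (w3 ++ w4) by move: ua; rewrite uniq_catCA cat_uniq => /and3P[].
have hP := hom_P u12 pw.
rewrite (D a) // (D b) //; last by move: tg; rewrite ?map_cat -?catA.
have t1 := to_sw S tf2.
have t2 : to (u ++ tw a ++ tw w1 ++ tw w2 ++ v)
  (act (u ++ tw a) (P (w1 ++ w2) (w3 ++ w4)) v (act u (sw (tw w3) (tw a)) (tw w4 ++ v) f)).
  have := to_act (u := u ++ tw a) (v := v) hP (f := act u (sw (tw w3) (tw a)) (tw w4 ++ v) f).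
  by rewrite ?map_cat -?catA; apply.
rewrite -(act_sw_l S hg t2); congr act.
have := act_exch (u := u) (m := [::]) (v := v) hg hP (f := act u (sw (tw w3) (tw a)) (tw w4 ++ v) f).
rewrite /= !cats0 !map_cat -!catA => ->; last exact: t1.
by congr act; rewrite (act_sw_r S hg tf2).
Qed.

End Permutations.

Arguments perm_mor : simpl never.

(** * Consequences of commutativity for the generators *)

Section Commutative.
Variables (C : smcat) (F : frob3 C) (S : symmetry C).
Hypothesis hcomm : frob3_commutative F S.
Implicit Types (u v : seq leg) (f g e : mor C).
Local Notation act := (act F).
Local Notation hom := (hom F).
Local Notation to := (to F).
Local Notation idw := (idw F).
Local Notation sw := (sym_words F S).
Local Notation I1 := (idm (unito C)).

(* Names for the wires of concrete diagrams: even ones have type A, odd ones type A^*. *)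
Definition par (i : nat) : leg := if odd i then LD else LA.
Local Notation P := (perm_mor F S par).

Lemma eps'_sw : eps' F = eps F ∘ sw [:: LD] [:: LA].
Proof.
case: hcomm => _ ->; rewrite /sw /= !tenso1.
have [d1 c1] := sym_hom S (fD F) (fA F); have [d2 c2] := sym_hom S (fA F) (fD F).
have [d3 c3] := eps'_hom F.
by rewrite -compmA ?c1 ?d2 ?c2 ?d3 // sym_inv -d3 compm1.
Qed.

(** The symmetry [tau] is the canonical isomorphism reversing three wires. *)
Lemma fm_P u v i j k f : uniq [:: i; j; k] -> par i = LA -> par j = LD -> par k = LA ->
  to (u ++ [:: LA; LD; LA] ++ v) f ->
  act u (fm F) v (act u (P [:: k; j; i] [:: i; j; k]) v f) = act u (fm F) v f.
Proof.
move=> uq ei ej ek tf; rewrite (act_P3 S uq) ?ei ?ej ?ek //.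
have h1 : hom [:: LA; LD; LA] [:: LD; LA; LA] (sw [:: LA] [:: LD; LA]) := hom_sw F S [:: LA] [:: LD; LA].
have h2 : hom [:: LD; LA; LA] [:: LA; LD; LA] (lay F [::] (sw [:: LD] [:: LA]) [:: LA]).
  exact: (hom_lay [::] [:: LA] (hom_sw F S [:: LD] [:: LA])).
have hf := hom_fm F.
have := act_comp h1 h2 tf; rewrite act_lay cats0 /= => <-.
rewrite -(act_comp (hom_comp h2 h1) hf tf).
case: hcomm => {2}-> _; congr (act u (_ ∘ _) v f).
by rewrite /tau /lay idw0 tens1m idw1 /sw /= !tenso1.
Qed.

(* [eta'] and the crossed [eta] are both duals of [eps']. *)
Lemma eta'_sw : eta' F = sw [:: LD] [:: LA] ∘ eta F.
Proof.
pose X := sw [:: LD] [:: LA] ∘ eta F.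
have hs : hom [:: LD; LA] [:: LA; LD] (sw [:: LD] [:: LA]) := hom_sw F S [:: LD] [:: LA].
have hX : hom [::] [:: LA; LD] X := hom_comp hs (hom_eta F).
(* The crossed [eta] satisfies a snake identity with [eps'], just as [eta'] does. *)
have K e : to [:: LA] e -> act [:: LA] (eps' F) [::] (act [::] X [:: LA] e) = e.
  move=> te.
  rewrite (act_comp (u := [::]) (hom_eta F) hs te).
  have tz := to_act (u := [::]) (v := [:: LA]) (hom_eta F) te.
  have t2 := to_act (u := [:: LA]) (v := [::]) (hom_eta F) te.
  have e1 : act [::] (eta F) [:: LA] e = act [::] (P [:: 1; 2; 0] [:: 0; 1; 2]) [::] (act [:: LA] (eta F) [::] e).
    have := @act_P_nat _ F S _ par [::] [::] [::] [:: 1; 2] [::] [:: 0] [:: 0] [::] _ e (hom_eta F)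
      isT isT isT te.
    by rewrite /= act_P_id.
  have e2 g : to [:: LD; LA; LA] g ->
     act [::] (sw [:: LD] [:: LA]) [:: LA] g = act [::] (P [:: 2; 1; 0] [:: 1; 2; 0]) [::] g.
    move=> tg; have := act_P_block S (tn := par) (u := [::]) (v := [::]) (a := [:: 1]) (w1 := [:: 2]) (w2 := [:: 0]) (f := g) isT tg.
    by rewrite /= => ->.
  rewrite e2 // e1 act_P_comp //.
  have t3 : to [:: LA; LD; LA] (act [::] (P [:: 2; 1; 0] [:: 0; 1; 2]) [::] (act [:: LA] (eta F) [::] e)).
    exact: (@to_P _ F S _ par [::] [::] [:: 0; 1; 2] [:: 2; 1; 0] _ isT isT t2).
  rewrite eps'_sw (act_comp (u := [:: LA]) (v := [::]) hs (hom_eps F) t3).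
  have := act_P_block S (tn := par) (u := [:: LA]) (v := [::]) (a := [:: 1]) (w1 := [:: 0]) (w2 := [::]) isT t3.
  rewrite /= => <-.
  have := @act_P_catl _ F S _ par [::] [::] [:: 2] [:: 1; 0] [:: 0; 1] _ isT isT t3.
  rewrite /= => <-.
  rewrite act_P_comp //.
  have := @act_P_nat _ F S _ par [::] [::] [:: 0; 1] [::] [:: 2] [::] [::] [:: 2] _ _ (hom_eps F)
    isT isT isT t2.
  rewrite /= => ->; rewrite act_P_id //; last exact: (to_act (u := [::]) (v := [:: LA]) (hom_eps F) t2).
  exact: (ruleS1 (F := F) te).
have tX := hom_cod hX.
(* Uniqueness of duals: [X] is expanded by a snake containing [eta'], and the snake [K] then removes
   [X]. *)
have := @snake_a _ F [:: LA] [::] LA X tX.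
rewrite [cq F LA]/= [cp F LA]/= => eX; rewrite -[RHS]eX.
have hI : to [::] I1 by apply: hom_cod (hom_idw F [::]).
have -> : act ([:: LA] ++ [:: dual LA]) (eta' F) [::] X = act [::] X [:: LA; LD] (eta' F).
  have := act_exch (u := [::]) (m := [::]) (v := [::]) hX (hom_eta' F) hI.
  by rewrite /= !act0 (comp_id (hom_eta' F)) (comp_id hX).
have te' := hom_cod (hom_eta' F).
have := act_act2 (p := [::]) (p1 := [::]) (p2 := [:: LA]) (v := [:: LD]) (v1 := [:: LA]) (v2 := [::]) (f := eta' F) hX (hom_eps' F) erefl te'.
rewrite /= => ->.
have := K _ (hom_cod (hom_idw F [:: LA])).
rewrite /act (comp_id (hom_lay [::] [:: LA] hX)) => ->.
by rewrite -/(act _ _ _ _) act_id.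
Qed.

Definition tw := map par.

(** Exchanging the two kinds of cup costs only a permutation of named wires, which [act_P_comp]
    absorbs. *)
Lemma flip_eta p r d a f : uniq (p ++ [:: a; d] ++ r) -> par a = LA -> par d = LD ->
  to (tw p ++ tw r) f ->
  act (tw p) (eta F) (tw r) f
  = act [::] (P (p ++ [:: d; a] ++ r) (p ++ [:: a; d] ++ r)) [::] (act (tw p) (eta' F) (tw r) f).
Proof.
move=> uq ea ed tf.
have t1 := to_act (u := tw p) (v := tw r) (hom_eta F) tf.
have t2 := to_act (u := tw p) (v := tw r) (hom_eta' F) tf.
have pq : perm_eq [:: a; d] [:: d; a] := permEl (perm_catC [:: a] [:: d]).
have ua : uniq ([:: a; d] ++ r) by move: uq; rewrite cat_uniq => /and3P[].
have t2' : to ([::] ++ tw (p ++ [:: a; d] ++ r) ++ [::]) (act (tw p) (eta' F) (tw r) f).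
  by rewrite cats0 /tw !map_cat /= ea ed.
rewrite act_P_catl // ?perm_cat2r // act_P_catr //; last by move: t2'; rewrite /tw !map_cat -!catA.
rewrite cats0 (act_P2 S) //; first last.
- by rewrite ea ed /=; move: t2.
- by case/andP: ua; rewrite in_cons negb_or => /andP[].
rewrite ea ed eta'_sw (act_comp (u := tw p) (hom_eta F) (hom_sw F S [:: LD] [:: LA])) //.
by rewrite act_swK.
Qed.

Lemma flip_eta' p r d a f : uniq (p ++ [:: d; a] ++ r) -> par a = LA -> par d = LD ->
  to (tw p ++ tw r) f ->
  act (tw p) (eta' F) (tw r) f
  = act [::] (P (p ++ [:: a; d] ++ r) (p ++ [:: d; a] ++ r)) [::] (act (tw p) (eta F) (tw r) f).
Proof.
move=> uq ea ed tf.
have pq : perm_eq [:: a; d] [:: d; a] := permEl (perm_catC [:: a] [:: d]).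
have pq2 : perm_eq (p ++ [:: a; d] ++ r) (p ++ [:: d; a] ++ r) by rewrite perm_cat2l perm_cat2r.
have uq2 : uniq (p ++ [:: a; d] ++ r) by rewrite (perm_uniq pq2).
have t2 := to_act (u := tw p) (v := tw r) (hom_eta' F) tf.
have t2' : to ([::] ++ tw (p ++ [:: a; d] ++ r) ++ [::]) (act (tw p) (eta' F) (tw r) f).
  by rewrite cats0 /tw !map_cat /= ea ed.
by rewrite (@flip_eta p r d a f) // act_P_inv.
Qed.

Lemma lam_rho : lam F = rho F.
Proof.
have te : to [:: LA] (idw [:: LA]) by apply: hom_cod (hom_idw F _).
have -> : lam F = act [::] (fm F) [::] (act [::] (eta' F) [:: LA] (idw [:: LA])).
  rewrite -[LHS](act_nil (hom_lam F)); exact: (rule_l (F := F) te).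
have -> : rho F = act [::] (fm F) [::] (act [:: LA] (eta F) [::] (idw [:: LA])).
  rewrite -[LHS](act_nil (hom_rho F)); exact: (rule_r (F := F) te).
have t2 := to_act (u := [:: LA]) (v := [::]) (hom_eta F) te.
have := @flip_eta' [::] [:: 0] 1 2 _ isT erefl erefl te; rewrite /= => ->.
have := @act_P_nat _ F S _ par [::] [::] [::] [:: 1; 2] [::] [:: 0] [:: 0] [::] _ _ (hom_eta F)
  isT isT isT te.
rewrite /= act_P_id // => ->; rewrite act_P_comp //.
exact: (@fm_P [::] [::] 0 1 2).
Qed.

(** Reversal turns one side of the symmetry axiom into the other: [fm_P] reverses the multiplication
    and the flips exchange the cups. *)
Lemma comul_revA e : to [:: LA] e ->
  act [::] (P [:: 6; 3; 2] [:: 2; 3; 6]) [::] (act [::] (fw F) [::] e) = act [::] (fw F) [::] e.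
Proof.
move=> te.
pose Y := act [::] (eta' F) [:: LA] e.
pose X := act [:: LA] (eta F) [:: LD; LA] Y.
have tY : to [:: LA; LD; LA] Y := to_act (u := [::]) (v := [:: LA]) (hom_eta' F) te.
have tX : to [:: LA; LD; LA; LD; LA] X := to_act (u := [:: LA]) (v := [:: LD; LA]) (hom_eta F) tY.
have E2 : act [::] (fw F) [::] e = act [:: LA; LD] (fm F) [::] X := rule_w2 (F := F) te.
have E1 : act [::] (fw F) [::] e
   = act [::] (fm F) [:: LD; LA] (act [:: LA; LD] (eta' F) [:: LA] (act [:: LA] (eta F) [::] e)).
  exact: (rule_w1 (F := F) te).
rewrite {1}E2 E1.
(* The input is wire 0, the cups create 1, 2 and 3, 4, and 6 is the output of the multiplication. *)
have := @act_P_nat _ F S _ par [::] [::] [:: 4; 1; 0] [:: 6] [::] [:: 3; 2] [:: 2; 3] [::] _ X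
  (hom_fm F) isT isT isT tX.
rewrite /= => <-.
have tZ := @to_P _ F S _ par [::] [::] [:: 2; 3; 4; 1; 0] [:: 4; 1; 0; 3; 2] _ isT isT tX.
have := @fm_P [::] [:: LD; LA] 4 1 0 _ isT erefl erefl erefl tZ.
rewrite /= => <-; congr (act _ _ _ _).
have := @act_P_catr _ F S _ par [::] [::] [:: 3; 2] [:: 4; 1; 0] [:: 0; 1; 4] _ isT isT tZ.
rewrite /= => <-; rewrite act_P_comp //.
have := @flip_eta [:: 2] [:: 1; 0] 3 4 Y isT erefl erefl tY; rewrite /= -/X => ->.
have tX' : to [:: LA; LA; LD; LD; LA] (act [:: LA] (eta' F) [:: LD; LA] Y).
  exact: (to_act (u := [:: LA]) (v := [:: LD; LA]) (hom_eta' F) tY).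
rewrite act_P_comp //.
have := @act_P_nat _ F S _ par [::] [::] [::] [:: 4; 3] [:: 0; 1] [:: 2] [:: 2] [:: 1; 0] _ Y
  (hom_eta' F) isT isT isT tY.
rewrite /= => <-; congr (act _ _ _ _).
have := @flip_eta' [::] [:: 0] 1 2 _ isT erefl erefl te; rewrite /= -/Y => ->.
have t1 := to_act (u := [::]) (v := [:: LA]) (hom_eta F) te.
rewrite act_P_comp //.
have := @act_P_nat _ F S _ par [::] [::] [::] [:: 1; 2] [:: 0] [::] [::] [:: 0] _ _ (hom_eta F)
  isT isT isT te.
by rewrite /= act_P_id // => <-.
Qed.

(** The transposed comultiplication is its own mirror image, its two cups being exchanged. Wire 5 is
    the input and 6 the output of the multiplication. *)
Lemma comul_revD e : to [:: LD] e ->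
  act [::] (P [:: 3; 6; 1] [:: 1; 6; 3]) [::] (act [::] (op_mor F Comul LD) [::] e)
  = act [::] (op_mor F Comul LD) [::] e.
Proof.
move=> te.
pose Y := act [::] (eta F) [:: LD] e.
pose X := act [:: LD; LA; LD] (eta' F) [::] Y.
have tY : to [:: LD; LA; LD] Y := to_act (u := [::]) (v := [:: LD]) (hom_eta F) te.
have tX : to [:: LD; LA; LD; LA; LD] X := to_act (u := [:: LD; LA; LD]) (v := [::]) (hom_eta' F) tY.
have E : act [::] (op_mor F Comul LD) [::] e = act [:: LD] (fm F) [:: LD] X := rule_v (F := F) te.
rewrite E.
have := @act_P_nat _ F S _ par [::] [::] [:: 2; 5; 4] [:: 6] [:: 3] [:: 1] [:: 1] [:: 3] _ X
  (hom_fm F) isT isT isT tX.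
rewrite /= => <-.
have tZ := @to_P _ F S _ par [::] [::] [:: 1; 2; 5; 4; 3] [:: 3; 2; 5; 4; 1] _ isT isT tX.
have := @fm_P [:: LD] [:: LD] 2 5 4 _ isT erefl erefl erefl tZ.
rewrite /= => <-; congr (act _ _ _ _).
have := @act_P_catr _ F S _ par [:: LD] [::] [:: 1] [:: 2; 5; 4] [:: 4; 5; 2] _ isT isT tZ.
rewrite /= => <-.
have := @act_P_catl _ F S _ par [::] [::] [:: 3] [:: 2; 5; 4; 1] [:: 4; 5; 2; 1] _ isT isT tZ.
rewrite /= => <-; rewrite act_P_comp //.
have := @flip_eta' [:: 1; 2; 5] [::] 3 4 Y isT erefl erefl tY; rewrite /= -/X => {1}->.
have tX' : to [:: LD; LA; LD; LD; LA] (act [:: LD; LA; LD] (eta F) [::] Y).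
  exact: (to_act (u := [:: LD; LA; LD]) (v := [::]) (hom_eta F) tY).
rewrite act_P_comp //.
have := @act_P_nat _ F S _ par [::] [::] [::] [:: 3; 4] [::] [:: 5; 2; 1] [:: 1; 2; 5] [::] _ Y
  (hom_eta F) isT isT isT tY.
rewrite /= => <-.
have := @flip_eta [::] [:: 5] 1 2 _ isT erefl erefl te; rewrite /= -/Y => {1}->.
have t1 := to_act (u := [::]) (v := [:: LD]) (hom_eta' F) te.
rewrite act_P_comp //.
have := @act_P_nat _ F S _ par [::] [::] [::] [:: 2; 1] [:: 5] [::] [::] [:: 5] _ _ (hom_eta' F)
  isT isT isT te.
rewrite /= act_P_id // => <-.
exact: (act_exch (u := [::]) (m := [:: LD]) (v := [::]) (hom_eta F) (hom_eta' F) te).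
Qed.

End Commutative.

(** * Permuted collections of spiders *)

Section Interleave.
Variable T : eqType.
Implicit Types s t : seq T.

Fixpoint il s t : seq T :=
  if s is x :: s' then (if t is y :: t' then x :: y :: il s' t' else [::]) else [::].

Lemma il_cat s s' t t' : size s = size t -> il (s ++ s') (t ++ t') = il s t ++ il s' t'.
Proof. by elim: s t => [|x s IHs] [|y t] //= [/IHs ->]. Qed.

Lemma perm_il s t : size s = size t -> perm_eq (il s t) (s ++ t).
Proof.
elim: s t => [|x s IHs] [|y t] //= [e]; rewrite perm_cons.
rewrite -(cat1s y t) perm_sym perm_catCA perm_cons perm_sym; exact: IHs.
Qed.

Lemma size_split (s p q : seq T) : size s = size (p ++ q) ->
  exists sp sq, [/\ s = sp ++ sq, size sp = size p & size sq = size q].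
Proof.
rewrite size_cat => e; exists (take (size p) s), (drop (size p) s).
by rewrite cat_take_drop size_takel ?size_drop e ?leq_addr // addKn.
Qed.

End Interleave.

Lemma altw_next x n p z y v : altw x n = p ++ [:: z, y & v] -> y = dual z.
Proof.
elim: p x n => [|t p IHp] x [|n] //=; first by case=> <-; case: n => //= n [].
by case=> _ /IHp.
Qed.

Section Blocks.
Variables (C : smcat) (F : frob3 C) (S : symmetry C).
Hypothesis hslide : sliding F.
Hypothesis hcomm : frob3_commutative F S.
Implicit Types (u v : seq leg) (f g e : mor C).
Local Notation act := (act F).
Local Notation hom := (hom F).
Local Notation to := (to F).
Local Notation idw := (idw F).
Local Notation sw := (sym_words F S).
Local Notation sp := (spider F).
Local Notation gm := (op_mor F).

(* The two symmetries exchange the first and the third leg. *)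
Lemma comul_rev u v x f : to (u ++ [:: x] ++ v) f ->
  act u (sw [:: dual x] [:: x]) (x :: v)
    (act u (sw [:: x] [:: dual x; x]) v (act u (gm Comul x) v f))
  = act u (gm Comul x) v f.
Proof.
move=> tf.
have hg : hom [:: x] [:: x; dual x; x] (gm Comul x) := hom_gm F Comul x.
have h1 : hom [:: x; dual x; x] [:: dual x; x; x] (sw [:: x] [:: dual x; x]).
  exact: (hom_sw F S [:: x] [:: dual x; x]).
have h2 : hom [:: dual x; x; x] [:: x; dual x; x] (lay F [::] (sw [:: dual x] [:: x]) [:: x]).
  exact: (hom_lay [::] [:: x] (hom_sw F S [:: dual x] [:: x])).
have ti : to [:: x] (idw [:: x]) by apply: hom_cod (hom_idw F _).
have tg := to_act (u := [::]) (v := [::]) hg ti.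
have E : lay F [::] (sw [:: dual x] [:: x]) [:: x] ∘ (sw [:: x] [:: dual x; x] ∘ gm Comul x)
   = gm Comul x.
  rewrite -[RHS](act_nil hg).
  transitivity (act [::] (sw [:: dual x] [:: x]) [:: x]
    (act [::] (sw [:: x] [:: dual x; x]) [::] (act [::] (gm Comul x) [::] (idw [:: x])))).
    by rewrite (act_nil hg) act0.
  case: x {tf} hg h1 h2 ti tg => hg h1 h2 ti tg.
  - rewrite -[RHS](comul_revA hcomm ti).
    by rewrite (act_P3 S (tn := par) (u := [::]) (v := [::]) (i := 2) (j := 3) (k := 6)).
  - rewrite -[RHS](comul_revD hcomm ti).
    by rewrite (act_P3 S (tn := par) (u := [::]) (v := [::]) (i := 1) (j := 6) (k := 3)).
have tg2 := to_act hg tf.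
have := act_comp h1 h2 tg2; rewrite act_lay cats0 /= => <-.
rewrite -(act_comp hg (hom_comp h2 h1) tf).
by rewrite -(compA_hom h1) ?E //; [case: h2 | apply: hom_cod hg].
Qed.

(** The type is part of the name, so [tn] is a projection and a number may be used once for each
    type. *)
Definition name : eqType := (leg * nat)%type.
Definition tn (z : name) : leg := z.1.
Local Notation tw := (map tn).
Local Notation P := (perm_mor F S tn).

(** Three consecutive legs of a spider may be taken to come from one comultiplication, and
    [comul_rev] exchanges the outer two. *)
Lemma sp_rev ops p i j k q : uniq (p ++ [:: i; j; k] ++ q) ->
  tw (p ++ [:: i; j; k] ++ q) = altw LA (len ops).+2 ->
  act [::] (P (p ++ [:: k; j; i] ++ q) (p ++ [:: i; j; k] ++ q)) [::] (sp LA ops) = sp LA ops.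
Proof.
move=> uq et.
have ts := hom_cod (hom_sp F LA ops); rewrite -et in ts.
have pr : perm_eq [:: i; j; k] [:: k; j; i].
  by rewrite -[[:: k; j; i]]/(rev [:: i; j; k]) perm_sym perm_rev.
have uq2 : uniq ([:: i; j; k] ++ q) by move: uq; rewrite cat_uniq => /and3P[].
have uq3 : uniq [:: i; j; k] by move: uq2; rewrite cat_uniq => /and3P[].
rewrite act_P_catl ?perm_cat2r // ?cats0 //.
rewrite act_P_catr //; last by move: ts; rewrite map_cat ?cats0.
have et' : altw LA (len ops).+2 = tw p ++ [:: tn i, tn j, tn k & tw q] by rewrite -et map_cat.
have ej := altw_next et'.
have [ek e2] := altw_unsplit et'.
have l0 : len ops != 0.
  apply/eqP => l0; move: (congr1 size e2); rewrite size_altw l0 size_cat /= => /esym/eqP.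
  by rewrite addnS.
have [ops' [eo el]] := om_front hslide LA (len_Comul l0).
have E : act (tw p) (gm Comul (tn i)) (tw q) (sp LA ops') = sp LA ops.
  rewrite (sp_leg hslide Comul (x := LA) (p := tw p) (y := tn i) (v := tw q)).
    by rewrite /sp eo.
  by rewrite ek -e2 el.
have ts' : to (tw p ++ [:: tn i] ++ tw q) (sp LA ops').
  by rewrite /= ek -e2 el; apply: hom_cod (hom_sp F LA ops').
rewrite -E cats0 act_P3 //; last first.
  have := to_act (hom_gm F Comul (tn i)) ts'; rewrite /= ej -ek; exact.
by rewrite ej -ek comul_rev.
Qed.

Lemma tw_il s t : size s = size t -> all (fun z => tn z == LA) s ->
  all (fun z => tn z == LD) t -> tw (il s t) = altw LA (size s).*2.
Proof.
elim: s t => [|x s IHs] [|y t] //= [e] /andP[/eqP-> hs] /andP[/eqP-> ht].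
by rewrite IHs.
Qed.

(** Two neighbours of equal type have exactly one leg between them in the alternating word, so
    transposing them is an instance of [sp_rev]. *)
Lemma sp_perm ops s s' t t' : size s = size t -> uniq (il s t) ->
  all (fun z => tn z == LA) s -> all (fun z => tn z == LD) t ->
  (size s).*2 = (len ops).+2 -> perm_eq s s' -> perm_eq t t' ->
  act [::] (P (il s' t') (il s t)) [::] (sp LA ops) = sp LA ops.
Proof.
move=> est uq hA hD en ps pt.
have pil s1 t1 : perm_eq s s1 -> perm_eq t t1 -> perm_eq (il s t) (il s1 t1).
  move=> p1 p2; apply: (perm_trans (perm_il est)).
  apply: perm_trans (perm_cat p1 p2) _; rewrite perm_sym; apply: perm_il.
  by rewrite -(perm_size p1) -(perm_size p2).
have pil2 s1 t1 s2 t2 : perm_eq s s1 -> perm_eq t t1 -> perm_eq s s2 -> perm_eq t t2 ->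
    perm_eq (il s1 t1) (il s2 t2).
  by move=> p1 p2 p3 p4; apply: (perm_trans _ (pil _ _ p3 p4)); rewrite perm_sym; apply: pil.
have et s1 t1 : perm_eq s s1 -> perm_eq t t1 -> tw (il s1 t1) = altw LA (len ops).+2.
  move=> p1 p2; rewrite -en (perm_size p1); apply: tw_il.
  - by rewrite -(perm_size p1) -(perm_size p2).
  - by rewrite -(perm_all _ p1).
  - by rewrite -(perm_all _ p2).
have tsp : to ([::] ++ tw (il s t) ++ [::]) (sp LA ops).
  by rewrite cats0 et //; apply: hom_cod (hom_sp F LA ops).
have step s1 t1 w : perm_eq s s1 -> perm_eq t t1 ->
    act [::] (P (il s1 t1) (il s t)) [::] (sp LA ops) = sp LA ops ->
    perm_eq (il s1 t1) w ->
    act [::] (P w (il s1 t1)) [::] (sp LA ops) = sp LA ops ->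
    act [::] (P w (il s t)) [::] (sp LA ops) = sp LA ops.
  move=> p1 p2 e1 pw e2.
  by rewrite -(act_P_comp S uq (pil _ _ p1 p2) pw tsp) e1.
have ust s1 t1 : perm_eq s s1 -> perm_eq t t1 -> uniq (il s1 t1).
  by move=> p1 p2; rewrite -(perm_uniq (pil _ _ p1 p2)).
have [_ E1] : perm_eq s s' /\ act [::] (P (il s' t) (il s t)) [::] (sp LA ops) = sp LA ops.
  apply: (@perm_swap_ind _ (fun z => perm_eq s z /\
    act [::] (P (il z t) (il s t)) [::] (sp LA ops) = sp LA ops) s) => //.
    by split=> //; rewrite act_P_id.
  move=> p x y q [p1 e1].
  have p2 : perm_eq (p ++ [:: x, y & q]) (p ++ [:: y, x & q]).
    by rewrite perm_cat2l -(cat1s x) -(cat1s y) perm_catCA.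
  have p3 := perm_trans p1 p2; split=> //.
  have e : size t = size (p ++ [:: x, y & q]) by rewrite -est (perm_size p1).
  have [tp [[|d [|d' tq]] [et0 e2 e3]]] := size_split e; rewrite //= in e3.
  apply: (step _ _ _ p1 (perm_refl t) e1); first exact: pil2.
  have := et _ _ p1 (perm_refl t); have := ust _ _ p1 (perm_refl t).
  rewrite et0 !il_cat //=; exact: (@sp_rev ops (il p tp) x d y (d' :: il q tq)).
apply: (step s' t _ ps (perm_refl t) E1).
  exact: pil2.
have [_ E2] : perm_eq t t' /\ act [::] (P (il s' t') (il s' t)) [::] (sp LA ops) = sp LA ops.
  apply: (@perm_swap_ind _ (fun z => perm_eq t z /\
    act [::] (P (il s' z) (il s' t)) [::] (sp LA ops) = sp LA ops) t) => //.
    split=> //; rewrite act_P_id //; first exact: ust.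
    by rewrite cats0 et //; apply: hom_cod (hom_sp F LA ops).
  move=> p x y q [p1 e1].
  have p2 : perm_eq (p ++ [:: x, y & q]) (p ++ [:: y, x & q]).
    by rewrite perm_cat2l -(cat1s x) -(cat1s y) perm_catCA.
  have p3 := perm_trans p1 p2; split=> //.
  have e : size s' = size (p ++ [:: x, y & q]) by rewrite -(perm_size ps) est (perm_size p1).
  have [sp0 [[|a [|a' sq]] [es0 e2 e3]]] := size_split e; rewrite //= in e3.
  have pw : perm_eq (il s' (p ++ [:: x, y & q])) (il s' (p ++ [:: y, x & q])).
    exact: pil2.
  have pw0 : perm_eq (il s' t) (il s' (p ++ [:: x, y & q])).
    exact: pil2.
  have tsp' : to ([::] ++ tw (il s' t) ++ [::]) (sp LA ops).
    by rewrite cats0 et //; apply: hom_cod (hom_sp F LA ops).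
  rewrite -(act_P_comp S (ust _ _ ps (perm_refl t)) pw0 pw tsp') e1.
  have := et _ _ ps p1; have := ust _ _ ps p1.
  rewrite es0 !il_cat //=.
  have := @sp_rev ops (il sp0 p ++ [:: a]) x a' y (il sq q).
  by rewrite -!catA /=.
exact: E2.
Qed.

End Blocks.

(* A connected component of a state: its legs of type A and of type A^*, which are
   laid out alternately, its label, and the operations building its spider. *)
Record blk : Type := Blk {
  bA : seq name;
  bD : seq name;
  bc : nat;
  bo : seq op
}.

Definition wd (b : blk) : seq name := il (bA b) (bD b).
Definition flat (bs : seq blk) : seq name := flatten (map wd bs).

(** The predecessor covers two cases: [2n] legs with [n > 0] come from operations adding [2n - 2],
    while for no legs it gives 0, a two-legged spider that [blk_mor] closes with a cap. *)
Definition bok (b : blk) : bool :=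
  [&& size (bA b) == size (bD b), all (fun z => tn z == LA) (bA b),
      all (fun z => tn z == LD) (bD b) & len (bo b) == (size (bA b)).-1.*2].

Section States.
Variables (C : smcat) (F : frob3 C) (S : symmetry C).
Hypothesis hslide : sliding F.
Hypothesis hcomm : frob3_commutative F S.
Implicit Types (u v : seq leg) (f g e : mor C) (w : seq name) (b : blk) (bs : seq blk).
Local Notation act := (act F).
Local Notation hom := (hom F).
Local Notation to := (to F).
Local Notation idw := (idw F).
Local Notation sw := (sym_words F S).
Local Notation sp := (spider F).
Local Notation I1 := (idm (unito C)).
Local Notation tw := (map tn).
Local Notation P := (perm_mor F S tn).

Definition blk_mor b : mor C :=
  if bA b is [::] then act [::] (cap F LA) [::] (sp LA (bo b)) else sp LA (bo b).
Local Notation bm := blk_mor.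

Lemma tw_wd b : bok b -> tw (wd b) = altw LA (size (bA b)).*2.
Proof.
by case/and4P=> /eqP e hA hD _; apply: tw_il.
Qed.

Lemma hom_bm b : bok b -> hom [::] (tw (wd b)) (bm b).
Proof.
move=> ok; rewrite tw_wd // /bm; case/and4P: ok => /eqP e _ _ /eqP el.
have := hom_sp F LA (bo b); rewrite el; case: (bA b) => [|a s] //= h.
exact: (hom_act (u := [::]) (v := [::]) (hom_cap F LA) h).
Qed.

Fixpoint blks_mor bs : mor C :=
  if bs is b :: bs' then act [::] (bm b) (tw (flat bs')) (blks_mor bs') else I1.
Local Notation Z := blks_mor.

Lemma flat_cons b bs : flat (b :: bs) = wd b ++ flat bs. Proof. by []. Qed.
Lemma flat_cat bs bs' : flat (bs ++ bs') = flat bs ++ flat bs'.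
Proof. by rewrite /flat map_cat flatten_cat. Qed.

Lemma hom_Z bs : all bok bs -> hom [::] (tw (flat bs)) (Z bs).
Proof.
elim: bs => [|b bs IHbs] /=; first by move=> _; apply: (hom_idw F [::]).
by move=> /andP[ok /IHbs h]; rewrite flat_cons map_cat; apply: (hom_act (u := [::]) (hom_bm ok)).
Qed.

Lemma to_Z bs : all bok bs -> to (tw (flat bs)) (Z bs).
Proof. by move=> /hom_Z; apply: hom_cod. Qed.

(* [f] is obtained by permuting the legs of the components [bs] into the order [w]. *)
Record rep w f bs : Prop := Rep {
  rep_ok : all bok bs;
  rep_uniq : uniq (flat bs);
  rep_lbl : uniq (map bc bs);
  rep_perm : perm_eq (flat bs) w;
  rep_eq : f = act [::] (P w (flat bs)) [::] (Z bs)
}.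

Lemma rep_hom w f bs : rep w f bs -> hom [::] (tw w) f.
Proof.
case=> ok uq _ pw ->; have h := hom_P F S tn uq pw.
have := @hom_act _ F [::] [::] [::] _ _ _ (Z bs) h.
by rewrite !cats0; apply; apply: hom_Z.
Qed.

Lemma rep_change w f bs bs' : rep w f bs -> all bok bs' -> uniq (map bc bs') ->
  perm_eq (flat bs) (flat bs') -> Z bs' = act [::] (P (flat bs') (flat bs)) [::] (Z bs) ->
  rep w f bs'.
Proof.
move=> [ok uq ul pw ef] ok' ul' pb eZ.
have pw' : perm_eq (flat bs') w by apply: perm_trans pw; rewrite perm_sym.
split=> //; first by rewrite -(perm_uniq pb).
rewrite eZ act_P_comp //; rewrite /= cats0; exact: to_Z.
Qed.

Lemma rep_swap p x y q f bs : rep (p ++ [:: x, y & q]) f bs ->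
  rep (p ++ [:: y, x & q]) (act (tw p) (sw [:: tn x] [:: tn y]) (tw q) f) bs.
Proof.
move=> [ok uq ul pw ->]; split=> //.
  by apply: perm_trans pw _; rewrite perm_cat2l -(cat1s x) -(cat1s y) perm_catCA.
rewrite (act_P_swap S uq pw) ?cats0 //; rewrite /= ?cats0; exact: to_Z.
Qed.

(** Components have no inputs, so they can be created in any order; induction moves [b] past the
    blocks before it. *)
Lemma Z_front b bs1 bs2 : all bok (bs1 ++ b :: bs2) -> uniq (flat (bs1 ++ b :: bs2)) ->
  Z (b :: bs1 ++ bs2)
  = act [::] (P (flat (b :: bs1 ++ bs2)) (flat (bs1 ++ b :: bs2))) [::] (Z (bs1 ++ b :: bs2)).
Proof.
elim: bs1 => [|e bs1 IH] ok uq.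
  by rewrite act_P_id //= cats0; apply: (to_Z ok).
have /andP[oke ok1] : bok e && all bok (bs1 ++ b :: bs2) := ok.
have uq1 : uniq (flat (bs1 ++ b :: bs2)).
  by move: uq; rewrite cat_cons flat_cons cat_uniq => /and3P[].
have okb : bok b by move: ok1; rewrite all_cat /= => /andP[_ /andP[]].
have ok2 : all bok (b :: bs1 ++ bs2).
  by move: ok1; rewrite /= !all_cat /= => /and3P[-> -> ->].
have ok3 : all bok (bs1 ++ bs2) by case/andP: ok2.
have p1 : perm_eq (flat (bs1 ++ b :: bs2)) (flat (b :: bs1 ++ bs2)).
  by rewrite flat_cons !flat_cat flat_cons perm_catCA.
have uq2 : uniq (flat (b :: bs1 ++ bs2)) by rewrite -(perm_uniq p1).
have p2 : perm_eq (flat (b :: bs1 ++ bs2)) (flat (bs1 ++ b :: bs2)) by rewrite perm_sym.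
have tZ1 := to_Z ok1.
pose we := wd e; pose wb := wd b; pose v := flat (bs1 ++ bs2).
have uwb : uniq (we ++ wb ++ v).
  by rewrite (perm_uniq (_ : perm_eq _ (we ++ flat (bs1 ++ b :: bs2)))) // perm_cat2l.
have uwb' : uniq (wb ++ we ++ v) by rewrite uniq_catCA.
have e1 : Z (bs1 ++ b :: bs2)
  = act [::] (P (flat (bs1 ++ b :: bs2)) (flat (b :: bs1 ++ bs2))) [::] (Z (b :: bs1 ++ bs2)).
  by rewrite IH // act_P_inv //= cats0.
have tZ2 := to_Z ok2.
have tZ3 := to_Z ok3.
have e2 : Z ((e :: bs1) ++ b :: bs2)
  = act [::] (P (we ++ flat (bs1 ++ b :: bs2)) (we ++ wb ++ v)) [::]
      (act [::] (bm e) (tw (wb ++ v)) (Z (b :: bs1 ++ bs2))).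
  rewrite cat_cons [LHS]/= e1.
  have := @act_P_nat _ F S _ tn [::] [::] [::] we [::] (flat (bs1 ++ b :: bs2)) [::] (wb ++ v)
    (bm e) (Z (b :: bs1 ++ bs2)) (hom_bm oke) uq2 uwb p2.
  by rewrite /= !cats0; apply.
have e3 : act [::] (bm e) (tw (wb ++ v)) (Z (b :: bs1 ++ bs2))
  = act [::] (P (we ++ wb ++ v) (wb ++ we ++ v)) [::] (Z (b :: (e :: bs1) ++ bs2)).
  have tI : to ([::] ++ [::] ++ [::] ++ [::] ++ tw v) (Z (bs1 ++ bs2)) by [].
  have := act_exch (hom_bm oke) (hom_bm okb) tI.
  rewrite /= map_cat cats0 => ->.
  have te := to_act (u := [::]) (v := tw v) (hom_bm oke) tZ3.
  have := @act_P_nat _ F S _ tn [::] [::] [::] wb we v [::] (we ++ v)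
    (bm b) (act [::] (bm e) (tw v) (Z (bs1 ++ bs2))) (hom_bm okb).
  rewrite /= cats0 map_cat => <- //.
  - rewrite act_P_id ?cats0 ?map_cat //; by move: uwb'; rewrite cat_uniq => /and3P[].
  - by move: uwb'; rewrite cat_uniq => /and3P[].
rewrite e2 e3.
have p3 : perm_eq (wb ++ we ++ v) (we ++ wb ++ v) by rewrite perm_catCA.
have p4 : perm_eq (we ++ wb ++ v) (we ++ flat (bs1 ++ b :: bs2)) by rewrite perm_cat2l.
have tf : to ([::] ++ tw (wb ++ we ++ v) ++ [::]) (Z (b :: (e :: bs1) ++ bs2)).
  by rewrite cats0; apply: (to_Z (bs := [:: b, e & bs1 ++ bs2])); rewrite /= okb oke.
rewrite act_P_comp // cat_cons !flat_cons act_P_inv //.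
exact: perm_trans p3 p4.
Qed.

Lemma rep_front w f b bs1 bs2 : rep w f (bs1 ++ b :: bs2) -> rep w f (b :: bs1 ++ bs2).
Proof.
move=> r; have [ok uq ul pw _] := r.
apply: (rep_change r).
- by move: ok; rewrite /= !all_cat /= => /and3P[-> -> ->].
- by move: ul; rewrite !map_cat /= -(cat1s (bc b)) uniq_catCA map_cat.
- by rewrite flat_cons !flat_cat flat_cons perm_catCA.
exact: Z_front.
Qed.

Lemma bm_perm s s' t t' c ops : bok (Blk s t c ops) -> uniq (il s t) ->
  perm_eq s s' -> perm_eq t t' ->
  bm (Blk s' t' c ops) = P (il s' t') (il s t) ∘ bm (Blk s t c ops).
Proof.
move=> ok uq ps pt; have hb := hom_bm ok.
have /and4P[/= /eqP est hA hD /eqP el] := ok.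
case: s ps est hA el uq hb {ok} => [|a s] ps est hA el uq hb.
  have -> : s' = [::] by apply: size0nil; rewrite -(perm_size ps).
  have -> : t' = [::] by apply: size0nil; rewrite -(perm_size pt).
  rewrite (@P_id _ F S _ tn [::] isT).
  by rewrite (id_comp (hom_cod hb)).
have -> : bm (Blk s' t' c ops) = sp LA ops.
  by rewrite /bm /=; case: s' ps => // /perm_size.
rewrite -[bm _]/(sp LA ops) -(act0 F); symmetry; apply: (sp_perm hslide hcomm) => //.
by rewrite el.
Qed.

(** Within a component the order of the legs of each type is immaterial, so a chosen leg may be
    taken first or last. *)
Lemma rep_relabel w f s s' t t' c ops bs : rep w f (Blk s t c ops :: bs) ->
  perm_eq s s' -> perm_eq t t' -> rep w f (Blk s' t' c ops :: bs).
Proof.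
move=> r ps pt; have [ok uq ul pw _] := r.
have /= /andP[okb ok1] := ok; have /and4P[/= /eqP est hA hD /eqP el] := okb.
have pil : perm_eq (il s t) (il s' t').
  apply: (perm_trans (perm_il est)); apply: (perm_trans (perm_cat ps pt)).
  by rewrite perm_sym; apply: perm_il; rewrite -(perm_size ps) -(perm_size pt).
have okb' : bok (Blk s' t' c ops).
  by rewrite /bok /= -(perm_size ps) -(perm_size pt) -(perm_all _ ps) -(perm_all _ pt) est eqxx hA hD -est el eqxx.
apply: (rep_change r) => //.
- by rewrite /= okb'.
- by rewrite !flat_cons perm_cat2r.
have uil : uniq (il s t) by move: uq; rewrite flat_cons cat_uniq => /and3P[].
have hb := hom_bm okb.
have tZ : to ([::] ++ tw (wd (Blk s t c ops) ++ flat bs) ++ [::]) (Z (Blk s t c ops :: bs)).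
  by rewrite cats0; apply: (to_Z ok).
rewrite !flat_cons (act_P_catr S uq pil tZ) cats0 [in RHS]/=.
have t1 : to ([::] ++ [::] ++ tw (flat bs)) (Z bs) := to_Z ok1.
have hP := hom_P F S tn uil pil.
rewrite -(act_comp hb hP t1) [LHS]/=; congr (act _ _ _ _).
exact: bm_perm.
Qed.

End States.

Lemma map_cat_inv (T1 T2 : Type) (h : T1 -> T2) w a b : map h w = a ++ b ->
  exists w1 w2, [/\ w = w1 ++ w2, map h w1 = a & map h w2 = b].
Proof.
elim: a w => [|x a IHa] [|z w] //=; first by move=> <-; exists [::], [::].
  by move=> <-; exists [::], (z :: w).
by case=> <- /IHa[w1 [w2 [-> <- <-]]]; exists (z :: w1), w2.
Qed.

Lemma flat_split z bs : z \in flat bs -> exists bs1 b bs2, bs = bs1 ++ b :: bs2 /\ z \in wd b.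
Proof.
elim: bs => [//|b bs IHbs]; rewrite flat_cons mem_cat => /orP[zb|/IHbs].
  by exists [::], b, bs.
by case=> bs1 [b' [bs2 [-> zb]]]; exists (b :: bs1), b', bs2.
Qed.

Definition lok (l : name -> nat) (bs : seq blk) : bool :=
  all (fun b => all (fun z => l z == bc b) (wd b)) bs.

Lemma lok_repl l c1 c2 bs : c1 \notin map bc bs -> lok l bs -> lok (repl c1 c2 \o l) bs.
Proof.
elim: bs => //= b bs IHbs; rewrite in_cons => /norP[nc nbs] /andP[/allP o ol].
apply/andP; split; last exact: IHbs.
by apply/allP => z /o /= /eqP ->; rewrite /repl [bc b == c1]eq_sym (negPf nc) eqxx.
Qed.

Definition lw (l : name -> nat) (w : seq name) : lword := [seq (tn z, l z) | z <- w].

Lemma ty_lw l w : ty (lw l w) = map tn w.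
Proof. by rewrite /ty /lw -map_comp. Qed.
Lemma lb_lw l w : lb (lw l w) = map l w.
Proof. by rewrite /lb /lw -map_comp. Qed.
Lemma lw_cat l w w' : lw l (w ++ w') = lw l w ++ lw l w'.
Proof. exact: map_cat. Qed.
Lemma rl_lw h l w : rl h (lw l w) = lw (h \o l) w.
Proof. by rewrite /rl /lw -map_comp. Qed.

Lemma perm_wd b : bok b -> perm_eq (wd b) (bA b ++ bD b).
Proof. by case/and4P=> /eqP e _ _ _; apply: perm_il. Qed.

Lemma wd_A b z : bok b -> z \in wd b -> tn z = LA -> z \in bA b.
Proof.
move=> ok; rewrite (perm_mem (perm_wd ok)) mem_cat => /orP[//|zD] ez.
by case/and4P: ok => _ _ /allP /(_ _ zD); rewrite ez.
Qed.

Lemma wd_D b z : bok b -> z \in wd b -> tn z = LD -> z \in bD b.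
Proof.
move=> ok; rewrite (perm_mem (perm_wd ok)) mem_cat => /orP[zA|//] ez.
by case/and4P: ok => _ /allP /(_ _ zA); rewrite ez.
Qed.

Lemma eq_lw l l' w : {in w, l =1 l'} -> lw l w = lw l' w.
Proof. by move=> e; apply/eq_in_map => z zw; rewrite e. Qed.

Lemma lok_mem l bs z : lok l bs -> z \in flat bs -> l z \in map bc bs.
Proof.
elim: bs => //= b bs IHbs /andP[/allP o ol]; rewrite flat_cons mem_cat in_cons.
by case/orP=> [/o/eqP->|/(IHbs ol)->]; rewrite ?eqxx ?orbT.
Qed.

Lemma eq_lok l l' bs : {in flat bs, l =1 l'} -> lok l bs = lok l' bs.
Proof.
elim: bs => //= b bs IHbs e; rewrite IHbs; last first.
  by move=> z zbs; apply: e; rewrite flat_cons mem_cat zbs orbT.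
congr (_ && _); apply: eq_in_all => z zb; rewrite e //.
by rewrite flat_cons mem_cat zb.
Qed.

(** * Labelled symmetric states and their contractions *)

Section SymStates.
Variables (C : smcat) (F : frob3 C) (S : symmetry C).
Hypothesis hslide : sliding F.
Hypothesis hcomm : frob3_commutative F S.
Implicit Types (u v : seq leg) (f g e : mor C) (w : seq name) (b : blk) (bs : seq blk).
Local Notation act := (act F).
Local Notation hom := (hom F).
Local Notation to := (to F).
Local Notation idw := (idw F).
Local Notation sw := (sym_words F S).
Local Notation sp := (spider F).
Local Notation tw := (map tn).
Local Notation P := (perm_mor F S tn).
Local Notation rep := (rep F S).
Local Notation Z := (blks_mor F).
Local Notation bm := (blk_mor F).

Definition srep (l : name -> nat) (L : seq nat) w f bs : Prop :=
  [/\ rep w f bs, lok l bs & L =i map bc bs].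

Lemma srep_move l L w f b bs1 bs2 : srep l L w f (bs1 ++ b :: bs2) ->
  srep l L w f (b :: bs1 ++ bs2).
Proof.
move=> [r ol eL]; split.
- exact: rep_front.
- by move: ol; rewrite /lok /= !all_cat /= => /and3P[-> -> ->].
by move=> c; rewrite eL map_cat /= mem_cat !in_cons map_cat mem_cat orbCA.
Qed.

Lemma srep_front l L w f bs z : srep l L w f bs -> z \in w ->
  exists b bs', srep l L w f (b :: bs') /\ z \in wd b.
Proof.
move=> r zw; have [[_ _ _ pw _] _ _] := r.
have zf : z \in flat bs by rewrite (perm_mem pw).
have [bs1 [b [bs2 [ebs zb]]]] := flat_split zf; subst bs.
by exists b, (bs1 ++ bs2); split=> //; apply: srep_move.
Qed.

Lemma srep_relabel l L w f s s' t t' c ops bs : srep l L w f (Blk s t c ops :: bs) ->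
  perm_eq s s' -> perm_eq t t' -> srep l L w f (Blk s' t' c ops :: bs).
Proof.
move=> [r ol eL] ps pt; split=> //; first exact: (rep_relabel hslide hcomm r).
have /andP[ok _] : bok (Blk s t c ops) && all bok bs := rep_ok r.
case/and4P: ok => /= /eqP est _ _ _.
have pil : perm_eq (il s t) (il s' t').
  apply: (perm_trans (perm_il est)); apply: (perm_trans (perm_cat ps pt)).
  by rewrite perm_sym; apply: perm_il; rewrite -(perm_size ps) -(perm_size pt).
by move: ol; rewrite /lok /= /wd /= (perm_all _ pil).
Qed.

Lemma srep_A l L w f b bs z : srep l L w f (b :: bs) -> z \in wd b -> tn z = LA ->
  exists s, srep l L w f (Blk (z :: s) (bD b) (bc b) (bo b) :: bs).
Proof.
move=> r zb ez; have [[/andP[ok _] _ _ _ _] _ _] := r.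
have zA := wd_A ok zb ez; exists (rem z (bA b)).
by apply: (@srep_relabel _ _ _ _ (bA b) _ (bD b)) => //; [case: (b) r | apply: perm_to_rem].
Qed.

Lemma srep_D l L w f b bs z : srep l L w f (b :: bs) -> z \in wd b -> tn z = LD ->
  exists t, srep l L w f (Blk (bA b) (z :: t) (bc b) (bo b) :: bs).
Proof.
move=> r zb ez; have [[/andP[ok _] _ _ _ _] _ _] := r.
have zD := wd_D ok zb ez; exists (rem z (bD b)).
by apply: (@srep_relabel _ _ _ _ (bA b) _ (bD b)) => //; [case: (b) r | apply: perm_to_rem].
Qed.

(** If no legs remain, this is how [blk_mor] defines a component without legs; otherwise [sp_cap]
    applies. *)
Lemma bm_cap i j s t c ops : bok (Blk (i :: s) (j :: t) c ops) ->
  exists ops', act [::] (cap F LA) (tw (il s t)) (sp LA ops) = bm (Blk s t c ops')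
    /\ bok (Blk s t c ops').
Proof.
case/and4P=> /= /eqP [est] /andP[/eqP hi hA] /andP[/eqP hj hD] /eqP el.
have eA : altw LA (len ops).+2 = [:: LA, LD & tw (il s t)].
  by rewrite el (tw_il est hA hD).
case: s est hA el eA => [|a s] est hA el eA.
  by exists ops; have -> : t = [::] := size0nil (esym est); split=> //; rewrite /bok /= el.
have l0 : len ops != 0 by rewrite el.
have [ops' [e1 e2]] := sp_cap hslide (p := [::]) (y := LA) eA l0.
exists ops'; split=> //; apply/and4P; split=> //; first by apply/eqP.
move: (congr1 size e2); rewrite size_altw cat0s (tw_il est hA hD) size_altw => /= -[el'].
by rewrite -(eqn_add2l 2) -el'.
Qed.

Lemma rep_cap_same w1 w2 i j f s t c ops bs :
  rep (w1 ++ [:: i, j & w2]) f (Blk (i :: s) (j :: t) c ops :: bs) ->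
  exists ops', rep (w1 ++ w2) (act (tw w1) (cap F LA) (tw w2) f) (Blk s t c ops' :: bs).
Proof.
move=> r; have [/andP[okb ok] uq ul pw ef] := r.
have /and4P[/= /eqP [est] /andP[/eqP hi hA] /andP[/eqP hj hD] /eqP el] := okb.
set x := il s t ++ flat bs.
have eflat : flat (Blk (i :: s) (j :: t) c ops :: bs) = [:: i, j & x] by [].
have p2 : perm_eq x (w1 ++ w2).
  rewrite -(perm_cons j) -(perm_cons i); apply: (perm_trans pw).
  by rewrite -[[:: i, j & w2]]/([:: i; j] ++ w2) -[[:: i, j & w1 ++ w2]]/([:: i; j] ++ w1 ++ w2) perm_catCA.
have uqx : uniq x by move: uq; rewrite eflat /= => /and3P[].
have hc : hom (tw [:: i; j]) (tw [::]) (cap F LA) by rewrite /= hi hj; apply: hom_cap.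
have tZ := to_Z F (rep_ok r).
pose z := Z (Blk (i :: s) (j :: t) c ops :: bs).
have E : act (tw w1) (cap F LA) (tw w2) f
  = act [::] (P (w1 ++ w2) x) [::] (act [::] (cap F LA) (tw x) z).
  have := @act_P_nat _ F S _ tn [::] [::] [:: i; j] [::] w1 w2 [::] x _ z hc uq uqx p2.
  by rewrite ef eflat -/z /= !cats0 => <-.
have hs := hom_sp F LA ops.
have eA : altw LA (len ops).+2 = [:: LA, LD & tw (il s t)].
  by rewrite el (tw_il est hA hD).
have tb := to_Z F ok.
have E2 : act [::] (cap F LA) (tw x) z
  = act [::] (act [::] (cap F LA) (tw (il s t)) (sp LA ops)) (tw (flat bs)) (Z bs).
  rewrite /z [Z _]/= -[bm _]/(sp LA ops) /x map_cat.
  have hl : hom (altw LA (len ops).+2) (tw (il s t)) (lay F [::] (cap F LA) (tw (il s t))).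
    rewrite eA; exact: (hom_lay [::] (tw (il s t)) (hom_cap F LA)).
  have := act_comp (u := [::]) (v := tw (flat bs)) hs hl tb.
  by rewrite act_lay /= => <-.
have [ops' [eb okb']] := bm_cap okb.
exists ops'; split=> //=.
- by rewrite okb'.
- by rewrite E E2 eb.
Qed.

Lemma bm_sp b : bA b != [::] -> bm b = sp LA (bo b).
Proof. by rewrite /bm; case: (bA b). Qed.

(** With [i] last in its component and [j] first in the next, the two wires are adjacent and
    [merge_left] fuses the spiders. Their partners [a] and [d] become neighbours. *)
Lemma rep_cap_diff w1 w2 i j f s1 t1 a c1 ops1 s2 t2 d c2 ops2 bs :
  rep (w1 ++ [:: i, j & w2]) f
    [:: Blk (rcons s1 a) (rcons t1 i) c1 ops1, Blk (j :: s2) (d :: t2) c2 ops2 & bs] ->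
  rep (w1 ++ w2) (act (tw w1) (cap F LD) (tw w2) f)
    (Blk (rcons s1 a ++ s2) (t1 ++ d :: t2) c2 (ops1 ++ ops2) :: bs).
Proof.
move=> r; have [/and3P[ok1 ok2 ok] uq ul pw ef] := r.
have [/eqP/= est1 hA1 hD1 /eqP/= el1] := and4P ok1.
have [/eqP/= est2 hA2 hD2 /eqP/= el2] := and4P ok2.
move: est1 hA1 hD1 el1; rewrite /= !size_rcons !all_rcons /= => -[est1].
move=> /andP[/eqP ha hA1] /andP[/eqP hi hD1] el1.
case: est2 => est2; case/andP: hA2 => /eqP hj hA2; case/andP: hD2 => /eqP hd hD2.
(* The remaining legs of the two components, whose concatenation is the word of the fused one. *)
pose U := il s1 t1 ++ [:: a]; pose V := d :: il s2 t2.
have eU : il (rcons s1 a) (rcons t1 i) = U ++ [:: i].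
  by rewrite -!cats1 il_cat // /U -catA.
have eUV : il (rcons s1 a ++ s2) (t1 ++ d :: t2) = U ++ V.
  by rewrite -cats1 -catA il_cat // /U -catA.
have twU : tw U = altw LA (len ops1).+1.
  by rewrite altw_rcons el1 map_cat tw_il // iter_dual odd_double /= ha.
have twV : altw LA (len ops2).+2 = LA :: tw V.
  by rewrite el2 /= hd tw_il.
set b1 := Blk (rcons s1 a) _ _ _ in r ok1 uq ul pw ef.
set b2 := Blk (j :: s2) _ _ _ in r ok2 uq ul pw ef.
set b := Blk (rcons s1 a ++ s2) _ _ _.
have nb : bA b != [::] by rewrite /b /= -cats1 -catA; case: (s1).
have nb1 : bA b1 != [::] by rewrite /b1 /= -cats1; case: (s1).
have okb : bok b.
  rewrite /bok /b /= !size_cat size_rcons /= est1 est2 addSnnS eqxx !all_cat /= all_rcons ha hA1 hA2 /= hd hD1 hD2.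
  by rewrite len_cat el1 el2 est1 est2 doubleD !eqxx.
set x := flat bs.
have ef1 : flat [:: b1, b2 & bs] = U ++ [:: i; j] ++ V ++ x.
  by rewrite !flat_cons [wd b1]eU -!catA.
have ef2 : flat (b :: bs) = U ++ V ++ x by rewrite flat_cons [wd b]eUV -catA.
have p0 : perm_eq (U ++ V ++ x) (w1 ++ w2).
  rewrite -(perm_cons j) -(perm_cons i) -[[:: i, j & U ++ _]]/([:: i; j] ++ _).
  rewrite perm_catCA -ef1; apply: (perm_trans pw).
  by rewrite -[[:: i, j & w2]]/([:: i; j] ++ w2) -[[:: i, j & w1 ++ w2]]/([:: i; j] ++ w1 ++ w2) perm_catCA.
have uq1 := uq; rewrite ef1 in uq1.
have uq2 : uniq (U ++ V ++ x).
  by move: uq1; rewrite uniq_catCA /= => /and3P[].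
have hc : hom (tw [:: i; j]) (tw [::]) (cap F LD) by rewrite /= hi hj; apply: hom_cap.
have tZ := to_Z F (rep_ok r).
split; [by rewrite /= okb | by rewrite ef2 | | by rewrite ef2 | ].
  by case/andP: ul.
rewrite -[Z (b :: bs)]/(act [::] (bm b) (tw x) (Z bs)).
have ez : Z [:: b1, b2 & bs] = act [::] (sp LA ops1) (tw (wd b2) ++ tw x) (act [::] (bm b2) (tw x) (Z bs)).
  by rewrite -map_cat -(bm_sp nb1).
move: (Z [:: b1, b2 & bs]) ef tZ ez => z ef tZ ez.
have := @act_P_nat _ F S _ tn [::] [::] [:: i; j] [::] w1 w2 U (V ++ x) _ z hc uq1 uq2 p0.
rewrite ef ef1 ef2 cats0 /= cats0 => ->; last first.
  by move: tZ; rewrite ef1.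
congr (act _ _ _ _).
rewrite {}ez [tw (wd b2)]/= hj map_cat twU.
have tb := hom_act (u := [::]) (v := tw x) (hom_bm F ok2) (hom_Z F ok).
have := @merge_left _ F [::] (tw V ++ tw x) LA ops1 (act [::] (bm b2) (tw x) (Z bs)).
rewrite /= hd cats0 => -> //.
  have hs := hom_sp F LA ops2.
  have [e1 e2] := sp_om_leg hslide ops1 (x := LA) (p := [::]) twV.
  rewrite (bm_sp nb) -[bo b]/(ops1 ++ ops2) -e1 /=.
  rewrite [bm b2]bm_sp // -/x -!hd.
  have ho := hom_lay [::] (tw V) (hom_om F LA ops1).
  rewrite (act_comp (a := [::]) (b := LA :: tw V) _ ho) ?act_lay //.
  - by rewrite -twV.
  - exact: to_Z.
by move: (hom_cod tb); rewrite /= hj hd.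
Qed.

Lemma act_cap_flip u x v f : to (u ++ [:: x; dual x] ++ v) f ->
  act u (cap F x) v f = act u (cap F (dual x)) v (act u (sw [:: x] [:: dual x]) v f).
Proof.
move=> tf.
have hc : hom [:: dual x; x] [::] (cap F (dual x)).
  by have := hom_cap F (dual x); rewrite dualK.
rewrite -(act_comp (hom_sw F S [:: x] [:: dual x]) hc tf); congr (act _ _ _ _).
case: x {tf hc} => /=; last exact: eps'_sw.
by rewrite /sw /= !tenso1; case: hcomm.
Qed.

(** Reduces the contractions to one orientation of the cap: [LA] first within a component, [LD]
    first between two. *)
Lemma srep_flip l L w1 w2 i j f bs : srep l L (w1 ++ [:: i, j & w2]) f bs ->
  tn j = dual (tn i) ->
  exists f', srep l L (w1 ++ [:: j, i & w2]) f' bs /\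
    act (tw w1) (cap F (tn i)) (tw w2) f = act (tw w1) (cap F (tn j)) (tw w2) f'.
Proof.
move=> [r ol eL] e; have := rep_hom r; rewrite map_cat /= => /hom_cod tf.
exists (act (tw w1) (sw [:: tn i] [:: tn j]) (tw w2) f); split.
  by split=> //; apply: rep_swap.
by rewrite e -act_cap_flip // -e.
Qed.

Lemma srep_cap_same l L w1 w2 i j f b bs : srep l L (w1 ++ [:: i, j & w2]) f (b :: bs) ->
  i \in wd b -> j \in wd b -> tn i = LA -> tn j = LD ->
  exists bs', srep l L (w1 ++ w2) (act (tw w1) (cap F LA) (tw w2) f) bs'.
Proof.
move=> r ib jb ei ej.
have [s r1] := srep_A r ib ei.
have ok1 : bok (Blk (i :: s) (bD b) (bc b) (bo b)) by case: r1 => -[/andP[]].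
have ok0 : bok b by case: r => -[/andP[]].
have jD : j \in bD b := wd_D ok0 jb ej.
have jb1 : j \in wd (Blk (i :: s) (bD b) (bc b) (bo b)).
  by rewrite (perm_mem (perm_wd ok1)) mem_cat /= jD orbT.
have [t r2] := srep_D r1 jb1 ej.
have [r2' ol eL] := r2.
have [ops' r3] := rep_cap_same r2'.
exists (Blk s t (bc b) ops' :: bs); split=> //.
by move: ol; rewrite /lok /= => /andP[/and3P[_ _ ->]].
Qed.

Lemma srep_cap_diff l L w1 w2 i j f b1 b2 bs :
  srep l L (w1 ++ [:: i, j & w2]) f [:: b1, b2 & bs] ->
  i \in wd b1 -> tn i = LD -> tn j = LA -> (exists s, bA b2 = j :: s) ->
  exists bs', srep (repl (bc b1) (bc b2) \o l) (map (repl (bc b1) (bc b2)) L) (w1 ++ w2)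
    (act (tw w1) (cap F LD) (tw w2) f) bs'.
Proof.
move=> r ib ei ej [s2 es2].
have [t r1] := srep_D r ib ei.
have [[/and3P[ok1 ok2 ok] uq ul pw ef] ol eL] := r1.
have [a [s1 es1]] : exists a s1, bA b1 = a :: s1.
  by case/and4P: ok1 => /=; case: (bA b1) => // a s1 _ _ _ _; exists a, s1.
have [d [t2 et2]] : exists d t2, bD b2 = d :: t2.
  by case/and4P: ok2; rewrite es2; case: (bD b2) => // d t2 _ _ _ _; exists d, t2.
case: b2 es2 et2 r r1 ok2 uq ul pw ef ol eL => s2' t2' c2 ops2 /= -> ->.
move: ok1; rewrite es1; move: (bc b1) (bo b1) => c1 ops1 ok1 _ r1 ok2 uq ul pw ef ol eL.
have [r2 _ _] : srep l L (w1 ++ [:: i, j & w2]) f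
  [:: Blk (rcons s1 a) (rcons t i) c1 ops1, Blk (j :: s2) (d :: t2) c2 ops2 & bs].
  by apply: (srep_relabel r1); rewrite perm_sym perm_rcons.
have r3 := rep_cap_diff r2.
exists (Blk (rcons s1 a ++ s2) (t ++ d :: t2) c2 (ops1 ++ ops2) :: bs); split=> //.
- have okm : bok (Blk (rcons s1 a ++ s2) (t ++ d :: t2) c2 (ops1 ++ ops2)).
    by case/andP: (rep_ok r3).
  move: ol ul ok1 ok2; rewrite /lok => /and3P[/allP o1 /allP o2 o3] /= /and3P[nc1 _ _] ok1 ok2.
  apply/andP; split.
    apply/allP => z; rewrite (perm_mem (perm_wd okm)) /= => zm.
    have : (z \in wd (Blk (a :: s1) (i :: t) c1 ops1)) || (z \in wd (Blk (j :: s2) (d :: t2) c2 ops2)).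
      rewrite (perm_mem (perm_wd ok1)) (perm_mem (perm_wd ok2)) /=.
      move: zm; rewrite !(mem_cat, mem_rcons, in_cons).
      by case/orP=> [/orP[/orP[->|->]|->]|/orP[->|/orP[->|->]]]; rewrite ?orbT.
    rewrite /repl; case/orP => [/o1|/o2] /= /eqP ->; first by rewrite eqxx.
    by case: ifP.
  by apply: lok_repl => //; move: nc1; rewrite in_cons => /norP[].
move=> c /=; rewrite in_cons.
move: ul => /= /andP[]; rewrite in_cons => /norP[_ nc1] _.
apply/mapP/orP.
  case=> c0; rewrite eL /= !in_cons => /or3P[/eqP->|/eqP->|c0bs] ->.
  - by left; rewrite /repl eqxx.
  - by left; rewrite /repl; case: ifP.
  by right; rewrite /repl; case: eqP => // e; rewrite -e c0bs in nc1.
case=> [/eqP->|cbs].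
  by exists c1; rewrite ?eL ?mem_head // /repl eqxx.
exists c; first by rewrite eL /= !in_cons cbs !orbT.
by rewrite /repl; case: eqP => // e; rewrite -e cbs in nc1.
Qed.

Lemma srep_lbl l L w f b bs z : srep l L w f (b :: bs) -> z \in wd b -> l z = bc b.
Proof. by case=> _ /andP[/allP h _] _ /h /eqP. Qed.

Lemma srep_cap_diff' l L w1 w2 i j f b1 b2 bs :
  srep l L (w1 ++ [:: i, j & w2]) f [:: b1, b2 & bs] ->
  i \in wd b1 -> j \in wd b2 -> tn i = LD -> tn j = LA ->
  exists h bs', h (l i) = h (l j) /\ srep (h \o l) (map h L) (w1 ++ w2)
    (act (tw w1) (cap F LD) (tw w2) f) bs'.
Proof.
move=> r ib jb ei ej; have r1 := @srep_move _ _ _ _ b2 [:: b1] bs r.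
have [s r2] := srep_A r1 jb ej; have r3 := @srep_move _ _ _ _ b1 [:: _] bs r2.
have [|bs' r4] := srep_cap_diff r3 ib ei ej; first by exists s.
exists (repl (bc b1) (bc b2)), bs'; split=> //.
rewrite (srep_lbl r ib) (srep_lbl r1 jb) /repl eqxx.
by case: ifP.
Qed.

Lemma srep_cap l L w1 w2 i j f bs : srep l L (w1 ++ [:: i, j & w2]) f bs ->
  tn j = dual (tn i) ->
  exists h bs', h (l i) = h (l j) /\
    srep (h \o l) (map h L) (w1 ++ w2) (act (tw w1) (cap F (tn i)) (tw w2) f) bs'.
Proof.
move=> r e; have jw : j \in w1 ++ [:: i, j & w2] by rewrite mem_cat !in_cons eqxx !orbT.
have [b2 [bs2 [r2 jb]]] := srep_front r jw.
have [ib|ib] := boolP (i \in wd b2).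
  exists id; rewrite (srep_lbl r2 ib) (srep_lbl r2 jb) map_id.
  case ei: (tn i) e => ej.
    have [bs' r'] := srep_cap_same r2 ib jb ei ej; exists bs'; by split.
  have [f' [r3 ef]] := srep_flip r2 (etrans ej (congr1 dual (esym ei))).
  have [bs' r'] := srep_cap_same r3 jb ib ej ei; exists bs'; split=> //.
  by rewrite -ei ef ej.
have izf : i \in flat bs2.
  have [[_ _ _ pw _] _ _] := r2.
  have : i \in flat (b2 :: bs2) by rewrite (perm_mem pw) mem_cat mem_head orbT.
  by rewrite flat_cons mem_cat (negPf ib).
have [bsa [b1 [bsb [ebs {}ib]]]] := flat_split izf; subst bs2.
have r3 := @srep_move _ _ _ _ b1 (b2 :: bsa) bsb r2.
case ei: (tn i) e => ej; last exact: srep_cap_diff' r3 ib jb ei ej.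
have [f' [r4 ef]] := srep_flip r3 (etrans ej (congr1 dual (esym ei))).
have r5 := @srep_move _ _ _ _ b2 [:: b1] _ r4.
have [h [bs' [eh r6]]] := srep_cap_diff' r5 jb ib ej ei.
by exists h, bs'; split=> //; rewrite -ei ef ej.
Qed.

(** The split wire is first in its component, so [d] and [a] are inserted directly after it without
    disturbing the alternation. *)
Lemma rep_split w1 w2 i d a f s t c ops bs :
  rep (w1 ++ i :: w2) f (Blk (i :: s) t c ops :: bs) -> uniq [:: d; a] ->
  d \notin w1 ++ i :: w2 -> a \notin w1 ++ i :: w2 -> tn d = LD -> tn a = LA ->
  rep (w1 ++ [:: i, d, a & w2]) (act (tw w1) (fw F) (tw w2) f)
    (Blk [:: i, a & s] (d :: t) c (Comul :: ops) :: bs).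
Proof.
move=> r uda nd na hd ha; have [/andP[okb ok] uq ul pw ef] := r.
have [t0 [t1 et]] : exists t0 t1, t = t0 :: t1.
  by case/and4P: okb => /=; case: (t) => // t0 t1 _ _ _ _; exists t0, t1.
subst t; set b := Blk (i :: s) _ _ _ in r okb uq pw ef ul.
set b' := Blk [:: i, a & s] _ _ _.
have [/eqP/= est /andP[/eqP hi hA] hD /eqP el] := and4P okb.
have ok' : bok b'.
  apply/and4P; split.
  - by apply/eqP; rewrite /= est.
  - by rewrite /= hi ha.
  - by rewrite /= hd.
  - by rewrite len_cons el.
pose x := t0 :: il s t1 ++ flat bs.
have e1 : flat (b :: bs) = [::] ++ [:: i] ++ x by [].
have e2 : flat (b' :: bs) = [::] ++ [:: i; d; a] ++ x by [].
have p0 : perm_eq ([::] ++ x) (w1 ++ w2).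
  rewrite -(perm_cons i); apply: (perm_trans pw).
  by rewrite -[i :: w2]/([:: i] ++ w2) -[i :: w1 ++ w2]/([:: i] ++ w1 ++ w2) perm_catCA.
have p1 : perm_eq ([::] ++ [:: i; d; a] ++ x) (w1 ++ [:: i; d; a] ++ w2).
  by rewrite perm_sym perm_catCA perm_cat2l perm_sym.
have uq2 : uniq ([::] ++ [:: i; d; a] ++ x).
  have p2 : perm_eq ([::] ++ [:: i; d; a] ++ x) ([:: d; a] ++ [:: i] ++ x) by apply/permPl; apply: (perm_catCA [:: i] [:: d; a] x).
  rewrite (perm_uniq p2) cat_uniq uda; apply/and3P; split=> //.
  apply/hasPn => z; rewrite -[[:: i] ++ x]/(flat (b :: bs)) (perm_mem pw) !inE => zw; apply/norP.
  by split; apply: contraTneq zw => ->.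
have hg : hom (tw [:: i]) (tw [:: i; d; a]) (fw F) by rewrite /= hi hd ha; apply: hom_fw.
have tZ := to_Z F (rep_ok r).
split=> //; first by rewrite /= ok'.
rewrite -[Z (b' :: bs)]/(act [::] (sp LA (Comul :: ops)) (tw (flat bs)) (Z bs)).
have ez : Z (b :: bs) = act [::] (sp LA ops) (tw (flat bs)) (Z bs) by [].
move: (Z (b :: bs)) ef tZ ez => z ef tZ ez.
have := @act_P_nat _ F S _ tn [::] [::] _ _ w1 w2 [::] x _ z hg uq uq2 p0.
rewrite -e1 -e2 !cats0 -ef [[::] ++ _]/= => -> //.
congr (act _ _ _ _); rewrite ez.
have eA : altw LA (len ops).+2 = LA :: tw (t0 :: il s t1).
  by have := tw_wd okb; rewrite el -doubleS /= hi => <-.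
have hl := hom_lay [::] (tw (t0 :: il s t1)) (hom_fw F).
rewrite -(sp_leg hslide Comul (p := [::]) eA).
have hs := hom_sp F LA ops; rewrite eA in hs.
rewrite (act_comp (u := [::]) (v := tw (flat bs)) hs hl) ?act_lay /=; last exact: to_Z.
by rewrite map_cat.
Qed.

Lemma rep_cup w1 w2 d a f c bs : rep (w1 ++ w2) f bs -> a != d ->
  d \notin w1 ++ w2 -> a \notin w1 ++ w2 -> tn d = LD -> tn a = LA -> c \notin map bc bs ->
  rep (w1 ++ [:: a, d & w2]) (act (tw w1) (eta' F) (tw w2) f) (Blk [:: a] [:: d] c [::] :: bs).
Proof.
move=> r nad nd na hd ha nc; have [ok uq ul pw ef] := r.
set b := Blk _ _ _ _; set x := flat bs.
have e1 : flat (b :: bs) = [::] ++ [:: a; d] ++ x by [].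
have ok' : bok b by rewrite /bok /= ha hd.
have tZ := to_Z F ok.
have hg : hom (tw [::]) (tw [:: a; d]) (eta' F) by rewrite /= ha hd; apply: hom_eta'.
have uq2 : uniq ([::] ++ [:: a; d] ++ x).
  by rewrite /= uq !inE !(perm_mem pw) (negPf nd) (negPf na) (negPf nad).
split=> //=; first by rewrite ok'.
- by rewrite nc.
- by rewrite -[flat _]/([:: a; d] ++ x) -[[:: a, d & w2]]/([:: a; d] ++ w2) perm_sym perm_catCA perm_cat2l perm_sym.
have := @act_P_nat _ F S _ tn [::] [::] _ _ w1 w2 [::] x _ (Z bs) hg uq uq2 pw.
rewrite -e1 /= !cats0 -ef => -> //.
by congr (act _ _ _ _); rewrite /bm /= sp_nil.
Qed.

Lemma eta_sw : eta F = sw [:: LA] [:: LD] ∘ eta' F.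
Proof.
rewrite (eta'_sw hcomm) (compA_hom (hom_sw F S [:: LD] [:: LA])).
- by rewrite swK id_comp //; apply: hom_cod (hom_eta F).
- by case: (hom_sw F S [:: LA] [:: LD]).
exact: hom_cod (hom_eta F).
Qed.

(** One number names both new wires, which differ in type. *)
Definition fresh_id (w : seq name) : nat := fresh (map snd w).

Lemma fresh_idP w (x : leg) : (x, fresh_id w) \notin w.
Proof. by apply/negP => /(map_f snd); apply/negP; apply: freshP. Qed.

Lemma fresh_id_neq w z : z \in w -> (z.2 == fresh_id w) = false.
Proof.
by move=> zw; apply/eqP => e; have := freshP (map snd w); rewrite -[fresh _]/(fresh_id w) -e map_f.
Qed.

Definition sym_state (L : seq nat) (w0 : lword) (f : mor C) : Prop :=
  exists w bs l, srep l L w f bs /\ w0 = lw l w.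

Lemma sym_closed : closed_states F sym_state.
Proof.
split.
- move=> L w0 f [w [bs [l [[r ol eL] ->]]]] c; rewrite lb_lw eL => /mapP[z zw ->].
  by apply: lok_mem => //; have [_ _ _ pw _] := r; rewrite (perm_mem pw).
- by move=> L w0 f [w [bs [l [[r _ _] ->]]]]; rewrite ty_lw; apply: rep_hom r.
- exists [::], [::], (fun _ => 0); split=> //; split=> //; split=> //.
  by rewrite act_id //; apply: hom_cod (hom_idw F [::]).
- move=> L w1' w2' f c x [w [bs [l [[r ol eL] /esym/map_cat_inv[w1 [w2 [ew e1 e2]]]]]]] nc.
  subst w w1' w2'; set w := w1 ++ w2; have [_ _ _ pw _] := r.
  pose l' := fun z : name => if z.2 == fresh_id w then c else l z.
  pose a : name := (LA, fresh_id w); pose d : name := (LD, fresh_id w).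
  have el : {in w, l =1 l'} by move=> z zw; rewrite /l' fresh_id_neq.
  have r1 := @rep_cup w1 w2 d a f c bs r isT (fresh_idP _ _) (fresh_idP _ _) erefl erefl.
  have {}r1 : srep l' (c :: L) (w1 ++ [:: a, d & w2]) (act (tw w1) (eta' F) (tw w2) f)
     (Blk [:: a] [:: d] c [::] :: bs).
    split; first by apply: r1; rewrite -eL.
      rewrite /lok /= {1 2}/l' /= !eqxx /= -/(lok l' bs) -(@eq_lok l) //.
      by move=> z; rewrite (perm_mem pw); apply: el.
    by move=> z; rewrite !in_cons eL.
  have ew1 : lw l w1 = lw l' w1 by apply: eq_lw => z zw; apply: el; rewrite mem_cat zw.
  have ew2 : lw l w2 = lw l' w2 by apply: eq_lw => z zw; apply: el; rewrite mem_cat zw orbT.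
  (* The new component is built from [eta']; for [eta] its two wires are exchanged afterwards. *)
  rewrite -!/(lw l _) ew1 ew2 !ty_lw; case: x.
    exists (w1 ++ [:: d, a & w2]), (Blk [:: a] [:: d] c [::] :: bs), l'; split; last first.
      by rewrite lw_cat /lw /= /l' /= eqxx.
    have [r2 ol2 eL2] := r1; split=> //.
    have := rep_swap r2; rewrite /tn /=.
    have t2 := hom_cod (rep_hom r); rewrite map_cat in t2.
    rewrite -(act_comp (u := tw w1) (v := tw w2) (hom_eta' F) (hom_sw F S [:: LA] [:: LD])) //.
    by rewrite -eta_sw.
  exists (w1 ++ [:: a, d & w2]), (Blk [:: a] [:: d] c [::] :: bs), l'; split=> //.
  by rewrite lw_cat /lw /= /l' /= eqxx.
- move=> L w1' w2' f c [w [bs [l [r0 /esym/map_cat_inv[w1 [[|i w2] [ew e1 e2]]]]]]] //.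
  case: e2 => ei eli e2; subst w w1' w2' c; set w := w1 ++ i :: w2.
  have iw : i \in w by rewrite mem_cat mem_head orbT.
  have [b [bs1 [r1 ib]]] := srep_front r0 iw.
  have [s r2] := srep_A r1 ib ei; have eb := srep_lbl r1 ib.
  have [r ol eL] := r2; have [_ _ _ pw _] := r.
  pose l' := fun z : name => if z.2 == fresh_id w then l i else l z.
  pose a : name := (LA, fresh_id w); pose d : name := (LD, fresh_id w).
  have el : {in w, l =1 l'} by move=> z zw; rewrite /l' fresh_id_neq.
  have r3 := @rep_split w1 w2 i d a f _ _ _ _ _ r isT (fresh_idP _ _) (fresh_idP _ _) erefl erefl.
  have ew1 : lw l w1 = lw l' w1 by apply: eq_lw => z zw; apply: el; rewrite mem_cat zw.
  have ew2 : lw l w2 = lw l' w2.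
    by apply: eq_lw => z zw; apply: el; rewrite mem_cat in_cons zw !orbT.
  rewrite -!/(lw l _) ew1 ew2 !ty_lw.
  exists (w1 ++ [:: i, d, a & w2]), (Blk [:: i, a & s] (d :: bD b) (bc b) (Comul :: bo b) :: bs1), l'.
  split; last by rewrite lw_cat /lw /= -(el i iw) ei /l' /= eqxx.
  split=> //; have := ol; rewrite (eq_lok (l' := l')); last first.
    by move=> z; rewrite (perm_mem pw); apply: el.
  move=> /andP[o1 o2]; apply/andP; split; last exact: o2.
  move: o1; rewrite /wd /=.
  have li : l' i = bc b by rewrite -(el i iw).
  have ld : l' d = bc b by rewrite /l' /= eqxx.
  have la : l' a = bc b by rewrite /l' /= eqxx.
  case: (bD b) => [|t0 t1] /=; first by rewrite li ld eqxx.
  by move=> /and3P[-> -> ->]; rewrite ld la eqxx.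
- move=> L w1' w2' f y a b [w [bs [l [r /esym/map_cat_inv[w1 [[|i [|j w2]] [ew e1 e2]]]]]]] //.
  case: e2 => ei ea ej eb e2; subst w w1' w2' a b y.
  have [h [bs' [eh r']]] := srep_cap r ej.
  exists h; split=> //; exists (w1 ++ w2), bs', (h \o l); split=> //.
    by rewrite -!/(lw l _) !ty_lw.
  by rewrite -!/(lw l _) -lw_cat rl_lw.
Qed.

End SymStates.

(** * Normal forms up to bending and symmetries *)

Section Equivalence.
Variables (C : smcat) (F : frob3 C) (S : symmetry C).
Implicit Types (u v w : seq leg) (f g : mor C) (X Y : lmor C).
Local Notation act := (act F).
Local Notation hom := (hom F).
Local Notation to := (to F).
Local Notation idw := (idw F).
Local Notation sw := (sym_words F S).
Local Notation tw := (map tn).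
Local Notation P := (perm_mor F S tn).
Local Notation eqv := (equivalent F S).

Lemma obtained_trans X Y W : obtained_from F S X Y -> obtained_from F S Y W -> obtained_from F S X W.
Proof. by move=> xy; elim=> // W1 W2 _ xw; apply: ObtainedStep. Qed.

Lemma obtained_step X Y : bend_or_permute F S X Y -> obtained_from F S X Y.
Proof. by move=> xy; apply: ObtainedStep xy; apply: ObtainedRefl. Qed.

Lemma eqv_refl X : eqv X X.
Proof. by split; apply: ObtainedRefl. Qed.

Lemma eqv_sym X Y : eqv X Y -> eqv Y X.
Proof. by case. Qed.

Lemma eqv_trans X Y W : eqv X Y -> eqv Y W -> eqv X W.
Proof. by move=> [a b] [c d]; split; [apply: obtained_trans c | apply: obtained_trans b]. Qed.

Lemma bend_in_leftE x u f :
  bend_in_left F x u f = lay F [:: dual x] f [::] ∘ lay F [::] (cup F x) u.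
Proof. by rewrite /bend_in_left /lay idw0 idw1 tensm1 tens1m. Qed.

Lemma bend_in_leftK x u v f : hom (x :: u) v f ->
  bend_out_left F (dual x) v (bend_in_left F x u f) = f.
Proof.
move=> hf; rewrite bend_in_leftE.
have hl := hom_lay [::] u (hom_cup F x).
have hr := hom_lay [:: dual x] [::] hf; rewrite !cats0 in hr.
set g := _ ∘ _; have hg : hom u (dual x :: v) g := hom_comp hr hl.
have ti : to (x :: u) (idw (x :: u)) by apply: hom_cod (hom_idw F _).
have -> : bend_out_left F (dual x) v g
  = act [::] (cap F x) v (act [:: x] g [::] (idw (x :: u))).
  rewrite /act; have h1 := hom_lay [:: x] [::] hg; rewrite !cats0 in h1.
  by rewrite (comp_id h1) /bend_out_left dualK /lay idw0 idw1 tens1m tensm1.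
rewrite /g (act_comp (u := [:: x]) (v := [::]) hl hr); last by rewrite cats0.
rewrite !act_lay /= cats0.
have := @act_exch _ F [::] [::] [::] [:: x; dual x] [::] (x :: u) v _ f
  (act [:: x] (cup F x) u (idw (x :: u))) (hom_cap F x) hf.
rewrite !cats0 /= => ->; last first.
  exact: (to_act (u := [:: x]) (v := u) (hom_cup F x) ti).
have := @snake_a _ F [::] u (dual x) (idw (x :: u)).
rewrite /cq /cp dualK /= => -> //.
by rewrite act0 (comp_id hf).
Qed.

Lemma bendl_cons x u v f : hom (x :: u) v f ->
  bendl F (x :: u) f = bendl F u (bend_in_left F x u f).
Proof.
move=> hf; rewrite /bendl ustar_cons bend_in_leftE.
have hl := hom_lay [::] u (hom_cup F x).
have hr := hom_lay [:: dual x] [::] hf; rewrite !cats0 in hr.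
rewrite (act_comp (u := ustar u) (v := [::]) hl hr) ?act_lay /= ?cats0 //.
exact: hom_cod (hom_cups F u).
Qed.

(** The inputs are bent one at a time, and [bend_in_leftK] makes each step reversible. *)
Lemma eqv_bendl u v f : hom u v f -> eqv (LMor u v f) (LMor [::] (ustar u ++ v) (bendl F u f)).
Proof.
elim: u v f => [|x u IHu] v f hf.
  by rewrite /bendl /= act0 (comp_id hf); apply: eqv_refl.
have hl := hom_lay [::] u (hom_cup F x).
have hr := hom_lay [:: dual x] [::] hf; rewrite !cats0 in hr.
have hg := hom_comp hr hl; rewrite -bend_in_leftE in hg.
rewrite (bendl_cons hf) ustar_cons -catA; apply: eqv_trans (IHu _ _ hg).
split; apply: obtained_step; first exact/StepBendIn/BendInLeft.
apply: StepBendOut; have := BendOutLeft F (dual x) u v (bend_in_left F x u f).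
by rewrite bend_in_leftK // dualK.
Qed.

Lemma swap_atE u x y v f : swap_at F S u x y v ∘ f = act u (sw [:: x] [:: y]) v f.
Proof. by rewrite /act /lay /sw /= !tenso1. Qed.

Lemma eqv_swap u v x y f : to (u ++ [:: x, y & v]) f ->
  eqv (LMor [::] (u ++ [:: x, y & v]) f)
      (LMor [::] (u ++ [:: y, x & v]) (act u (sw [:: x] [:: y]) v f)).
Proof.
move=> tf; split; apply: obtained_step; first by rewrite -swap_atE; apply: StepSymOut.
have := StepSymOut F S y x [::] u v (act u (sw [:: x] [:: y]) v f).
by rewrite swap_atE act_swK.
Qed.

Lemma eqv_P (w w' : seq name) f : uniq w -> perm_eq w w' -> to (tw w) f ->
  eqv (LMor [::] (tw w) f) (LMor [::] (tw w') (act [::] (P w' w) [::] f)).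
Proof.
move=> uw pw tf.
suff [] : perm_eq w w' /\
  eqv (LMor [::] (tw w) f) (LMor [::] (tw w') (act [::] (P w' w) [::] f)) by [].
apply: (@perm_swap_ind _ (fun z => perm_eq w z /\
  eqv (LMor [::] (tw w) f) (LMor [::] (tw z) (act [::] (P z w) [::] f))) _ _ _ _ pw).
  by split=> //; rewrite act_P_id ?cats0 //; apply: eqv_refl.
move=> p x y q [p1 e1].
have p2 : perm_eq w (p ++ [:: y, x & q]).
  by apply: perm_trans p1 _; rewrite perm_cat2l -(cat1s x) -(cat1s y) perm_catCA.
split=> //; apply: eqv_trans e1 _.
rewrite (act_P_swap S uw p1) ?cats0 // !map_cat /=; apply: eqv_swap.
by have := hom_to (hom_P F S tn uw p1) tf; rewrite act0 map_cat.
Qed.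

(** The spider arises by bending the only input to the right; bending it back is a case of
    [merge_left]. *)
Lemma eqv_sp ops :
  eqv (LMor [:: LA] (altw LA (len ops).+1) (ops_mor F LA ops))
      (LMor [::] (altw LA (len ops).+2) (spider F LA ops)).
Proof.
rewrite altw_even cats1; split; apply: obtained_step.
  apply: StepBendIn; have := BendInRight F LA [::] (altw LA (len ops).+1) (ops_mor F LA ops).
  by rewrite /bend_in_right /spider /act /lay idw0 !tens1m idw1.
apply: StepBendOut.
have := BendOutRight F LD [::] (altw LA (len ops).+1) (spider F LA ops).
have ti : to [:: LA] (idw [:: LA]) by apply: hom_cod (hom_idw F _).
have hs := hom_lay [::] [:: LA] (hom_sp F LA ops).
have := @merge_left _ F [::] [::] LA ops (idw [:: LA]) ti.
rewrite /= (act_nil (hom_om F LA ops)) => <-.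
by rewrite /bend_out_right {2}/act (comp_id hs) /act /lay idw0 tens1m tensm1 idw1.
Qed.

End Equivalence.

(** * Normal forms of connected symmetric diagrams *)

Section SymmetricTheorem.
Variables (C : smcat) (F : frob3 C) (S : symmetry C).
Hypothesis hslide : sliding F.
Hypothesis hcomm : frob3_commutative F S.
Local Notation act := (act F).
Local Notation hom := (hom F).
Local Notation to := (to F).
Local Notation idw := (idw F).
Local Notation tw := (map tn).
Local Notation eqv := (equivalent F S).

Lemma hom_cpiece (g : gen cfrob3_sig) : hom (gin g) (gout g) (cpiece_mor F S g).
Proof.
case: g => [p|x y]; first exact: hom_piece.
by have := hom_sw F S [:: x] [:: y]; rewrite /sym_words /= !tenso1.
Qed.

(** A crossing merges nothing: each strand keeps its label and only the order of the wires
    changes. *)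
Lemma acts_cfrob3 (g : gen cfrob3_sig) :
  acts F (sym_state F S) (gin g) (gout g) (fun _ _ : gstrand g => false)
    (gstrand_in g) (gstrand_out g) (cpiece_mor F S g).
Proof.
case: g => [p|x y]; first exact: (acts_piece (sym_closed hslide hcomm)).
move=> L w1 [|a [|b []]] // w2 f _ [w [bs [l [[r ol eL] e0]]]].
have [v1 [[|i [|j v2]] [ew e1 e2]]] := map_cat_inv (esym e0); rewrite //= in e2.
case: e2 => ei ea ej eb e2.
have hL z : z \in w -> l z \in L.
  by move=> zw; rewrite eL; apply: lok_mem => //; rewrite (perm_mem (rep_perm r)).
exists id, (fun s => if s then a else b), L; split=> //=; last first.
- by move=> c cL; left; exists c.
- by case; [rewrite -ea|rewrite -eb]; apply: hL; rewrite ew mem_cat !in_cons eqxx ?orbT.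
exists (v1 ++ [:: j, i & v2]), bs, l; split; last first.
  by rewrite !rl_id // lw_cat -e1 -e2 /= ei ea ej eb.
subst w; split=> //; have := rep_swap r.
by rewrite /sym_words /= !tenso1 ei ej -e1 -e2 -!/(lw l _) !ty_lw.
Qed.

Lemma connected_component (t : term cfrob3_sig) : is_diagram t ->
  exists w b, rep F S w (bendl F (tin t) (eval F (cpiece_mor F S) t)) [:: b] /\
    tw w = ustar (tin t) ++ tout t.
Proof.
move=> [wt ct]; have [t0 _] := ct.
have sg (g : gen cfrob3_sig) : size (gstrand_out g) = size (gout g).
  by case: g => //= p; rewrite size_nseq.
have [L [w0 [[w [bs [l [[r ol eL] ->]]]] ew cL /(_ t0) L0]]] :=
  connected_state (G := cfrob3_sig) (sym_closed hslide hcomm) hom_cpiece sg acts_cfrob3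
    wt (connected_label ct).
exists w; rewrite -(ty_lw l) -ew; have ul := rep_lbl r; move: ul eL r {ol}.
(* Components have distinct labels, connectedness leaves at most one label, and nonemptiness gives
   at least one. *)
case: bs => [|b [|b' bs]] ul eL r.
- by case: L L0 eL {cL} => // c L _ /(_ c); rewrite mem_head.
- by exists b.
move: ul; rewrite /= in_cons (cL (bc b) (bc b')) ?eqxx //.
  by rewrite eL /= mem_head.
by rewrite eL /= !in_cons eqxx orbT.
Qed.

(** Since [lam F = rho F], the two powers of loops combine into one, as the normal form without legs
    demands. *)
Lemma om_loops ops : len ops = 0 ->
  exists k, ops_mor F LA ops = endo_pow F (lam F) k.
Proof.
move=> l0; have [q [k [k' [-> el]]]] := om_sort hslide LA ops.
have -> : q = 0 by case: q el => // q; rewrite l0.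
exists (k' + k); rewrite cat0s om_cat; last by elim: k.
rewrite !om_loop -(lam_rho hcomm).
have h n : hom [:: LA] [:: LA] (endo_pow F (lam F) n).
  have := hom_om F LA (nseq n (Loop true)); rewrite om_loop.
  by have -> : len (nseq n (Loop true)) = 0 by elim: n.
elim: k' => [|k' IHk]; first by rewrite -[endo_pow F _ 0]/(idm (obj F LA)) -idw1 id_comp //; apply: hom_cod (h k).
rewrite addSn [endo_pow _ _ _.+1]/= [RHS]/= -IHk (compA_hom (h k')) //.
  by have [] := hom_lam F.
exact: hom_cod (h k).
Qed.

Lemma component_nf b : bok b ->
  exists Y, eqv (LMor [::] (tw (wd b)) (blk_mor F b)) Y /\ comm_normal_form F Y.
Proof.
move=> ok; rewrite (tw_wd ok) /blk_mor; have /and4P[_ _ _ /eqP el] := ok.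
case: (bA b) el => [|a s] el.
  have [k ek] := om_loops el; eexists; split; first exact: eqv_refl.
  right; exists k; rewrite act0 /spider /act ek /lay idw0 tens1m idw1 /=.
  congr LMor; rewrite (compA_hom (F := F) (a := [:: LA; LD]) (b := [:: LA; LD])) //.
  - have := hom_lay [::] [:: LD] (hom_om F LA (bo b)); rewrite el ek /= /lay idw0 tens1m idw1.
    exact.
  - by have [] := hom_eps F.
  exact: hom_cod (hom_eta' F).
have -> : altw LA (size (a :: s)).*2 = altw LA (len (bo b)).+2 by rewrite el.
eexists; split; first exact: eqv_sym (eqv_sp F S (bo b)).
left; have [q [k [k' [-> ->]]]] := om_sort hslide LA (bo b).
(* Exactly one leg was bent back into an input, hence [p = 0]. *)
exists 0, q, k, k'; rewrite -nf_word_altw om_sorted //; congr LMor.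
rewrite -[mpow F 0]/(idm (obj F LA)) -idw1 -(om_sorted hslide).
by rewrite (comp_id (hom_om F LA _)).
Qed.

Lemma symmetric_theorem (t : term cfrob3_sig) : is_diagram t ->
  exists Y, eqv (denote F (cpiece_mor F S) t) Y /\ comm_normal_form F Y.
Proof.
move=> dt; have [wt _] := dt.
have [w [b [r ew]]] := connected_component dt.
have [/andP[ok _] uq _ pw ef] := r.
have [Y [e1 nf]] := component_nf ok; exists Y; split=> //; apply: eqv_trans e1.
have ht := hom_eval (G := cfrob3_sig) hom_cpiece wt.
apply: eqv_trans (eqv_bendl S ht) _; apply: eqv_sym.
rewrite -ew ef.
have ez : blks_mor F [:: b] = blk_mor F b.
  by rewrite /= (act_nil (hom_bm F ok)).
have efl : flat [:: b] = wd b by rewrite flat_cons cats0.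
rewrite efl in uq pw; rewrite ez efl; apply: eqv_P => //.
exact: hom_cod (hom_bm F ok).
Qed.

End SymmetricTheorem.

Theorem theorem5p11 (C : smcat) (F : frob3 C) (hslide : sliding F) :
  (forall d : term frob3_sig,
     is_diagram d -> 0 < size (tin d) ->
     exists Y : lmor C,
       bent_at_most_one F (denote F (piece_mor F) d) Y /\ normal_form F Y) /\
  (forall S : symmetry C, frob3_commutative F S ->
   forall d : term cfrob3_sig,
     is_diagram d ->
     exists Y : lmor C,
       equivalent F S (denote F (cpiece_mor F S) d) Y /\ comm_normal_form F Y).
Proof.
split; first exact: planar_theorem.
by move=> S hcomm d; apply: symmetric_theorem.
Qed.
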